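(* Let $\alpha : [0,1] \to \mathbb{R}$ be given by $$\alpha(t) = \frac{e^{1-2t}\,\Gamma(1+3t)}{3\,\Gamma(1+t)^3}.$$ Then for any fixed $1 \le p \le 4$ and $1 \le q \le \infty$ (with $1/q = 0$ when $q = \infty$), as $n \to \infty$, $$\|V_{B_q^n}\|_p^{1/n} \simeq \sqrt{\alpha(1/q)}\; n^{-1/2}, \qquad \|U_{B_q^n}\|_p^{1/n} \simeq \frac{1}{2}\sqrt{\alpha(1/q)}\; n^{-1/2}.$$
   Context: The notation $f \simeq g$ means $f = (1+o(1))g$ as $n \to \infty$. $B_q^n = \{x \in \mathbb{R}^n : \sum_{i=1}^n |x_i|^q \le 1\}$ for $1 \le q < \infty$, and $B_\infty^n = \{x \in \mathbb{R}^n : \max_i |x_i| \le 1\}$. For a symmetric convex body $K \subset \mathbb{R}^n$ (compact, convex, with nonempty interior, $K = -K$), $U_K$ and $V_K$ are the random variables $$U_K = \frac{1}{|K|}\,\bigl|\mathrm{conv}\{x_1,\ldots,x_{n+1}\}\bigr|, \qquad V_K = \frac{1}{|K|}\,\bigl|\mathrm{conv}\{\pm x_1,\ldots,\pm x_n\}\bigr|,$$ where in each case the $x_i$ are independent random points uniformly distributed in $K$ and $|\cdot|$ denotes volume ($n$-dimensional Lebesgue measure). For a random variable $X$ and $1 \le p < \infty$, $\|X\|_p = (\mathbb{E}|X|^p)^{1/p}$. $\Gamma$ is the Gamma function. *)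

(* Defs.v *)
From HB Require Import structures.
From mathcomp Require Import all_boot all_order all_algebra.
From mathcomp Require Import all_classical all_reals all_analysis.

Set Implicit Arguments.
Unset Strict Implicit.
Unset Printing Implicit Defensive.

Import Order.TTheory GRing.Theory Num.Theory.
Import numFieldNormedType.Exports.

Local Open Scope classical_set_scope.
Local Open Scope ring_scope.

(* R^n is represented by [n.-tuple R], with the library's product
   sigma-algebra. *)

Section tuple_lebesgue.
Local Open Scope ereal_scope.
Variable R : realType.

(* [measurableTypeR R] is [R] with the same Borel sets, under the display that
   [lebesgue_measure] expects. *)
Definition tcons n (p : measurableTypeR R * n.-tuple R) : n.+1.-tuple R :=
  [the n.+1.-tuple R of (p.1 : R) :: p.2].

Definition tuncons n (x : n.+1.-tuple R) : measurableTypeR R * n.-tuple R :=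
  (thead x, [tuple of behead x]).

Lemma measurable_tcons n : measurable_fun setT (@tcons n).
Proof. by apply: measurable_cons; [exact: measurable_fst|exact: measurable_snd]. Qed.

Lemma measurable_tuncons n : measurable_fun setT (@tuncons n).
Proof.
apply/measurable_fun_pairP; split; first exact: measurable_tnth.
exact: measurable_behead.
Qed.

Lemma tconsK n : cancel (@tcons n) (@tuncons n).
Proof.
move=> [a x]; rewrite /tcons /tuncons /=; congr pair => //.
by apply/val_inj.
Qed.

Section lebesgue_cons.
Variables (n : nat) (m : {sigma_finite_measure set (n.-tuple R) -> \bar R}).

Definition lebesgue_cons : set (n.+1.-tuple R) -> \bar R :=
  pushforward (@lebesgue_measure R \x m) (@tcons n).

Let lebesgue_cons0 : lebesgue_cons set0 = 0.
Proof. by rewrite /lebesgue_cons /pushforward preimage_set0 measure0. Qed.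

Let lebesgue_cons_ge0 A : 0 <= lebesgue_cons A.
Proof. exact: (measure_ge0 (@lebesgue_measure R \x m)). Qed.

Let lebesgue_cons_sigma_additive : semi_sigma_additive lebesgue_cons.
Proof.
move=> F mF tF mUF; rewrite /lebesgue_cons /pushforward preimage_bigcup.
have mc := @measurable_tcons n.
apply: (@measure_semi_sigma_additive _ _ _ (@lebesgue_measure R \x m)).
- by move=> k; rewrite -[X in measurable X]setTI; exact: mc.
- apply/trivIsetP => /= i j _ _ ij; rewrite -preimage_setI.
  by move/trivIsetP : tF => /(_ _ _ _ _ ij) ->//; rewrite preimage_set0.
- by rewrite -preimage_bigcup -[X in measurable X]setTI; exact: mc.
Qed.

HB.instance Definition _ := isMeasure.Build _ _ _ lebesgue_cons
  lebesgue_cons0 lebesgue_cons_ge0 lebesgue_cons_sigma_additive.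

Let lebesgue_cons_sigma_finite :
  sigma_finite [set: n.+1.-tuple R] lebesgue_cons.
Proof.
have /sigma_finiteP[F [TF ndF Foo]] := sigma_finiteT (@lebesgue_measure R).
have /sigma_finiteP[G [TG ndG Goo]] := sigma_finiteT m.
exists (fun k => @tuncons n @^-1` (F k `*` G k)).
  rewrite -preimage_bigcup (_ : \bigcup_k _ = setT) ?preimage_setT//.
  rewrite -setXTT TF TG predeqE => -[x y]; split.
    by move=> [k _ [] /= ? ?]; split; exists k.
  move=> [/= [i _ Fix] [k _ Gky]]; exists (maxn i k) => //; split.
  - by move: x Fix; exact/subsetPset/ndF/leq_maxl.
  - by move: y Gky; exact/subsetPset/ndG/leq_maxr.
move=> k; have [? ?] := Foo k; have [? ?] := Goo k; split.
  rewrite -[X in measurable X]setTI; apply: measurable_tuncons => //.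
  exact: measurableX.
rewrite /lebesgue_cons /pushforward.
rewrite (_ : _ @^-1` _ = F k `*` G k).
  by rewrite product_measure1E// lte_mul_pinfty// ge0_fin_numE.
by apply/predeqP => p; change ((F k `*` G k) (tuncons (tcons p)) <-> (F k `*` G k) p);
  rewrite tconsK.
Qed.

HB.instance Definition _ := Measure_isSigmaFinite.Build _ _ _ lebesgue_cons
  lebesgue_cons_sigma_finite.
End lebesgue_cons.

(* Lebesgue measure on the Borel sets of R^n, as an iterated product. *)
Fixpoint lebesgue_tuple (n : nat) :
    {sigma_finite_measure set (n.-tuple R) -> \bar R} :=
  if n is k.+1 then lebesgue_cons (lebesgue_tuple k) else dirac [tuple].

Lemma lebesgue_tuple_box n (a b : 'I_n -> R) : (forall i, a i <= b i)%R ->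
  lebesgue_tuple n [set x | forall i, (a i <= tnth x i <= b i)%R]
  = (\prod_(i < n) (b i - a i))%:E.
Proof.
elim: n a b => [|n IH] a b ab.
  by rewrite big_ord0 /= diracE mem_set// => -[].
rewrite big_ord_recl EFinM /= /lebesgue_cons /pushforward.
have := IH (fun i => a (lift ord0 i)) (fun i => b (lift ord0 i)).
set B := [set x | _] => /(_ (fun i => ab _)) vB.
have mB : measurable B.
  rewrite (_ : B = \big[setI/setT]_(i < n) ((fun x : n.-tuple R => tnth x i)
      @^-1` `[a (lift ord0 i), b (lift ord0 i)])).
    apply: bigsetI_measurable => i _; rewrite -[X in measurable X]setTI.
    exact: measurable_tnth.
  rewrite -bigcap_seq/=; apply/seteqP; split=> x /= Bx i.
    by move=> _ /=; rewrite in_itv/=; exact: Bx.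
  by have := Bx i; rewrite /= in_itv/= mem_index_enum; exact.
rewrite (_ : _ @^-1` _ = `[a ord0, b ord0]%classic `*` B).
  rewrite product_measure1E// vB; congr (_ * _).
  apply: (etrans (lebesgue_measure_itv `[a ord0, b ord0])); rewrite /= lte_fin.
  have := ab ord0; rewrite le_eqVlt => /orP[/eqP ->|->]; last by rewrite EFinB.
  by rewrite ltxx subrr.
apply/predeqP => -[x y]; split=> /=.
  move=> xy; split; first by rewrite in_itv/=; exact: (xy ord0).
  by move=> i; have := xy (lift ord0 i); rewrite tnthS.
rewrite in_itv/= => -[abx By] i; case: (unliftP ord0 i) => [j ->|->//].
by rewrite tnthS; exact: By.
Qed.
End tuple_lebesgue.

Section random_points.
Local Open Scope ereal_scope.
Context (R : realType) (d d' : measure_display) (T : measurableType d)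
  (E : measurableType d').
Variable P : probability T R.

(* Mutual independence: the product rule over every subfamily. *)
Definition independent (I : finType) (X : I -> {RV P >-> E}) : Prop :=
  forall (J : {set I}) (A : I -> set E),
    (forall i, i \in J -> measurable (A i)) ->
    P (\bigcap_(i in [set` J]) (X i @^-1` A i))
    = \prod_(i in J) P (X i @^-1` A i).

End random_points.

Section random_polytopes.
Local Open Scope ereal_scope.
Context (R : realType) (n : nat).

Local Notation vol := (lebesgue_tuple R n).

Definition uniform_in (K : set (n.-tuple R)) (d : measure_display)
    (T : measurableType d) (P : probability T R)
    (X : {RV P >-> n.-tuple R}) : Prop :=
  forall A : set (n.-tuple R), measurable A ->
    distribution P X A = vol (A `&` K) / vol K.

Definition iid_uniform_in (K : set (n.-tuple R)) (d : measure_display)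
    (T : measurableType d) (P : probability T R) (I : finType)
    (X : I -> {RV P >-> n.-tuple R}) : Prop :=
  independent X /\ forall i, uniform_in K (X i).

Definition conv_hull (I : finType) (x : I -> n.-tuple R) : set (n.-tuple R) :=
  [set y | exists w : I -> R,
    [/\ forall i, (0 <= w i)%R, (\sum_i w i = 1)%R &
        forall k, tnth y k = (\sum_i w i * tnth (x i) k)%R]].

(* Points are tuples, which carry no zmodType structure. *)
Definition oppt (x : n.-tuple R) : n.-tuple R := [tuple (- tnth x k)%R | k < n].

Definition U_ (K : set (n.-tuple R)) (d : measure_display)
    (T : measurableType d) (P : probability T R)
    (X : 'I_n.+1 -> {RV P >-> n.-tuple R}) (w : T) : \bar R :=
  vol (conv_hull (fun i => X i w)) / vol K.

Definition V_ (K : set (n.-tuple R)) (d : measure_display)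
    (T : measurableType d) (P : probability T R)
    (X : 'I_n -> {RV P >-> n.-tuple R}) (w : T) : \bar R :=
  vol (conv_hull (fun s : 'I_n + 'I_n =>
         match s with inl i => X i w | inr i => oppt (X i w) end)) / vol K.

Definition lq_ball (q : \bar R) : set (n.-tuple R) :=
  match q with
  | r%:E => [set x | (\sum_(i < n) `|tnth x i| `^ r <= 1)%R]
  | +oo => [set x | (\big[Num.max/0]_(i < n) `|tnth x i| <= 1)%R]
  | -oo => set0
  end.

End random_polytopes.
Arguments lq_ball {R} n q.

Section gamma_alpha.
Variable R : realType.

Definition Gamma (x : R) : R :=
  \int[lebesgue_measure]_(t in `]0, +oo[) (t `^ (x - 1) * expR (- t)).

Definition alpha (t : R) : R :=
  expR (1 - 2 * t) * Gamma (1 + 3 * t) / (3 * Gamma (1 + t) ^+ 3).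

End gamma_alpha.

(* Main.v *)
Require Import Defs.
From HB Require Import structures.
From mathcomp Require Import all_boot all_order all_algebra.
From mathcomp Require Import all_classical all_reals all_analysis.
From mathcomp Require Import measurable_realfun measurable_fun_approximation.
From mathcomp Require Import ring lra zify.
Import Order.TTheory GRing.Theory Num.Theory.
Import numFieldNormedType.Exports.
Local Open Scope classical_set_scope.
Local Open Scope ring_scope.

Set Implicit Arguments.
Unset Strict Implicit.
Unset Printing Implicit Defensive.

(** Put t = 1/q, with t = 0 for q = +oo.  The two polytopes are affine images
    of a fixed body, and the volume of an affine image is multiplied by the
    absolute value of the determinant (lebesgue_tuple_image).  The symmetric hull
    is a linear image of the cross-polytope and the hull of n + 1 points is an
    affine image of the corner simplex, whence (V_eq, U_eq)

      V = 2^n |det (x_1, ..., x_n)| / (n! vol K),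
      U = |det (x_1 - x_0, ..., x_n - x_0)| / (n! vol K)
        = |det ((1, x_0), ..., (1, x_n))| / (n! vol K).

    Both are thus governed by the determinant of an m by m matrix with
    independent rows, with m = n for V and m = n + 1 for U.  A uniform point of K
    has uncorrelated coordinates of common variance s, because K is invariant
    under changing the sign of one coordinate.  Removing the rows one at a time,
    det^2 is a product of squared distances to random subspaces, and conditioning
    on the other rows gives E det^2 = s^m m!.  The same recursion for the fourth
    moment loses only a factor 1 + C/d when a subspace of codimension d is met, so
    E det^4 <= (s^m m!)^2 (m + 1)^C with C depending on q alone (det_second_moment,
    det_fourth_moment).  A nonnegative variable whose fourth moment is at most M
    times the square of its second moment has all its norms of order 1 to 4
    comparable, up to a factor polynomial in M (Lnorm_bounds).  Such factors
    disappear after taking n-th roots, hence both limits are those of the n-th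
    root of the L^2 norm, which is explicit: it is 2^n base_size n for V and
    sqrt(n + 1) base_size n for U.

    The value of s and the volume of K come from one formula.  Integrating a
    homogeneous function against exp (- sum |x_i|^r) over the whole space produces
    a Gamma factor times its integral over the unit ball (integral_homogeneous);
    for a monomial the left-hand side is a product of one-dimensional integrals, so
    the moments of K are ratios of Gamma values (lq_ball_moment).  Two-sided
    bounds for Gamma(1 + x) and for Gamma(1 + x + u) / Gamma(1 + x), with
    polynomial losses, then yield

      ln (base_size n) = - (n / 2) ln n + n base_rate + O(ln n),

    and exp (base_rate) is half the square root of alpha(t) (alpha_base_rate).

    Throughout, Gamma(1 + x) is written gammaD x, and egammaD x is the same
    integral with values in the extended reals. *)

(** * Lebesgue integration over tuples *)

Section any_integral.
Local Open Scope ereal_scope.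

(** The integral of a nonnegative function is the supremum of the integrals
    of the simple functions below it, which is monotone for arbitrary functions. *)
Lemma le_integral_any d (T : measurableType d) (R : realType)
    (mu : {measure set T -> \bar R}) (f g : T -> \bar R) :
  (forall x, 0 <= f x) -> (forall x, f x <= g x) ->
  \int[mu]_x f x <= \int[mu]_x g x.
Proof.
move=> f0 fg.
have g0 x : 0 <= g x by exact: le_trans (fg x).
rewrite !ge0_integralTE//.
apply: ereal_sup_le => _ [h /= hf <-]; exists h => //= x.
exact: le_trans (hf x) (fg x).
Qed.

Variable R : realType.

(** The iterated construction makes the measure monotone on all sets; this gives
    volume 0 to an arbitrary subset of a hyperplane, such as a degenerate hull. *)
Lemma le_lebesgue_tuple n (A B : set (n.-tuple R)) : A `<=` B ->
  lebesgue_tuple R n A <= lebesgue_tuple R n B.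
Proof.
elim: n A B => [|n IH] A B AB /=.
  rewrite !diracE lee_fin ler_nat.
  by case: (boolP (_ \in A)) => // /set_mem/AB/mem_set ->.
rewrite /lebesgue_cons /pushforward /product_measure1 /=.
apply: le_integral_any => x; first exact: measure_ge0.
by apply: IH => y; rewrite /xsection /= !inE => /AB.
Qed.

Lemma measurable_tuple_comp d (T : measurableType d) n (f : 'I_n -> T -> R) :
  (forall i, measurable_fun setT (f i)) ->
  measurable_fun setT (fun x => [tuple f i x | i < n]).
Proof.
move=> mf; apply/measurable_fun_tnthP => i.
rewrite (_ : _ \o _ = f i) => [//|].
by apply/funext => x /=; rewrite tnth_mktuple.
Qed.

(** Tonelli's theorem, the first coordinate being integrated last; in the next
    lemma it is integrated first. *)
Lemma ge0_integral_tcons n (f : n.+1.-tuple R -> \bar R) :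
  measurable_fun setT f -> (forall x, 0 <= f x) ->
  \int[lebesgue_tuple R n.+1]_x f x =
  \int[@lebesgue_measure R]_x \int[lebesgue_tuple R n]_y f (tcons (x, y)).
Proof.
move=> mf f0.
rewrite [LHS]/= /lebesgue_cons ge0_integral_pushforward//=;
  last exact: measurable_tcons.
rewrite preimage_setT fubini_tonelli1//.
exact: measurableT_comp mf (@measurable_tcons R n).
Qed.

Lemma ge0_integral_tconsC n (f : n.+1.-tuple R -> \bar R) :
  measurable_fun setT f -> (forall x, 0 <= f x) ->
  \int[lebesgue_tuple R n.+1]_x f x =
  \int[lebesgue_tuple R n]_y \int[@lebesgue_measure R]_x f (tcons (x, y)).
Proof.
move=> mf f0.
rewrite [LHS]/= /lebesgue_cons ge0_integral_pushforward//=;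
  last exact: measurable_tcons.
rewrite preimage_setT fubini_tonelli2//.
exact: measurableT_comp mf (@measurable_tcons R n).
Qed.

Lemma ge0_integral_tuple0 (f : 0.-tuple R -> \bar R) :
  measurable_fun setT f -> (forall x, 0 <= f x) ->
  \int[lebesgue_tuple R 0]_x f x = f [tuple].
Proof. by move=> mf f0; rewrite /= integral_dirac// diracT mul1e. Qed.

End any_integral.

Section affine1.
Local Open Scope ereal_scope.
Variable R : realType.
Notation mu := (@lebesgue_measure R).

Lemma measurable_affine (a b : R) :
  measurable_fun [set: measurableTypeR R]
    ((fun u : R => (a * u + b)%R) : measurableTypeR R -> measurableTypeR R).
Proof. by apply: measurable_funD => //; exact: measurable_funM. Qed.

(** Both sides are measures in A, so it suffices to compare them on half-open
    intervals. *)
Lemma lebesgue_measure_affine (a b : R) (A : set (measurableTypeR R)) :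
  a != 0%R -> measurable A ->
  mu A = `|a|%:E * mu ((fun u : R => (a * u + b)%R) @^-1` A).
Proof.
move=> a0 mA.
pose f : measurableTypeR R -> measurableTypeR R := fun u : R => (a * u + b)%R.
have mf : measurable_fun setT f := measurable_affine a b.
pose fp : {mfun measurableTypeR R >-> measurableTypeR R} :=
  HB.pack f (isMeasurableFun.Build _ _ _ _ _ mf).
pose nu : {measure set (measurableTypeR R) -> \bar R} :=
  mscale (NngNum (normr_ge0 a)) (pushforward mu fp).
rewrite (@lebesgue_measure_unique R (nu mf))// => X [[c d] _ <-] /=.
rewrite /mscale /= /pushforward /=.
have [a_gt0|a_lt0|] := ltgtP 0%R a; last by move=> a00; rewrite -a00 eqxx in a0.
- have -> : f @^-1` `]c, d]%classic = `]((c - b) / a)%R, ((d - b) / a)%R]%classic.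
    apply/seteqP; split => u /=; rewrite !in_itv /= /f;
      by rewrite ltr_pdivrMr// ler_pdivlMr// ltrBlDr lerBrDr (mulrC u).
  rewrite !lebesgue_measure_itv/= !lte_fin ltr_pM2r ?invr_gt0// ltrD2r.
  case: ifP => _; last by rewrite mule0.
  by rewrite -!EFinB -EFinM gtr0_norm//; congr EFin; field.
- have -> : f @^-1` `]c, d]%classic = `[((d - b) / a)%R, ((c - b) / a)%R[%classic.
    apply/seteqP; split => u /=; rewrite !in_itv /= /f;
      by rewrite ltr_ndivlMr// ler_ndivrMr// ltrBlDr lerBrDr (mulrC u) andbC.
  rewrite !lebesgue_measure_itv/= !lte_fin ltr_nM2r ?invr_lt0// ltrD2r.
  case: ifP => _; last by rewrite mule0.
  by rewrite -!EFinB -EFinM ltr0_norm//; congr EFin; field.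
Qed.

Lemma ge0_integral_affine1 (a b : R) (F : R -> \bar R) :
  a != 0%R -> measurable_fun [set: R] F -> (forall x, 0 <= F x) ->
  `|a|%:E * \int[mu]_u F (a * u + b)%R = \int[mu]_u F u.
Proof.
move=> a0 mF F0.
pose f : measurableTypeR R -> measurableTypeR R := fun u : R => (a * u + b)%R.
have mf : measurable_fun setT f := measurable_affine a b.
pose fp : {mfun measurableTypeR R >-> measurableTypeR R} :=
  HB.pack f (isMeasurableFun.Build _ _ _ _ _ mf).
transitivity (`|a|%:E * \int[pushforward mu fp]_u F u).
  by rewrite ge0_integral_pushforward// preimage_setT.
have -> : `|a|%:E = (NngNum (normr_ge0 a))%:num%:E by [].
rewrite -ge0_integral_mscale//.
by apply: eq_measure_integral => A mA _; rewrite /= /mscale/= -lebesgue_measure_affine.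
Qed.

End affine1.

(** * Affine changes of variables *)

(** Schur complement of a nonzero corner entry. *)
Lemma det_pivot (F : fieldType) n (A : 'M[F]_n.+1) : A 0 0 != 0 ->
  \det A = A 0 0 * \det (\matrix_(i < n, j < n)
     (A (lift 0 i) (lift 0 j) - A (lift 0 i) 0 / A 0 0 * A 0 (lift 0 j))).
Proof.
move=> a0; set S := \matrix_(i, j) _.
pose A' : 'M[F]_(1 + n) := A.
pose c : 'M[F]_(n, 1) := \matrix_(i, j) (A (lift 0 i) 0 / A 0 0).
pose b : 'M[F]_(1, n) := \matrix_(i, j) A 0 (lift 0 j).
have AE : A' = block_mx (1%:M : 'M[F]_1) 0 c 1%:M *m block_mx ((A 0 0)%:M : 'M[F]_1) b 0 S
    :> 'M[F]_(1 + n).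
  rewrite mulmx_block !mul1mx !mul0mx !addr0.
  rewrite -[LHS]submxK; congr block_mx; apply/matrixP => i j;
    rewrite !mxE ?ord1 ?lshift0 ?rshift1 ?eqxx ?mulr1n// big_ord1 !mxE.
  - by rewrite eqxx mulr1n divfK.
  - by rewrite addrC subrK.
rewrite -[\det A]/(\det A') AE (@det_mulmx _ (1 + n)).
rewrite det_lblock !det1 !mul1r det_ublock det_scalar1.
by congr (_ * _).
Qed.

Section affine.
Variable R : realType.

Definition affine_tuple m n (A : 'M[R]_(m, n)) (v : 'rV[R]_n) (x : m.-tuple R) :
    n.-tuple R :=
  [tuple \sum_i tnth x i * A i j + v 0 j | j < n].

Lemma measurable_affine_tuple m n (A : 'M[R]_(m, n)) (v : 'rV[R]_n) :
  measurable_fun setT (affine_tuple A v).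
Proof.
apply: measurable_tuple_comp => j; apply: measurable_funD => //.
apply: measurable_sum => i; apply: measurable_funM => //.
exact: measurable_tnth.
Qed.

Lemma affine_tuple_comp m n k (A : 'M[R]_(m, n)) v (B : 'M[R]_(n, k)) w x :
  affine_tuple B w (affine_tuple A v x) = affine_tuple (A *m B) (v *m B + w) x.
Proof.
apply: eq_from_tnth => j; rewrite !tnth_mktuple !mxE addrA; congr (_ + _).
under eq_bigr do rewrite tnth_mktuple mulrDl.
rewrite big_split /=; congr (_ + _).
under eq_bigr do rewrite mulr_suml.
rewrite exchange_big /=; apply: eq_bigr => i _.
by rewrite mxE mulr_sumr; apply: eq_bigr => l _; rewrite mulrA.
Qed.

Lemma affine_tuple1 n (x : n.-tuple R) : affine_tuple 1%:M 0 x = x.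
Proof.
apply: eq_from_tnth => j; rewrite tnth_mktuple mxE addr0.
rewrite (bigD1 j)//= mxE eqxx mulr1 big1 ?addr0// => i ij.
by rewrite mxE (negbTE ij) mulr0.
Qed.

Local Open Scope ereal_scope.

Definition affine_invariant n (A : 'M[R]_n) := forall v (F : n.-tuple R -> \bar R),
  measurable_fun setT F -> (forall x, 0 <= F x) ->
  `|\det A|%:E * \int[lebesgue_tuple R n]_x F (affine_tuple A v x) =
  \int[lebesgue_tuple R n]_x F x.

(** Compose the two substitutions and use multiplicativity of the determinant. *)
Lemma affine_invariantM n (A B : 'M[R]_n) :
  affine_invariant A -> affine_invariant B -> affine_invariant (A *m B).
Proof.
move=> hA hB v F mF F0.
rewrite det_mulmx normrM mulrC EFinM -muleA.
rewrite -[RHS](hB v F)//; congr (_ * _).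
rewrite -[RHS](hA 0%R)//.
  congr (_ * _); apply: eq_integral => x _.
  by rewrite affine_tuple_comp mul0mx add0r.
exact: (measurableT_comp mF (@measurable_affine_tuple _ _ B v)).
Qed.

(** Integrate over the first coordinate before the others and substitute the
    first output coordinate y for it, at the cost of the factor |A 0 0|.  In terms
    of y and the remaining inputs the other outputs are an affine map whose linear
    part is the Schur complement, so the hypothesis applies for each fixed y. *)
Lemma affine_invariant_pivot n (A : 'M[R]_n.+1) : A 0%R 0%R != 0%R ->
  affine_invariant (\matrix_(i < n, j < n)
     (A (lift 0 i) (lift 0 j) - A (lift 0 i) 0%R / A 0 0 * A 0 (lift 0 j))%R) ->
  affine_invariant A.
Proof.
move=> a0 hS v F mF F0; rewrite (det_pivot a0) normrM EFinM.
set S := (\matrix_(i, j) _)%R in hS *.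
have mFA : measurable_fun setT (F \o affine_tuple A v).
  exact: (measurableT_comp mF (@measurable_affine_tuple _ _ A v)).
rewrite (ge0_integral_tconsC mFA)//=.
pose b y : 'rV[R]_n := (\row_j (y * A 0 (lift 0 j) / A 0 0 + v 0 (lift 0 j)
  - v 0 0 / A 0 0 * A 0 (lift 0 j)))%R.
pose e (x' : n.-tuple R) : R := (\sum_i tnth x' i * A (lift 0 i) 0 + v 0 0)%R.
have mG : measurable_fun setT (fun yx : measurableTypeR R * n.-tuple R =>
    F (tcons (yx.1, affine_tuple S (b yx.1) yx.2))).
  apply: (measurableT_comp mF) => /=; apply: measurable_cons => /=; first exact: measurable_fst.
  rewrite /affine_tuple; apply: measurable_tuple_comp => j; apply: measurable_funD.
    apply: measurable_sum => i; apply: measurable_funM => //.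
    exact: (measurableT_comp (@measurable_tnth _ _ _ i)).
  rewrite (_ : (fun _ => _) = (fun yx : measurableTypeR R * n.-tuple R =>
    yx.1 * A 0 (lift 0 j) / A 0 0 + v 0 (lift 0 j) - v 0 0 / A 0 0 * A 0 (lift 0 j))%R); last first.
    by apply/funext => x; rewrite !mxE.
  apply: measurable_funB => //; apply: measurable_funD => //.
  by apply: measurable_funM => //; apply: measurable_funM.
transitivity (`|\det S|%:E * \int[lebesgue_tuple R n]_x'
    \int[@lebesgue_measure R]_y F (tcons (y, affine_tuple S (b y) x'))).
  rewrite (muleC `|A 0%R 0%R|%:E) -muleA; congr (_ * _).
  rewrite -ge0_integralZl//; last 2 first.
  - apply: (@measurable_fun_fubini_tonelli_G _ _ _ _ R (@lebesgue_measure R)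
      (fun z => (F \o affine_tuple A v) (tcons z))); last by move=> z; exact: F0.
    exact: (measurableT_comp mFA (@measurable_tcons R n)).
  - by move=> x _; apply: integral_ge0 => y _ /=; exact: F0.
  apply: eq_integral => x' _.
  rewrite -(@ge0_integral_affine1 R (A 0 0)%R (e x')
    (fun y => F (tcons (y, affine_tuple S (b y) x'))) a0)//; last first.
    have mp : measurable_fun setT (fun y : measurableTypeR R => (y, x')).
      by apply: measurable_fun_pair.
    exact: (measurableT_comp mG mp).
  congr (_ * _); apply: eq_integral => y _; congr F.
  apply: eq_from_tnth => j; rewrite tnth_mktuple /tcons big_ord_recl /=.
  rewrite tnth0/=.
  case: (unliftP ord0 j) => [j' ->|->] /=; last first.
    rewrite tnth0/= /e -addrA; congr (_ + (_ + _))%R; first exact: mulrC.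
    by apply: eq_bigr => i _; rewrite tnthS.
  rewrite tnthS tnth_mktuple !mxE /e.
  under [in LHS]eq_bigr do rewrite tnthS.
  under [in RHS]eq_bigr do rewrite mxE mulrBr.
  rewrite sumrB.
  have -> : (\sum_(i < n) tnth x' i * (A (lift 0 i) 0 / A 0 0 * A 0 (lift 0 j')) =
    (\sum_(i < n) tnth x' i * A (lift 0 i) 0) / A 0 0 * A 0 (lift 0 j'))%R.
    rewrite !mulr_suml; apply: eq_bigr => i _; ring.
  by field.
rewrite ge0_integral_tcons//.
rewrite (_ : \int[lebesgue_tuple R n]_x' _ =
    \int[@lebesgue_measure R]_y \int[lebesgue_tuple R n]_x' F (tcons (y, affine_tuple S (b y) x')));
    last first.
  have G0 (yx : measurableTypeR R * n.-tuple R) :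
    0%E <= F (tcons (yx.1, affine_tuple S (b yx.1) yx.2)) by exact: F0.
  rewrite -(@fubini_tonelli2 _ _ _ _ R (@lebesgue_measure R) (lebesgue_tuple R n) _ mG G0).
  exact: fubini_tonelli1.
rewrite -ge0_integralZl//; last 2 first.
- apply: (@measurable_fun_fubini_tonelli_F _ _ _ _ R _
      (fun yx => F (tcons (yx.1, affine_tuple S (b yx.1) yx.2)))) => //.
- by move=> x _; apply: integral_ge0 => y _ /=; exact: F0.
apply: eq_integral => y _.
apply: (hS (b y) (fun x => F (tcons (y, x)))) => //.
apply: (measurableT_comp mF) => /=; apply: measurable_cons => //.
exact: measurable_id.
Qed.

(** Induction on the dimension.  A matrix with zero corner entry is the product
    of two matrices with nonzero corner entry, the second being a shear. *)
Lemma affine_invariant_unit n (A : 'M[R]_n) : A \in unitmx -> affine_invariant A.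
Proof.
elim: n A => [|n IH] A uA.
  move=> v F mF F0; rewrite det_mx00 normr1 mul1e.
  by apply: eq_integral => x _; congr F; apply: eq_from_tnth => -[].
have pivot (B : 'M[R]_n.+1) : B \in unitmx -> B 0%R 0%R != 0%R -> affine_invariant B.
  move=> uB b0; apply: affine_invariant_pivot => //; apply: IH.
  by move: uB; rewrite !unitmxE (det_pivot b0) !unitfE mulf_eq0 negb_or => /andP[].
have [a0|a0] := eqVneq (A 0%R 0%R) 0%R; last exact: pivot.
(* A column with nonzero first entry is added to the first column. *)
have [j aj0] : exists j, A 0%R j != 0%R.
  apply/existsP; apply: contraT; rewrite negb_exists => /forallP A0.
  move: uA; rewrite unitmxE (expand_det_row _ 0%R) big1 ?unitr0// => i _.
  by have := A0 i; rewrite negbK => /eqP ->; rewrite mul0r.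
have j0 : j != 0%R by apply: contraNneq aj0 => ->; rewrite a0.
pose E (c : R) : 'M[R]_n.+1 := (1%:M + c *: delta_mx j 0%R)%R.
have EE c : (E c *m E (- c) = 1%:M)%R.
  rewrite /E mulmxDl mul1mx mulmxDr mulmx1 -scalemxAl -scalemxAr mul_delta_mx_0 1?eq_sym//.
  rewrite !scaler0 addr0 scaleNr subrK// .
have uE c : E c \in unitmx by have /mulmx1_unit[] := EE c.
have E00 c : E c 0%R 0%R = 1%R.
  by rewrite !mxE eqxx (eq_sym 0%R j) (negbTE j0) mulr0 addr0.
rewrite -(mulmx1 A) -(EE 1%R) mulmxA; apply: affine_invariantM.
  apply: pivot; first by rewrite unitmx_mul uA uE.
  rewrite /E mulmxDr mulmx1 !mxE a0 add0r scale1r (bigD1 j)//= !mxE !eqxx mulr1.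
  rewrite big1 ?addr0// => i ij; by rewrite mxE (negbTE ij) mulr0.
by apply: pivot => //; rewrite E00 oner_eq0.
Qed.

End affine.

(** * Volumes of affine images and convex hulls *)

Section volume.
Variable R : realType.
Local Open Scope ereal_scope.

Lemma measurable_hyperplane n (v : 'I_n -> R) (c : R) :
  measurable [set x : n.-tuple R | (\sum_i tnth x i * v i)%R = c].
Proof.
have mf : measurable_fun setT (fun x : n.-tuple R => (\sum_i tnth x i * v i)%R).
  apply: measurable_sum => i; apply: measurable_funM => //.
  exact: measurable_tnth.
have := mf measurableT [set c] (measurable_set1 c); rewrite setTI.
by congr measurable; apply/seteqP; split => x.
Qed.

Lemma integral_tuple_indic n (A : set (n.-tuple R)) : measurable A ->
  \int[lebesgue_tuple R n]_x (\1_A x)%:E = lebesgue_tuple R n A.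
Proof. by move=> mA; rewrite integral_indic// setIT. Qed.

(** By Tonelli: if the first coefficient is nonzero, each line parallel to the
    first axis meets the hyperplane in one point; otherwise each slice is a
    hyperplane of the smaller space. *)
Lemma lebesgue_tuple_hyperplane n (v : 'I_n -> R) (c : R) :
  (exists j, v j != 0%R) ->
  lebesgue_tuple R n [set x | (\sum_i tnth x i * v i)%R = c] = 0.
Proof.
elim: n v c => [v c [[]//]|n IH v c [j vj]].
have mH := measurable_hyperplane v c.
rewrite -(integral_tuple_indic mH).
have mI : measurable_fun setT (fun x : n.+1.-tuple R =>
    (\1_[set x | (\sum_i tnth x i * v i)%R = c] x)%:E : \bar R).
  by apply/measurable_EFinP; exact: measurable_indic.
have I0 x : 0 <= (\1_[set x : n.+1.-tuple R | (\sum_i tnth x i * v i)%R = c] x)%:E :> \bar R.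
  by rewrite lee_fin.
have [v0|v0] := eqVneq (v ord0) 0%R; last first.
  rewrite ge0_integral_tconsC//.
  apply: integral0_eq => y _.
  pose p := ((c - \sum_i tnth y i * v (lift ord0 i)) / v ord0)%R.
  under eq_integral => x _.
    rewrite (_ : \1__ _ = \1_[set p] x); first over.
    rewrite !indicE; congr ((nat_of_bool _)%:R); apply/idP/idP.
      move/set_mem => /=; rewrite big_ord_recl /= tnth0.
      under eq_bigr do rewrite tnthS.
      by move=> H; apply/mem_set; rewrite /= /p -H addrK mulfK.
    move/set_mem => /= ->; apply/mem_set => /=; rewrite big_ord_recl /= tnth0.
    under eq_bigr do rewrite tnthS.
    by rewrite /p divfK// subrK.
  by rewrite integral_indic// setIT; exact: lebesgue_measure_set1.
case: (unliftP ord0 j) => [j' jE|jE]; last by rewrite jE v0 eqxx in vj.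
rewrite ge0_integral_tcons//.
apply: integral0_eq => x _.
under eq_integral => y _.
  rewrite (_ : \1__ _ = \1_[set y | (\sum_i tnth y i * v (lift ord0 i))%R = c] y); first over.
  rewrite !indicE; congr ((nat_of_bool _)%:R); apply/idP/idP.
    move/set_mem => /=; rewrite big_ord_recl /= v0 mulr0 add0r.
    under eq_bigr do rewrite tnthS.
    by move=> H; apply/mem_set.
  move/set_mem => /= H; apply/mem_set => /=; rewrite big_ord_recl /= v0 mulr0 add0r.
  by under eq_bigr do rewrite tnthS.
rewrite integral_tuple_indic; last exact: measurable_hyperplane.
by apply: IH; exists j'; rewrite -jE.
Qed.

(** For an invertible matrix this is the change of variables.  For a singular
    one the image, measurable or not, is a subset of a hyperplane. *)
Lemma lebesgue_tuple_image n (A : 'M[R]_n) v (S : set (n.-tuple R)) :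
  measurable S ->
  lebesgue_tuple R n (affine_tuple A v @` S) = `|\det A|%:E * lebesgue_tuple R n S.
Proof.
move=> mS; have [uA|] := boolP (A \in unitmx); last first.
  rewrite unitmxE unitfE negbK => /eqP dA; rewrite dA normr0 mul0e.
  have /det0P[w w0 wA] : \det A^T == 0%R by rewrite det_tr dA.
  apply/eqP; rewrite eq_le measure_ge0 andbT.
  rewrite -(@lebesgue_tuple_hyperplane n (fun j => w 0%R j) (\sum_j v 0 j * w 0 j)%R).
    apply: le_lebesgue_tuple => _ [x _ <-] /=.
    under eq_bigr do rewrite tnth_mktuple mulrDl.
    rewrite big_split /= -[RHS]add0r; congr (_ + _)%R.
    under eq_bigr do rewrite mulr_suml.
    rewrite exchange_big /= big1// => i _.
    transitivity (tnth x i * (w *m A^T) 0 i)%R; last by rewrite wA mxE mulr0.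
    rewrite mxE mulr_sumr; apply: eq_bigr => k _.
    by rewrite mxE -mulrA (mulrC (A i k)).
  apply/existsP; apply: contraNT w0 => /existsPn w0.
  by apply/eqP/rowP => j; rewrite mxE; have := w0 j; rewrite negbK => /eqP.
have imE : affine_tuple A v @` S = affine_tuple (invmx A) (- v *m invmx A)%R @^-1` S.
  apply/seteqP; split=> [_ [x Sx <-] /=|y /= Sy].
    by rewrite affine_tuple_comp mulmxV// mulNmx subrr affine_tuple1.
  exists (affine_tuple (invmx A) (- v *m invmx A)%R y) => //.
  by rewrite affine_tuple_comp mulVmx// -mulmxA mulVmx// mulmx1 addNr affine_tuple1.
have mI : measurable (affine_tuple A v @` S).
  rewrite imE -[X in measurable X]setTI.
  exact: (@measurable_affine_tuple _ _ _ (invmx A)).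
rewrite -(integral_tuple_indic mI) -(integral_tuple_indic mS).
rewrite -(affine_invariant_unit uA v); last 2 first.
- by apply/measurable_EFinP; exact: measurable_indic.
- by move=> x; rewrite lee_fin.
congr (_ * _); apply: eq_integral => x _; congr EFin.
rewrite !indicE; congr ((nat_of_bool _)%:R); apply/idP/idP.
  move/set_mem; rewrite imE /= affine_tuple_comp mulmxV// mulNmx subrr affine_tuple1.
  exact: mem_set.
by move/set_mem => Sx; apply/mem_set; exists x.
Qed.

Definition corner_simplex n : set (n.-tuple R) :=
  [set x | (forall i, 0 <= tnth x i)%R /\ (\sum_i tnth x i <= 1)%R].

(** Solve for the weight of the first point in terms of the others. *)
Lemma conv_hull_simplex n (x : 'I_n.+1 -> n.-tuple R) :
  conv_hull x = affine_tuple (\matrix_(i < n, j < n) (tnth (x (lift ord0 i)) j - tnth (x ord0) j))%R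
    (\row_j tnth (x ord0) j) @` @corner_simplex n.
Proof.
apply/seteqP; split=> [y [w [w0 w1 yw]]|_ [c [c0 c1] <-]] /=.
  exists [tuple w (lift ord0 i) | i < n].
    split; first by move=> i; rewrite tnth_mktuple.
    rewrite -w1 big_ord_recl (eq_bigr (fun i => w (lift ord0 i))) ?lerDr// => i _.
    by rewrite tnth_mktuple.
  apply: eq_from_tnth => j; rewrite tnth_mktuple yw mxE big_ord_recl.
  under [in LHS]eq_bigr do rewrite tnth_mktuple mxE mulrBr.
  rewrite sumrB -mulr_suml.
  have -> : (w ord0 = 1 - \sum_(i < n) w (lift ord0 i))%R.
    by rewrite -w1 big_ord_recl addrK.
  ring.
pose w0 := (1 - \sum_i tnth c i)%R.
pose w (i : 'I_n.+1) := if unlift ord0 i is Some j then tnth c j else w0.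
exists w; split.
- move=> i; rewrite /w; case: unliftP => [j _|_]; first exact: c0.
  by rewrite /w0 subr_ge0.
- rewrite big_ord_recl /w unlift_none; under eq_bigr do rewrite liftK.
  by rewrite /w0 subrK.
- move=> j; rewrite tnth_mktuple mxE big_ord_recl /w unlift_none.
  under [in RHS]eq_bigr do rewrite liftK.
  under [in LHS]eq_bigr do rewrite mxE mulrBr.
  rewrite sumrB -mulr_suml /w0; ring.
Qed.

(** Opposite weights on x i and on its opposite subtract.  Conversely a
    coefficient vector c is split into its positive and negative parts, and the
    slack 1 - sum |c i| is shared equally among all the 2 n weights, which changes
    no difference; this is where n > 0 is used. *)
Lemma conv_hull_cross n (x : 'I_n -> n.-tuple R) : (0 < n)%N ->
  conv_hull (fun s : 'I_n + 'I_n =>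
    match s with inl i => x i | inr i => oppt (x i) end) =
  affine_tuple (\matrix_(i < n, j < n) tnth (x i) j)%R 0%R @` lq_ball n 1%:E.
Proof.
move=> n0; have n0R : (0 < n%:R :> R)%R by rewrite ltr0n.
apply/seteqP; split=> [y [w [w0 w1 yw]]|_ [c c1 <-]] /=.
  rewrite big_sumType /= in w1.
  exists [tuple (w (inl i) - w (inr i))%R | i < n].
    rewrite /= -[leRHS]w1 -big_split /=; apply: ler_sum => i _.
    rewrite tnth_mktuple powRr1//.
    by rewrite (le_trans (ler_normB _ _))// !ger0_norm.
  apply: eq_from_tnth => j; rewrite tnth_mktuple yw mxE addr0 big_sumType /=.
  rewrite -big_split /=; apply: eq_bigr => i _.
  by rewrite !tnth_mktuple mxE mulrN mulrBl.
have {}c1 : (\sum_(i < n) `|tnth c i| <= 1)%R.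
  by move: c1 => /=; under eq_bigr do rewrite powRr1//.
pose e := ((1 - \sum_(i < n) `|tnth c i|) / (2 * n%:R))%R.
have e0 : (0 <= e)%R by rewrite divr_ge0 ?subr_ge0// mulr_ge0.
exists (fun s => match s with
  | inl i => (e + (`|tnth c i| + tnth c i) / 2)%R
  | inr i => (e + (`|tnth c i| - tnth c i) / 2)%R end); split.
- by move=> [i|i]; rewrite addr_ge0// divr_ge0//;
    have := ler_norm (tnth c i); have := ler_norm (- tnth c i); rewrite normrN; lra.
- rewrite big_sumType /= -big_split /=.
  rewrite (eq_bigr (fun i => 2 * e + `|tnth c i|)%R); last by move=> i _; field.
  rewrite big_split /= sumr_const card_ord -mulr_natr /e; field.
  by rewrite gt_eqF.
- move=> j; rewrite tnth_mktuple mxE addr0 big_sumType /= -big_split /=.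
  by apply: eq_bigr => i _; rewrite tnth_mktuple mxE; field.
Qed.

Lemma measurable_corner_simplex n : measurable (@corner_simplex n).
Proof.
rewrite (_ : @corner_simplex n =
  \big[setI/setT]_(i < n) ((fun x : n.-tuple R => tnth x i) @^-1` `[0%R, +oo[)
  `&` (fun x : n.-tuple R => \sum_i tnth x i)%R @^-1` `]-oo, 1%R]).
  apply: measurableI.
    apply: bigsetI_measurable => i _; rewrite -[X in measurable X]setTI.
    exact: measurable_tnth.
  rewrite -[X in measurable X]setTI.
  have mf : measurable_fun setT (fun x : n.-tuple R => (\sum_i tnth x i)%R).
    by apply: measurable_sum => i; exact: measurable_tnth.
  exact: mf.
rewrite -bigcap_seq/=; apply/seteqP; split=> x /= [Bx Sx]; split.
- by move=> i _ /=; rewrite in_itv/= andbT.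
- by rewrite in_itv.
- by move=> i; have := Bx i; rewrite /= in_itv/= andbT mem_index_enum; exact.
- by rewrite in_itv/= in Sx.
Qed.

Lemma measurable_lq_ball n (q : \bar R) : measurable (lq_ball n q).
Proof.
case: q => [r| |]; last exact: measurable0.
- have mf : measurable_fun setT (fun x : n.-tuple R => (\sum_(i < n) `|tnth x i| `^ r)%R).
    apply: measurable_sum => i.
    apply: (measurableT_comp (measurable_powR r)).
    apply: measurableT_comp => //.
    exact: measurable_tnth.
  have := mf measurableT `]-oo, 1%R]%classic (measurable_itv _); rewrite setTI.
  by congr measurable; apply/seteqP; split => x; rewrite /= in_itv.
- rewrite (_ : lq_ball n +oo =
    \big[setI/setT]_(i < n) ((fun x : n.-tuple R => tnth x i)
      @^-1` `[(-1)%R, 1%R])).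
    apply: bigsetI_measurable => i _; rewrite -[X in measurable X]setTI.
    exact: measurable_tnth.
  rewrite -bigcap_seq/=; apply/seteqP; split=> x /= Bx.
    move=> i _ /=; rewrite in_itv/= -ler_norml (le_trans _ Bx)//.
    exact: le_bigmax.
  apply/bigmax_leP; split => // i _.
  by have := Bx i; rewrite /= in_itv/= -ler_norml mem_index_enum; exact.
Qed.

End volume.

(** * One-dimensional integrals *)

Section gamma_integral.
Variable R : realType.
Notation mu := (@lebesgue_measure R).

Lemma ge0_integral_expR_tail (a c : R) : 0 < c ->
  (\int[mu]_(x in `[a, +oo[) (expR (- (c * x)))%:E = (expR (- (c * a)) / c)%:E)%E.
Proof.
move=> c0.
have dF x : is_derive x (1 : R) (fun x => - (expR (- (c * x)) / c)) (expR (- (c * x))).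
  apply: is_derive_eq; rewrite /GRing.scale/=; field; exact: lt0r_neq0.
have ce (g : R -> R) : (forall x, exists d, is_derive x (1 : R) g d) -> continuous g.
  move=> h x; have [d hd] := h x.
  by apply: differentiable_continuous; apply/derivable1_diffP; exact: ex_derive.
have cF : continuous (fun x => - (expR (- (c * x)) / c)).
  by apply: ce => x; eexists; exact: dF.
rewrite (@ge0_continuous_FTC2y R _ (fun x => - (expR (- (c * x)) / c)) _ 0).
- by rewrite EFinN sub0e oppeK.
- by move=> x _; exact: expR_ge0.
- apply: continuous_subspaceT; apply: ce => x; eexists.
  by apply: is_derive_eq.
- rewrite -[X in _ --> X]oppr0; apply: cvgN; rewrite -[X in _ --> X](mul0r c^-1).
  apply: cvgMl.
  apply: (@cvg_comp _ _ _ _ (fun x => expR (- x)) _ (pinfty_nbhs R)); last exact: cvgr_expR.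
  exact: gt0_cvgMry.
- by move=> x _; exact: ex_derive.
- by apply: cvg_at_right_filter; exact: cF.
- by move=> x _; rewrite derive1E; exact: derive_val.
Qed.

Lemma integral_powR01 (a : R) : 0 < a ->
  (\int[mu]_(x in `[0%R, 1%R]) (x `^ a)%:E = (a + 1)^-1%:E)%E.
Proof.
move=> a0; have a1 : 0 < a + 1 by rewrite addr_gt0.
have cpow (b x : R) : 0 < x -> {for x, continuous ((@powR R) ^~ b)}.
  move=> x0; apply: differentiable_continuous; apply/derivable1_diffP.
  by apply: ex_derive; exact: is_derive1_powR.
rewrite (@continuous_FTC2 R _ (fun x => x `^ (a + 1) / (a + 1)))//.
- by rewrite powR1 powR0 ?gt_eqF// mul0r sube0 mul1r.
- apply/continuous_within_itvP => //; split.
  + by move=> x; rewrite in_itv/= => /andP[x0 _]; exact: cpow.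
  + by rewrite powR0 ?gt_eqF//; exact: powR_cvg0.
  + by apply: cvg_at_left_filter; exact: cpow.
- split.
  + move=> x; rewrite in_itv/= => /andP[x0 _].
    by apply: ex_derive; apply: is_deriveM; exact: is_derive1_powR.
  + by apply: cvgMl; rewrite powR0 ?gt_eqF//; exact: powR_cvg0.
  + by apply: cvg_at_left_filter; apply: cvgMl; exact: cpow.
- move=> x; rewrite in_itv/= => /andP[x0 _]; rewrite derive1E.
  have := is_derive1_powR (a + 1) x0 => dp.
  rewrite deriveMr; last exact: ex_derive.
  rewrite derive_val.
  by rewrite addrK /GRing.scale/= mulrA mulVf ?mul1r// gt_eqF.
Qed.

Lemma integral_normr_powR (a : R) : 0 <= a ->
  (\int[mu]_(x in `[(-1)%R, 1%R]) (`|x| `^ a)%:E = (2 / (a + 1))%:E)%E.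
Proof.
rewrite le_eqVlt => /orP[/eqP <-|a0].
  under eq_integral do rewrite powRr0.
  rewrite integral_cst//= mul1e lebesgue_measure_itv/= lte_fin ifT ?EFinB; last lra.
  by congr EFin; field.
have mpow : measurable_fun [set: measurableTypeR R] (fun x : R => `|x| `^ a).
  by apply: (measurableT_comp (measurable_powR a));
    apply: measurable_funTS => //; exact: normr_measurable.
have mE (D : set (measurableTypeR R)) :
    measurable_fun D (fun x : measurableTypeR R => (`|x| `^ a)%:E).
  by apply: measurable_funTS; apply/measurable_EFinP.
have I01 : (\int[mu]_(x in `[0%R, 1%R]) (`|x| `^ a)%:E = (a + 1)^-1%:E)%E.
  rewrite -(integral_powR01 a0); apply: eq_integral => x.
  by rewrite inE/= in_itv/= => /andP[x0 _]; rewrite ger0_norm.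
have -> : `[(-1)%R, 1%R]%classic = `[(-1)%R, 0%R[%classic `|` `[0%R, 1%R]%classic :> set R.
  by rewrite -itv_bndbnd_setU// bnd_simp; lra.
rewrite ge0_integral_setU//=; last first.
  rewrite disj_set2E; apply/eqP/seteqP; split => x //= []; rewrite !in_itv/=; lra.
rewrite I01.
rewrite (_ : \int[mu]_(x in `[(-1)%R, 0%R[) _ = (a + 1)^-1%:E)%E.
  by rewrite -EFinD; congr EFin; field; lra.
rewrite -I01 [LHS]integral_mkcond -(@ge0_integral_affine1 R (-1) 0)//; last 2 first.
- apply: (measurable_restrictT _ _).1; [exact: measurable_itv|exact: mE].
- by move=> x; apply: erestrict_ge0 => y _; rewrite lee_fin powR_ge0.
rewrite normrN normr1 mul1e -[RHS]integral_itv_obnd_cbnd; last exact: mE.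
rewrite [RHS]integral_mkcond; apply: eq_integral => x _.
rewrite !patchE addr0 mulN1r normrN; congr (if _ then _ else _).
apply/idP/idP; rewrite !inE/= !in_itv/=; lra.
Qed.

End gamma_integral.

(** * The layer-cake formula for homogeneous integrands *)

Section layer_cake.
Variable R : realType.
Notation mu := (@lebesgue_measure R).

Lemma ge0_integral_prod n (f : 'I_n -> R -> R) :
  (forall i, measurable_fun setT (f i)) -> (forall i u, 0 <= f i u) ->
  (\int[lebesgue_tuple R n]_x (\prod_i f i (tnth x i))%:E =
   \prod_i \int[mu]_u (f i u)%:E)%E.
Proof.
elim: n f => [|n IH] f mf f0.
  rewrite ge0_integral_tuple0 ?big_ord0//.
    under eq_fun do rewrite big_ord0; exact: measurable_cst.
  by move=> x; rewrite big_ord0 lee_fin.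
have mP k (h : 'I_k -> R -> R) : (forall i, measurable_fun setT (h i)) ->
    measurable_fun [set: k.-tuple R] (fun x => (\prod_i h i (tnth x i))%:E).
  move=> mh; apply/measurable_EFinP; apply: measurable_prod => i _.
  exact: (measurableT_comp (mh i) (@measurable_tnth _ _ _ i)).
rewrite ge0_integral_tcons//; last 2 first.
- exact: mP.
- by move=> x; rewrite lee_fin; apply: prodr_ge0.
rewrite big_ord_recl -ge0_integralZr//; last 3 first.
- by apply/measurable_EFinP; exact: mf.
- by move=> x _; rewrite lee_fin.
- by apply: prode_ge0 => i _; apply: integral_ge0 => x _; rewrite lee_fin.
apply: eq_integral => u _.
rewrite -IH// -ge0_integralZl//; last 3 first.
- exact: (mP n (fun i => f (lift ord0 i)) (fun i => mf _)).
- by move=> x _; rewrite lee_fin; apply: prodr_ge0.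
- by rewrite lee_fin.
apply: eq_integral => x _; rewrite big_ord_recl /= tnth0 -EFinM.
by under eq_bigr do rewrite tnthS.
Qed.

(** Gamma(1 + x), as an extended real. *)
Definition egammaD (x : R) : \bar R :=
  (\int[mu]_(s in `]0%R, +oo[) (s `^ x * expR (- s))%:E)%E.

(** The layer-cake form of the exponential: exp(-N) is the integral of exp(-s)
    over s >= N.  The indicator of the half-line s > 0 only discards a null set. *)
Lemma integral_layer (N : R) : 0 <= N ->
  (\int[mu]_s (\1_(`]0%R, +oo[) s * (N <= s)%R%:R * expR (- s))%:E = (expR (- N))%:E)%E.
Proof.
move=> N0.
have mexp (D : set (measurableTypeR R)) :
    measurable_fun D (fun x : measurableTypeR R => (expR (- x))%:E).
  apply: measurable_funTS; apply/measurable_EFinP.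
  by apply: measurableT_comp => //; exact: measurable_funN.
have tail a : (\int[mu]_(x in `[a, +oo[) (expR (- x))%:E = (expR (- a))%:E)%E.
  have := @ge0_integral_expR_tail R a 1 ltr01; rewrite mul1r divr1 => <-.
  by apply: eq_integral => x _; rewrite mul1r.
rewrite -tail; have [NP|NE] := leP N 0.
  have -> : N = 0 by apply/eqP; rewrite eq_le NP.
  rewrite -integral_itv_obnd_cbnd; last exact: mexp.
  rewrite [RHS]integral_mkcond; apply: eq_integral => x _; rewrite patchE indicE.
  case: ifPn; last by rewrite !mul0r.
  by rewrite inE/= in_itv/= andbT => /ltW ->; rewrite !mul1r.
rewrite [RHS]integral_mkcond; apply: eq_integral => x _; rewrite patchE indicE.
rewrite !mem_setE !in_itv/= !andbT.
have [Nx|] := leP N x; last by rewrite mulr0 mul0r.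
by rewrite (lt_le_trans NE Nx) !mul1r.
Qed.

Definition scale_tuple n (l : R) (x : n.-tuple R) : n.-tuple R := affine_tuple l%:M 0 x.

Lemma tnth_scale_tuple n l (x : n.-tuple R) i : tnth (scale_tuple l x) i = l * tnth x i.
Proof.
rewrite tnth_mktuple mxE addr0 (bigD1 i)//= mxE eqxx mulr1n big1.
  by rewrite addr0 mulrC.
by move=> j ji; rewrite mxE (negbTE ji) mulr0n mulr0.
Qed.

Lemma integral_scale_tuple n l (F : n.-tuple R -> \bar R) : 0 < l ->
  measurable_fun setT F -> (forall x, 0 <= F x)%E ->
  ((l ^+ n)%:E * \int[lebesgue_tuple R n]_x F (scale_tuple l x) =
   \int[lebesgue_tuple R n]_x F x)%E.
Proof.
move=> l0 mF F0; rewrite -(@affine_invariant_unit R n l%:M _ 0 F)//.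
  by rewrite det_scalar ger0_norm// exprn_ge0// ltW.
by rewrite unitmxE det_scalar unitfE expf_neq0// gt_eqF.
Qed.

Definition powR_sum n (r : R) (x : n.-tuple R) : R := \sum_(i < n) `|tnth x i| `^ r.

Lemma measurable_powR_sum n r : measurable_fun setT (@powR_sum n r).
Proof.
apply: measurable_sum => i.
apply: (measurableT_comp (measurable_powR r)).
by apply: measurableT_comp => //; exact: measurable_tnth.
Qed.

Lemma powR_sum_ge0 n r (x : n.-tuple R) : 0 <= powR_sum r x.
Proof. by apply: sumr_ge0 => i _; exact: powR_ge0. Qed.

Lemma powR_sum_scale_tuple n r l (x : n.-tuple R) : 0 <= l ->
  powR_sum r (scale_tuple l x) = l `^ r * powR_sum r x.
Proof.
move=> l0; rewrite /powR_sum mulr_sumr; apply: eq_bigr => i _.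
by rewrite tnth_scale_tuple normrM powRM// ger0_norm.
Qed.

(** Write exp(-powR_sum r x) as the integral of exp(-s) over the s above
    powR_sum r x and exchange the integrals.  For fixed s the inner domain is the
    ball scaled by s^(1/r), so homogeneity extracts s^((n + a)/r) and what remains
    is a Gamma integral. *)
Lemma integral_homogeneous n (r a : R) (g : n.-tuple R -> R) : 0 < r ->
  measurable_fun setT g -> (forall x, 0 <= g x) ->
  (forall l x, 0 < l -> g (scale_tuple l x) = l `^ a * g x) ->
  (\int[lebesgue_tuple R n]_x (g x * expR (- powR_sum r x))%:E =
   egammaD ((n%:R + a) / r) * \int[lebesgue_tuple R n]_(x in lq_ball n r%:E) (g x)%:E)%E.
Proof.
move=> r0 mg g0 ga.
set B := (\int[_]_(x in lq_ball n r%:E) _)%E.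
pose h1 (sx : measurableTypeR R * n.-tuple R) : R :=
  \1_(`]0%R, +oo[ : set (measurableTypeR R)) sx.1 * (powR_sum r sx.2 <= sx.1)%R%:R * expR (- sx.1).
pose h sx : R := h1 sx * g sx.2.
have h10 sx : 0 <= h1 sx by rewrite /h1 !mulr_ge0 ?expR_ge0.
have h0 sx : (0 <= (h sx)%:E)%E by rewrite lee_fin /h mulr_ge0.
have mN : measurable_fun [set: measurableTypeR R * n.-tuple R]
    (fun sx => powR_sum r sx.2 - sx.1 : R).
  apply: measurable_funB; last exact: measurable_fst.
  exact: (measurableT_comp (@measurable_powR_sum n r) measurable_snd).
have mh1 : measurable_fun [set: measurableTypeR R * n.-tuple R] (fun sx => (h1 sx)%:E).
  apply/measurable_EFinP.
  apply: measurable_funM; last first.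
    by apply: measurableT_comp => //; apply: measurable_funN.
  apply: measurable_funM.
    by apply: (measurableT_comp (measurable_indic _)).
  have := mN measurableT `]-oo, 0%R]%classic (measurable_itv _); rewrite setTI => mA.
  rewrite (_ : (fun _ => _) = \1_((fun sx : measurableTypeR R * n.-tuple R =>
    powR_sum r sx.2 - sx.1 : R) @^-1` `]-oo, 0%R]%classic)).
    exact: measurable_indic.
  apply/funext => sx; rewrite indicE; congr ((nat_of_bool _)%:R); apply/idP/idP.
    by move=> H; apply/mem_set; rewrite /= in_itv/= subr_le0.
  by move/set_mem; rewrite /= in_itv/= subr_le0.
have mh : measurable_fun [set: measurableTypeR R * n.-tuple R] (fun sx => (h sx)%:E).
  apply/measurable_EFinP; apply: measurable_funM; last exact: (measurableT_comp mg).
  exact/measurable_EFinP.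
transitivity (\int[mu \x lebesgue_tuple R n]_sx (h sx)%:E)%E.
  rewrite (fubini_tonelli2 _ mh h0); apply: eq_integral => x _.
  rewrite /fubini_G mulrC EFinM -(integral_layer (powR_sum_ge0 r x)).
  rewrite -ge0_integralZr//.
  - exact: (measurable_fun_pair1 _ mh1).
  - by rewrite lee_fin.
rewrite (fubini_tonelli1 _ mh h0) /egammaD.
have B0 : (0 <= B)%E by apply: integral_ge0 => x _; rewrite lee_fin.
rewrite -ge0_integralZr//; last 2 first.
- apply: measurable_funTS; apply/measurable_EFinP; apply: measurable_funM.
    exact: measurable_powR.
  by apply: measurableT_comp => //; exact: measurable_funN.
- by move=> s _; rewrite lee_fin mulr_ge0 ?powR_ge0 ?expR_ge0.
rewrite [RHS]integral_mkcond.
apply: eq_integral => s _; rewrite patchE /fubini_F.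
case: ifPn => [|s0]; last first.
  by apply: integral0_eq => x _; rewrite /h /h1/= indicE (negbTE s0) !mul0r.
rewrite inE/= in_itv/= andbT => s0.
set l := s `^ r^-1.
have l0 : 0 < l by exact: powR_gt0.
have lr : l `^ r = s by rewrite /l -powRrM mulVf ?gt_eqF// powRr1// ltW.
rewrite -(@integral_scale_tuple n l (fun x => (h (s, x))%:E) l0)//; last first.
  exact: (measurable_fun_pair2 s mh).
have mB := @measurable_lq_ball R n r%:E.
transitivity ((l ^+ n)%:E * ((l `^ a * expR (- s))%:E * B))%E; last first.
  rewrite muleA -EFinM mulrA; congr (_ * _)%E; congr EFin; congr (_ * _).
  rewrite -powR_mulrn ?ltW// -powRD; last by rewrite (gt_eqF l0) implybT.
  by rewrite -powRrM mulrC.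
congr (_ * _)%E; rewrite /B -ge0_integralZl//; last 3 first.
- by apply: measurable_funTS; apply/measurable_EFinP.
- by move=> x _; rewrite lee_fin.
- by rewrite lee_fin mulr_ge0 ?powR_ge0 ?expR_ge0.
rewrite [RHS]integral_mkcond.
apply: eq_integral => x _; rewrite patchE /h /h1 [_.1]/= [_.2]/=.
rewrite (powR_sum_scale_tuple _ _ (ltW l0)) lr ga// indicE.
have -> : (s \in `]0%R, +oo[%classic) = true.
  by apply/mem_set; rewrite /= in_itv/= s0.
have -> : (x \in lq_ball n r%:E) = (powR_sum r x <= 1).
  by apply/idP/idP => [/set_mem//|H]; exact/mem_set.
rewrite -[leRHS]mulr1 ler_pM2l// mul1r.
case: ifPn => _; last by rewrite !mul0r.
by rewrite mul1r -EFinM; congr EFin; ring.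
Qed.

End layer_cake.

(** * Bounds and log-convexity of the Gamma function *)

Section gamma_bounds.
Variable R : realType.
Notation mu := (@lebesgue_measure R).

Lemma ln_leB1 (y : R) : 0 < y -> ln y <= y - 1.
Proof.
move=> y0; have := @le_ln1Dx R (y - 1).
by rewrite (_ : 1 + (y - 1) = y); [apply; lra|ring].
Qed.

Lemma measurable_gamma_integrand (x : R) (D : set (measurableTypeR R)) :
  measurable_fun D (fun s : measurableTypeR R => (s `^ x * expR (- s))%:E).
Proof.
apply: measurable_funTS; apply/measurable_EFinP; apply: measurable_funM.
  exact: measurable_powR.
by apply: measurableT_comp => //; exact: measurable_funN.
Qed.

Lemma egammaD_ge0 (x : R) : (0 <= egammaD x)%E.
Proof. by apply: integral_ge0 => s _; rewrite lee_fin mulr_ge0 ?powR_ge0 ?expR_ge0. Qed.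

(** Keep only s >= x, where s^x >= x^x. *)
Lemma egammaD_lower (x : R) : 0 <= x -> ((x `^ x * expR (- x))%:E <= egammaD x)%E.
Proof.
move=> x0.
have -> : ((x `^ x * expR (- x))%:E =
    \int[mu]_(s in `]x, +oo[) (x `^ x * expR (- s))%:E)%E.
  under eq_integral do rewrite EFinM.
  have mexp : measurable_fun `]x, +oo[ (fun s : measurableTypeR R => (expR (- s))%:E).
    apply: measurable_funTS; apply/measurable_EFinP.
    by apply: measurableT_comp => //; exact: measurable_funN.
  rewrite ge0_integralZl//; last by rewrite lee_fin powR_ge0.
  rewrite integral_itv_obnd_cbnd// EFinM; congr (_ * _)%E.
  have := @ge0_integral_expR_tail R x 1 ltr01; rewrite mul1r divr1 => <-.
  by apply: eq_integral => s _; rewrite mul1r.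
rewrite /egammaD [X in (X <= _)%E]integral_mkcond [X in (_ <= X)%E]integral_mkcond.
apply: le_integral_any => s; rewrite !patchE.
  by case: ifPn => // _; rewrite lee_fin mulr_ge0 ?powR_ge0 ?expR_ge0.
case: ifPn => [|_]; last first.
  by case: ifPn => // _; rewrite lee_fin mulr_ge0 ?powR_ge0 ?expR_ge0.
rewrite inE/= in_itv/= andbT => xs.
rewrite ifT; last by rewrite inE/= in_itv/= andbT (le_lt_trans x0).
rewrite lee_fin ler_pM2r ?expR_gt0// ge0_ler_powR// ?nnegrE//; last exact: ltW.
by rewrite (le_trans x0)// ltW.
Qed.

(** Reserve the fraction 1/(x + 1) of the exponential for convergence; the rest
    of the integrand, s^x exp(-s x/(x + 1)), is largest at s = x + 1. *)
Lemma egammaD_upper (x : R) : 0 <= x ->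
  (egammaD x <= ((x + 1) * ((x + 1) `^ x * expR (- x)))%:E)%E.
Proof.
move=> x0; have x1 : 0 < x + 1 by lra.
set C := (x + 1) `^ x * expR (- x).
have C0 : 0 <= C by rewrite mulr_ge0 ?powR_ge0 ?expR_ge0.
have -> : (((x + 1) * C)%:E =
    \int[mu]_(s in `]0%R, +oo[) (C * expR (- ((x + 1)^-1 * s)))%:E)%E.
  under eq_integral do rewrite EFinM.
  have mexp : measurable_fun (`]0%R, +oo[%classic : set (measurableTypeR R))
    (fun s : measurableTypeR R => (expR (- ((x + 1)^-1 * s)))%:E).
    apply: measurable_funTS; apply/measurable_EFinP.
    apply: measurableT_comp => //; apply: measurable_funN.
    exact: measurable_funM.
  rewrite ge0_integralZl//.
  rewrite integral_itv_obnd_cbnd// ge0_integral_expR_tail ?invr_gt0//.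
  by rewrite mulr0 oppr0 expR0 invrK mul1r -EFinM mulrC.
rewrite /egammaD; apply: ge0_le_integral => //.
- by move=> s _; rewrite lee_fin mulr_ge0 ?powR_ge0 ?expR_ge0.
- exact: measurable_gamma_integrand.
- apply: measurable_funTS; apply/measurable_EFinP; apply: measurable_funM => //.
  apply: measurableT_comp => //; apply: measurable_funN.
  exact: measurable_funM.
move=> s /=; rewrite in_itv/= andbT => s0; rewrite lee_fin.
pose y := s / (x + 1).
have y0 : 0 < y by rewrite divr_gt0.
have sE : s = (x + 1) * y by rewrite /y mulrC divfK// gt_eqF.
have -> : (x + 1)^-1 * s = y by rewrite mulrC.
rewrite /C {1}sE (powRM _ (ltW x1) (ltW y0)) -!mulrA ler_pM2l ?powR_gt0// -expRD.
rewrite {1}/powR gt_eqF// -expRD ler_expR sE.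
have : x * ln y <= x * (y - 1) by rewrite ler_wpM2l// ln_leB1.
lra.
Qed.

(** Gamma(1 + x) as a real number; the shift makes factorials, volumes and the
    powers of the layer-cake formula all take the argument x. *)
Definition gammaD (x : R) : R := fine (egammaD x).

Lemma egammaD_fineE (x : R) : 0 <= x -> egammaD x = (gammaD x)%:E.
Proof.
move=> x0; rewrite /gammaD fineK// ge0_fin_numE ?egammaD_ge0//.
exact: le_lt_trans (egammaD_upper x0) (ltry _).
Qed.

Lemma gammaDE (x : R) : gammaD x = Gamma (1 + x).
Proof. by rewrite /gammaD /Gamma /Rintegral addrAC subrr add0r. Qed.

Lemma gammaD_lower (x : R) : 0 <= x -> x `^ x * expR (- x) <= gammaD x.
Proof. by move=> x0; rewrite -lee_fin -egammaD_fineE// egammaD_lower. Qed.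

Lemma gammaD_upper (x : R) : 0 <= x ->
  gammaD x <= (x + 1) * ((x + 1) `^ x * expR (- x)).
Proof. by move=> x0; rewrite -lee_fin -egammaD_fineE// egammaD_upper. Qed.

Lemma gammaD_gt0 (x : R) : 0 <= x -> 0 < gammaD x.
Proof.
move=> x0; apply: lt_le_trans (gammaD_lower x0).
rewrite mulr_gt0 ?expR_gt0//; move: x0; rewrite le_eqVlt => /orP[/eqP <-|x0].
  by rewrite powRr0.
exact: powR_gt0.
Qed.

(** A pointwise inequality between three powers integrates, against exp(-s), to
    the same inequality between Gamma values. *)
Lemma gammaD_le2 (x y z a b c : R) : 0 <= x -> 0 <= y -> 0 <= z ->
  0 <= a -> 0 <= b -> 0 <= c ->
  (forall s, 0 < s -> a * s `^ x <= b * s `^ y + c * s `^ z) ->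
  a * gammaD x <= b * gammaD y + c * gammaD z.
Proof.
move=> x0 y0 z0 a0 b0 c0 h.
have fE k w : 0 <= w -> ((k * gammaD w)%:E = k%:E * egammaD w)%E.
  by move=> w0; rewrite (egammaD_fineE w0) EFinM.
rewrite -lee_fin EFinD (fE _ _ x0) (fE _ _ y0) (fE _ _ z0) /egammaD.
have mI t : measurable_fun (`]0%R, +oo[%classic : set (measurableTypeR R))
  (fun s : measurableTypeR R => (s `^ t * expR (- s))%:E) by exact: measurable_gamma_integrand.
have I0 t (s : measurableTypeR R) : (0 <= (s `^ t * expR (- s))%:E)%E.
  by rewrite lee_fin mulr_ge0 ?powR_ge0 ?expR_ge0.
rewrite -!ge0_integralZl ?lee_fin// -ge0_integralD//; last 4 first.
- by move=> s _; rewrite mule_ge0// lee_fin.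
- exact: measurable_funeM.
- by move=> s _; rewrite mule_ge0// lee_fin.
- exact: measurable_funeM.
apply: ge0_le_integral => //.
- by move=> s _; rewrite mule_ge0// lee_fin.
- exact: measurable_funeM.
- by apply: emeasurable_funD; exact: measurable_funeM.
move=> s /=; rewrite in_itv/= andbT => s0.
rewrite -!EFinM -EFinD lee_fin !mulrA -mulrDl ler_wpM2r ?expR_ge0//.
exact: h.
Qed.

Lemma powRN_bernoulli (y u : R) : 0 < y -> 0 <= u -> 1 - u * (y - 1) <= y `^ (- u).
Proof.
move=> y0 u0; rewrite /powR gt_eqF//.
apply: le_trans (expR_ge1Dx _); rewrite lerD2l mulNr lerN2 ler_wpM2l//.
exact: ln_leB1.
Qed.

Let weighted_amgm (p v G0 G1 : R) : 0 < p -> 0 < G0 -> 0 < G1 ->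
  2 * (p * v) <= (G1 / G0) * p + (G0 / G1) * (p * v * v).
Proof.
move=> p0 g0 g1; rewrite -subr_ge0.
rewrite (_ : _ - _ = p * ((G0 / G1) * (v - G1 / G0) ^+ 2)); last first.
  by field; rewrite !gt_eqF.
apply: mulr_ge0; first exact: ltW.
by apply: mulr_ge0; [apply: divr_ge0; exact: ltW|exact: sqr_ge0].
Qed.

Let amgm_sqr (G0 G1 G2 : R) : 0 < G0 -> 0 < G1 ->
  2 * G1 <= (G1 / G0) * G0 + (G0 / G1) * G2 -> G1 ^+ 2 <= G0 * G2.
Proof.
move=> g0 g1; rewrite divfK ?gt_eqF// (_ : 2 * G1 = G1 + G1); last by ring.
by rewrite lerD2l mulrAC ler_pdivlMr// -expr2.
Qed.

(** Integrate the weighted inequality 2 s^(x + u) <= l s^x + l^-1 s^(x + 2 u)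
    with l = gammaD (x + u) / gammaD x. *)
Lemma gammaD_logconvex (x u : R) : 0 <= x -> 0 <= u ->
  gammaD (x + u) ^+ 2 <= gammaD x * gammaD (x + u + u).
Proof.
move=> x0 u0.
have xu0 : 0 <= x + u by rewrite addr_ge0.
have xuu0 : 0 <= x + u + u by rewrite addr_ge0.
have g0 := gammaD_gt0 x0; have g1 := gammaD_gt0 xu0.
have w1 := divr_ge0 (ltW g1) (ltW g0); have w0 := divr_ge0 (ltW g0) (ltW g1).
apply: (amgm_sqr g0 g1).
apply: (gammaD_le2 xu0 x0 xuu0 (ler0n R 2) w1 w0) => s s0.
have sx : s `^ (x + u) = s `^ x * s `^ u by rewrite powRD// (gt_eqF s0) implybT.
have sxx : s `^ (x + u + u) = s `^ x * s `^ u * s `^ u.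
  by rewrite powRD ?sx// (gt_eqF s0) implybT.
rewrite sxx sx.
exact: (weighted_amgm _ (powR_gt0 x s0) g0 g1).
Qed.

End gamma_bounds.

(** * Functional equation and ratios of Gamma values *)

Section gamma_equation.
Variable R : realType.
Notation mu := (@lebesgue_measure R).

Lemma integral_tuple1 (f : R -> \bar R) : measurable_fun [set: R] f ->
  (forall x, 0 <= f x)%E ->
  (\int[lebesgue_tuple R 1]_x f (tnth x ord0) = \int[mu]_u f u)%E.
Proof.
move=> mf f0; rewrite ge0_integral_tcons//; last first.
  exact: (measurableT_comp mf (@measurable_tnth _ _ _ ord0)).
apply: eq_integral => u _; rewrite ge0_integral_tuple0//.
rewrite (_ : (fun _ => _) = cst (f u)); first exact: measurable_cst.
by apply/funext => x /=; rewrite tnth0.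
Qed.

Lemma powR_sum1 (r : R) (x : 1.-tuple R) : powR_sum r x = `|tnth x ord0| `^ r.
Proof. by rewrite /powR_sum big_ord1. Qed.

(** The case of one variable, where the ball is [-1, 1] for every exponent. *)
Lemma integral_homogeneous1 (r a : R) (g : R -> R) : 0 < r ->
  measurable_fun setT g -> (forall x, 0 <= g x) ->
  (forall l x, 0 < l -> g (l * x) = l `^ a * g x) ->
  (\int[mu]_u (g u * expR (- (`|u| `^ r)))%:E =
   egammaD ((1 + a) / r) * \int[mu]_(u in `[(-1)%R, 1%R]) (g u)%:E)%E.
Proof.
move=> r0 mg g0 ga.
have mgt : measurable_fun [set: 1.-tuple R] (fun x => g (tnth x ord0)).
  exact: (measurableT_comp mg (@measurable_tnth _ _ _ ord0)).
have := @integral_homogeneous R 1 r a (fun x => g (tnth x ord0)) r0 mgt (fun x => g0 _).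
rewrite mulr1n => H; rewrite -[RHS]/(_ * _)%E.
rewrite -(@integral_tuple1 (fun u => (g u * expR (- (`|u| `^ r)))%:E)); last 2 first.
- apply/measurable_EFinP; apply: measurable_funM => //.
  apply: measurableT_comp => //; apply: measurable_funN.
  apply: (measurableT_comp (measurable_powR r)).
  exact: normr_measurable.
- by move=> x; rewrite lee_fin mulr_ge0 ?expR_ge0.
under eq_integral do rewrite -powR_sum1.
rewrite H; last by move=> l x l0; rewrite tnth_scale_tuple ga.
congr (_ * _)%E; rewrite [RHS]integral_mkcond.
rewrite -(@integral_tuple1 ((fun u => (g u)%:E) \_ `[(-1)%R, 1%R])); last 2 first.
- apply: (measurable_restrictT _ _).1; first exact: measurable_itv.
  by apply: measurable_funTS; apply/measurable_EFinP.
- by move=> x; apply: erestrict_ge0 => y _; rewrite lee_fin.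
rewrite integral_mkcond; apply: eq_integral => x _; rewrite !patchE.
congr (if _ then _ else _).
have E : (`|tnth x ord0| `^ r <= 1) = (-1 <= tnth x ord0 <= 1).
  have E1 : (1 : R) `^ r = 1 by rewrite powR1.
  rewrite -ler_norml -[X in X = _]/(_ <= _) -[X in (_ <= X) = _]E1; apply/idP/idP => h.
    by rewrite leNgt; apply: contraTN h => h; rewrite -ltNge gt0_ltr_powR// nnegrE.
  by rewrite ge0_ler_powR// ?ltW// nnegrE.
apply/idP/idP => /set_mem /= h; apply/mem_set; move: h; rewrite /= in_itv/= -E -powR_sum1//.
Qed.

(** The layer-cake formula in one variable, with r = 1 and u^a on the positive
    half-line: its integral over [0, 1] is 1/(a + 1). *)
Lemma egammaD_succ (a : R) : 0 <= a -> (egammaD a = (a + 1)^-1%:E * egammaD (a + 1))%E.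
Proof.
move=> a0.
have := @integral_homogeneous1 1 a (fun u => \1_(`]0%R, +oo[ : set R) u * u `^ a) ltr01.
rewrite divr1 addrC muleC => H.
have -> : egammaD a = (\int[mu]_u
    (\1_(`]0%R, +oo[ : set R) u * u `^ a * expR (- (`|u| `^ 1)))%:E)%E.
  rewrite /egammaD integral_mkcond; apply: eq_integral => u _; rewrite patchE indicE.
  case: ifPn => [|_]; last by rewrite !mul0r.
  by rewrite inE/= in_itv/= andbT => u0; rewrite mul1r powRr1// gtr0_norm.
rewrite H; last 3 first.
- apply: measurable_funM; [exact: measurable_indic|exact: measurable_powR].
- by move=> x; rewrite mulr_ge0 ?powR_ge0.
- move=> l x l0; rewrite !indicE !mem_setE !in_itv/= !andbT pmulr_rgt0//.
  by case: ltP => x0; rewrite ?mul0r ?mulr0// !mul1r powRM ?ltW.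
congr (_ * _)%E.
transitivity (\int[mu]_(x in `[0%R, 1%R]) (x `^ a)%:E)%E.
  rewrite -[RHS]integral_itv_obnd_cbnd; last first.
    apply: measurable_funTS; apply/measurable_EFinP; exact: measurable_powR.
  rewrite integral_mkcond [RHS]integral_mkcond; apply: eq_integral => u _.
  rewrite !patchE indicE !mem_setE !in_itv/= andbT.
  have [u0|u0] := ltP 0 u; rewrite ?mul1r ?mul0r//=; last by case: ifP.
  by rewrite (_ : (-1 <= u))//; lra.
move: a0; rewrite le_eqVlt => /orP[/eqP <-|a0]; last exact: integral_powR01.
under eq_integral do rewrite powRr0.
rewrite integral_cst//= mul1e lebesgue_measure_itv/= lte_fin ltr01.
by rewrite oppr0 adde0 add0r invr1.
Qed.

Lemma gammaD_succ (a : R) : 0 <= a -> gammaD (a + 1) = (a + 1) * gammaD a.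
Proof.
move=> a0; have a1 : 0 < a + 1 by lra.
have := egammaD_succ a0; rewrite !egammaD_fineE// ?ltW// -EFinM => -[->].
by rewrite mulrA mulfV ?mul1r// gt_eqF.
Qed.

Lemma gammaD0 : gammaD (0 : R) = 1.
Proof.
rewrite /gammaD /egammaD.
under eq_integral do rewrite powRr0 mul1r.
rewrite integral_itv_obnd_cbnd; last first.
  apply: measurable_funTS; apply/measurable_EFinP.
  by apply: measurableT_comp => //; exact: measurable_funN.
have := @ge0_integral_expR_tail R 0 1 ltr01; rewrite mul1r oppr0 expR0 divr1.
by under eq_integral do rewrite mul1r; move=> ->.
Qed.

Lemma gammaD_fact n : gammaD (n%:R : R) = n`!%:R.
Proof.
elim: n => [|n IH]; first by rewrite gammaD0.
by rewrite -natr1 gammaD_succ// IH natr1 factS natrM.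
Qed.

Lemma powR_divN (x y u : R) : 0 < x -> 0 < y -> (x / y) `^ (- u) = y `^ u / x `^ u.
Proof.
move=> x0 y0; rewrite powRN powRM; [|exact: ltW|by rewrite invr_ge0 ltW].
rewrite -[y^-1]powR_inv1; last exact: ltW.
by rewrite -powRrM mulN1r powRN invfM invrK mulrC.
Qed.

Let powR_succ (s y : R) : 0 < s -> s `^ (y + 1) = s `^ y * s.
Proof.
by move=> s0; rewrite powRD ?powRr1 ?(ltW s0)// (gt_eqF s0) implybT.
Qed.

Let ratio_ge_pointwise (s x u : R) : 0 < s -> 0 < x -> 0 <= u ->
  (x `^ u * (1 + u)) * s `^ x <=
  1 * s `^ (x + u) + (x `^ u * u * x) * s `^ (x - 1).
Proof.
move=> s0 x0 u0.
have pu : 0 < x `^ u by exact: powR_gt0.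
have E : s `^ x = s `^ (x - 1) * s by rewrite -(powR_succ _ s0) subrK.
have E2 : s `^ (x + u) = s `^ x * s `^ u by rewrite powRD// (gt_eqF s0) implybT.
have := @powRN_bernoulli R (x / s) u (divr_gt0 x0 s0) u0.
rewrite powR_divN// ler_pdivlMr// mulrC => h.
have ps : 0 < s `^ (x - 1) by exact: powR_gt0.
have : s `^ (x - 1) * s * (x `^ u * (1 - u * (x / s - 1))) <= s `^ (x - 1) * s * s `^ u.
  by rewrite ler_pM2l// mulr_gt0.
rewrite (_ : _ * s * (_ * _) = x `^ u * (1 + u) * (s `^ (x - 1) * s) -
    x `^ u * u * x * s `^ (x - 1)); last first.
  by field; rewrite gt_eqF.
by rewrite -!E E2 mul1r lerBlDr.
Qed.

Let cancel_ge (p u x g g' h : R) : g = x * g' ->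
  p * (1 + u) * g <= 1 * h + p * u * x * g' -> p * g <= h.
Proof.
move=> E; have -> : p * u * x * g' = p * u * g by rewrite E; ring.
lra.
Qed.

(** Integrate s^(x + u) >= x^u s^x (1 - u (x/s - 1)), which is Bernoulli's
    inequality for (x/s)^(-u); the term in u integrates to 0 because
    gammaD x = x gammaD (x - 1). *)
Lemma gammaD_ratio_ge (x u : R) : 1 <= x -> 0 <= u ->
  x `^ u * gammaD x <= gammaD (x + u).
Proof.
move=> x1 u0; have x0 : 0 < x by lra.
have p0 := powR_ge0 x u.
have xm0 : 0 <= x - 1 by lra.
have gE : gammaD x = x * gammaD (x - 1) by have := gammaD_succ xm0; rewrite subrK.
apply: (cancel_ge (u := u) gE).
apply: gammaD_le2 => [|||||| s s0].
- exact: ltW.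
- exact: addr_ge0 (ltW x0) u0.
- exact: xm0.
- exact: mulr_ge0 p0 (addr_ge0 ler01 u0).
- exact: ler01.
- exact: mulr_ge0 (mulr_ge0 p0 u0) (ltW x0).
exact: ratio_ge_pointwise.
Qed.

Let ratio_le_pointwise (s x u m : R) : 0 < s -> 0 < m -> 0 <= u ->
  (1 + u) * s `^ (x + u) <= m `^ u * s `^ x + (u / m) * s `^ (x + u + 1).
Proof.
move=> s0 m0 u0.
have E2 : s `^ (x + u) = s `^ x * s `^ u by rewrite powRD// (gt_eqF s0) implybT.
rewrite (powR_succ _ s0) E2.
have := @powRN_bernoulli R (s / m) u (divr_gt0 s0 m0) u0.
rewrite powR_divN//.
have ps : 0 < s `^ u by exact: powR_gt0.
have px : 0 < s `^ x by exact: powR_gt0.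
rewrite ler_pdivlMr// mulrC => h.
have : s `^ x * (s `^ u * (1 - u * (s / m - 1))) <= s `^ x * m `^ u.
  by rewrite ler_pM2l.
lra.
Qed.

Let cancel_le (u g h : R) : (1 + u) * g <= h + u * g -> g <= h.
Proof. lra. Qed.

(** Integrate s^(x + u) (1 - u (s/m - 1)) <= m^u s^x, which is Bernoulli's
    inequality for (s/m)^(-u), with m = x + u + 1; this m makes the term in u
    integrate to 0. *)
Lemma gammaD_ratio_le (x u : R) : 0 <= x -> 0 <= u ->
  gammaD (x + u) <= (x + u + 1) `^ u * gammaD x.
Proof.
move=> x0 u0; have xu0 : 0 <= x + u by exact: addr_ge0.
set m := x + u + 1; have m0 : 0 < m by rewrite ltr_wpDl.
apply: (cancel_le (u := u)).
have -> : u * gammaD (x + u) = u / m * gammaD (x + u + 1).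
  by rewrite (gammaD_succ xu0) -/m mulrA divfK ?gt_eqF.
apply: gammaD_le2 => [|||||| s s0].
- exact: xu0.
- exact: x0.
- exact: ltW m0.
- exact: addr_ge0 ler01 u0.
- exact: powR_ge0.
- exact: divr_ge0 u0 (ltW m0).
exact: ratio_le_pointwise.
Qed.

End gamma_equation.

(** * Moments and volumes of the balls *)

Section ball_moments.
Variable R : realType.
Notation mu := (@lebesgue_measure R).

Definition abs_monomial n (al : 'I_n -> nat) (x : n.-tuple R) : R :=
  \prod_i `|tnth x i| ^+ al i.

Lemma measurable_abs_monomial n (al : 'I_n -> nat) :
  measurable_fun setT (abs_monomial al).
Proof.
apply: measurable_prod => i _; apply: measurable_funX.
by apply: measurableT_comp => //; exact: measurable_tnth.
Qed.

Lemma abs_monomial_ge0 n (al : 'I_n -> nat) x : 0 <= abs_monomial al x.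
Proof. by apply: prodr_ge0 => i _; rewrite exprn_ge0. Qed.

Lemma prodEFin (I : Type) (r : seq I) (P : pred I) (F : I -> R) :
  (\prod_(i <- r | P i) (F i)%:E = (\prod_(i <- r | P i) F i)%:E)%E.
Proof. by rewrite (big_morph EFin EFinM erefl). Qed.

(** The integral of |u|^a exp(-|u|^r) over the line for t = 1/r, and that of
    |u|^a over [-1, 1] for t = 0. *)
Definition coord_moment (t : R) (a : nat) : R := gammaD ((1 + a%:R) * t) * (2 / (a%:R + 1)).

Lemma coord_moment_gt0 t a : 0 <= t -> 0 < coord_moment t a.
Proof.
by move=> t0; rewrite mulr_gt0 ?divr_gt0 ?ltr_wpDl// gammaD_gt0// mulr_ge0// addr_ge0.
Qed.

(** The layer-cake formula for a monomial, whose left-hand side factors. *)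
Lemma lq_ball_moment_fin n (r : R) (al : 'I_n -> nat) : 0 < r ->
  (\int[lebesgue_tuple R n]_(x in lq_ball n r%:E) (abs_monomial al x)%:E =
  ((\prod_i coord_moment r^-1 (al i)) / gammaD ((n%:R + (\sum_i al i)%:R) * r^-1))%:E)%E.
Proof.
move=> r0.
have := @integral_homogeneous R n r (\sum_i al i)%:R (abs_monomial al) r0
  (measurable_abs_monomial al) (abs_monomial_ge0 al).
have hom l (x : n.-tuple R) : 0 < l ->
    abs_monomial al (scale_tuple l x) = l `^ (\sum_i al i)%:R * abs_monomial al x.
  move=> l0; rewrite powR_mulrn ?ltW// -prodrXr /abs_monomial -big_split /=.
  by apply: eq_bigr => i _; rewrite tnth_scale_tuple normrM exprMn gtr0_norm.
move=> /(_ hom) H.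
have L : (\int[lebesgue_tuple R n]_x (abs_monomial al x * expR (- powR_sum r x))%:E =
    (\prod_i coord_moment r^-1 (al i))%:E)%E.
  under eq_integral do rewrite /powR_sum -sumrN expR_sum /abs_monomial -big_split /=.
  rewrite (ge0_integral_prod (f := fun i u => `|u| ^+ al i * expR (- `|u| `^ r))).
  - rewrite -prodEFin; apply: eq_bigr => i _.
    rewrite (@integral_homogeneous1 R r (al i)%:R (fun u => `|u| ^+ al i))//; last 2 first.
    + by apply: measurable_funX; exact: normr_measurable.
    + by move=> l x l0; rewrite normrM exprMn gtr0_norm// powR_mulrn// ltW.
    under eq_integral do rewrite -powR_mulrn//.
    rewrite integral_normr_powR// egammaD_fineE -?EFinM//; last first.
      by apply: divr_ge0; [rewrite addr_ge0|exact: ltW].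
  - move=> i; apply: measurable_funM.
      by apply: measurable_funX; exact: normr_measurable.
    apply: measurableT_comp => //; apply: measurable_funN.
    apply: (measurableT_comp (measurable_powR r)).
    exact: normr_measurable.
  - by move=> i u; rewrite mulr_ge0 ?exprn_ge0 ?expR_ge0.
have g0 : 0 < gammaD ((n%:R + (\sum_i al i)%:R) / r).
  by rewrite gammaD_gt0//; apply: divr_ge0; [rewrite addr_ge0|exact: ltW].
have e0 : 0 <= (n%:R + (\sum_i al i)%:R) / r.
  by apply: divr_ge0; [rewrite addr_ge0|exact: ltW].
move: H; rewrite L egammaD_fineE// => H.
by rewrite EFinM muleC H muleA -EFinM mulVf ?mul1e// gt_eqF.
Qed.

(** The cube is a product of intervals; the Gamma factor is gammaD 0 = 1, which
    gives the formula for finite exponents its value at t = 0. *)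
Lemma lq_ball_moment_oo n (al : 'I_n -> nat) :
  (\int[lebesgue_tuple R n]_(x in lq_ball n +oo) (abs_monomial al x)%:E =
  ((\prod_i coord_moment 0 (al i)) / gammaD ((n%:R + (\sum_i al i)%:R) * 0))%:E)%E.
Proof.
rewrite mulr0 gammaD0 divr1 -prodEFin.
transitivity (\prod_i \int[mu]_u (\1_(`[(-1)%R, 1%R] : set R) u * `|u| ^+ al i)%:E)%E; last first.
  apply: eq_bigr => i _; rewrite /coord_moment mulr0 gammaD0 mul1r -integral_normr_powR//.
  rewrite [RHS]integral_mkcond; apply: eq_integral => u _; rewrite patchE indicE.
  by case: ifPn => _; rewrite ?mul0r// mul1r powR_mulrn.
rewrite -(ge0_integral_prod (f := fun i u => \1_(`[(-1)%R, 1%R] : set R) u * `|u| ^+ al i)).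
- rewrite integral_mkcond; apply: eq_integral => x _; rewrite patchE /=.
  rewrite big_split /= -/(abs_monomial al x).
  have [xB|xB] := boolP (x \in lq_ball n +oo).
    rewrite big1 ?mul1r// => i _; rewrite indicE mem_set//= in_itv/= -ler_norml.
    move/set_mem: xB => /= xB; apply: le_trans xB; exact: le_bigmax.
  have [i xi] : exists i, 1 < `|tnth x i|.
    apply/existsP; apply: contraNT xB => /existsPn h; apply/mem_set => /=.
    by apply/bigmax_leP; split => // i _; rewrite leNgt h.
  rewrite (bigD1 i)//= indicE memNset ?mul0r//= in_itv/= -ler_norml.
  by apply/negP; rewrite -ltNge.
- move=> i; apply: measurable_funM; first exact: measurable_indic.
  by apply: measurable_funX; exact: normr_measurable.
- by move=> i u; rewrite mulr_ge0 ?exprn_ge0.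
Qed.

Definition inv_exp (q : \bar R) : R := fine (q^-1)%E.

Lemma inv_exp_itv (q : \bar R) : (1 <= q)%E -> 0 <= inv_exp q <= 1.
Proof.
rewrite /inv_exp; case: q => [r| |]; rewrite ?leey//.
  rewrite lee_fin => r1; have r0 : 0 < r by lra.
  by rewrite inver gt_eqF//= invr_ge0 ltW//= invf_le1.
by move=> _; rewrite /inve /= lexx ler01.
Qed.

Lemma lq_ball_moment n (q : \bar R) (al : 'I_n -> nat) : (1 <= q)%E ->
  (\int[lebesgue_tuple R n]_(x in lq_ball n q) (abs_monomial al x)%:E =
  ((\prod_i coord_moment (inv_exp q) (al i)) /
    gammaD ((n%:R + (\sum_i al i)%:R) * inv_exp q))%:E)%E.
Proof.
rewrite /inv_exp; case: q => [r| |]//.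
  rewrite lee_fin => r1; have r0 : 0 < r by lra.
  by rewrite inver gt_eqF//=; exact: lq_ball_moment_fin.
by move=> _; rewrite /inve /=; exact: lq_ball_moment_oo.
Qed.

Lemma lq_ball_volume n (q : \bar R) : (1 <= q)%E ->
  (lebesgue_tuple R n (lq_ball n q) =
  (coord_moment (inv_exp q) 0 ^+ n / gammaD (n%:R * inv_exp q))%:E)%E.
Proof.
move=> q1; have := @lq_ball_moment n q (fun=> 0%N) q1.
rewrite prodr_const card_ord big1// addr0 => <-.
under eq_integral do rewrite /abs_monomial big1//.
by rewrite integral_cst ?mul1e//; exact: measurable_lq_ball.
Qed.

Lemma cross_volume n :
  lebesgue_tuple R n (lq_ball n 1%:E) = (2 ^+ n / n`!%:R)%:E.
Proof.
rewrite lq_ball_volume ?lee_fin// /inv_exp inver oner_eq0/= invr1 mulr1 gammaD_fact.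
by rewrite /coord_moment addr0 mulr1 -[X in gammaD X]/(1%:R) gammaD_fact mul1r add0r divr1.
Qed.

(** The layer-cake formula with exponent 1 for the indicator of the positive
    orthant, which is homogeneous of degree 0. *)
Lemma simplex_volume n :
  lebesgue_tuple R n (@corner_simplex R n) = (n`!%:R^-1)%:E.
Proof.
pose g (x : n.-tuple R) : R := \prod_i \1_(`[0%R, +oo[ : set R) (tnth x i).
have mg : measurable_fun setT g.
  apply: measurable_prod => i _.
  apply: (measurableT_comp (measurable_indic _)) => //.
  exact: measurable_tnth.
have g0 x : 0 <= g x by apply: prodr_ge0.
have gh l x : 0 < l -> g (scale_tuple l x) = l `^ 0 * g x.
  move=> l0; rewrite powRr0 mul1r; apply: eq_bigr => i _.
  by rewrite tnth_scale_tuple !indicE !mem_setE !in_itv/= !andbT pmulr_rge0.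
have := @integral_homogeneous R n 1 0 g ltr01 mg g0 gh.
rewrite divr1 addr0 egammaD_fineE// gammaD_fact.
have -> : (\int[lebesgue_tuple R n]_(x in lq_ball n 1%:E) (g x)%:E =
    lebesgue_tuple R n (@corner_simplex R n))%E.
  rewrite integral_mkcond -(integral_tuple_indic (@measurable_corner_simplex R n)).
  apply: eq_integral => x _; rewrite patchE.
  have [xS|xS] := boolP (x \in @corner_simplex R n).
    have [x0 x1] := set_mem xS.
    rewrite indicE xS ifT; last first.
      apply/mem_set; rewrite /=; under eq_bigr do rewrite powRr1// ger0_norm//.
      exact: x1.
    by rewrite /g big1// => i _; rewrite indicE mem_set//= in_itv/= x0.
  rewrite [in RHS]indicE (negbTE xS); case: ifPn => // xB.
  have [i xi] : exists i, tnth x i < 0.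
    apply/existsP; apply: contraNT xS => /existsPn h; apply/mem_set; split.
      by move=> i; rewrite leNgt h.
    move: (set_mem xB) => /=; under eq_bigr do rewrite powRr1// ger0_norm ?leNgt ?h//.
    exact.
  rewrite /g (bigD1 i)//= indicE memNset ?mul0r//= in_itv/= andbT.
  by apply/negP; rewrite -ltNge.
have -> : (\int[lebesgue_tuple R n]_x (g x * expR (- powR_sum 1 x))%:E = 1)%E.
  under eq_integral do rewrite /powR_sum -sumrN expR_sum /g -big_split /=.
  rewrite (ge0_integral_prod (f := fun i u => \1_(`[0%R, +oo[ : set R) u * expR (- `|u| `^ 1))).
  - rewrite big1// => i _.
    have := @ge0_integral_expR_tail R 0 1 ltr01; rewrite mul1r oppr0 expR0 divr1 => <-.
    rewrite [RHS]integral_mkcond; apply: eq_integral => u _; rewrite patchE indicE.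
    case: ifPn => [|_]; last by rewrite mul0r.
    by rewrite inE/= in_itv/= andbT => u0; rewrite !mul1r powRr1// ger0_norm.
  - move=> i; apply: measurable_funM; first exact: measurable_indic.
    apply: measurableT_comp => //; apply: measurable_funN.
    apply: (measurableT_comp (measurable_powR 1)).
    exact: normr_measurable.
  - by move=> i u; rewrite mulr_ge0 ?expR_ge0.
have nf : (n`!%:R : R) != 0 by rewrite pnatr_eq0 -lt0n fact_gt0.
move=> H.
have : ((n`!%:R^-1)%:E * 1 = (n`!%:R^-1)%:E *
    ((n`!%:R)%:E * lebesgue_tuple R n (@corner_simplex R n)) :> \bar R)%E by rewrite -H.
by rewrite mule1 muleA -EFinM mulVf// mul1e.
Qed.

End ball_moments.

(** * Gram determinants and projections *)

Section gram.
Variable F : realFieldType.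

(** The squared volume of the parallelepiped spanned by the rows. *)
Definition gram k m (A : 'M[F]_(k, m)) : F := \det (A *m A^T).

(** The orthogonal projection onto the complement of the row space of A, when
    the rows are independent. *)
Definition coproj k m (A : 'M[F]_(k, m)) : 'M[F]_m :=
  1%:M - A^T *m invmx (A *m A^T) *m A.

Lemma mulmx_trmx_eq0 k m (A : 'M[F]_(k, m)) : A *m A^T = 0 -> A = 0.
Proof.
move=> AA; apply/matrixP => i j; rewrite mxE.
have : (A *m A^T) i i = 0 by rewrite AA mxE.
rewrite mxE; under eq_bigr do rewrite mxE -expr2.
move=> /eqP; rewrite psumr_eq0; last by move=> ? _; exact: sqr_ge0.
by move=> /allP/(_ j (mem_index_enum _)); rewrite /= sqrf_eq0 => /eqP.
Qed.

(** Base times height squared, by the Schur complement of the Gram matrix of A.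
    When that matrix is singular the rows of A are dependent and both sides
    vanish. *)
Lemma gram_col_mx k m (y : 'rV[F]_m) (A : 'M[F]_(k, m)) :
  gram (col_mx y A) = gram A * (y *m coproj A *m y^T) 0 0.
Proof.
rewrite /gram tr_col_mx mul_col_row.
have [dA|dA] := eqVneq (\det (A *m A^T)) 0.
  rewrite dA mul0r.
  have /det0P[v v0 vA] : \det (A *m A^T) == 0 by rewrite dA.
  have vA0 : v *m A = 0.
    by apply: mulmx_trmx_eq0; rewrite trmx_mul !mulmxA -(mulmxA v) vA mul0mx.
  apply/eqP/det0P; exists (row_mx 0 v).
    by apply: contraNneq v0; rewrite -row_mx0 => /eq_row_mx[_ ->].
  by rewrite mul_row_block !mul0mx !add0r !mulmxA vA0 !mul0mx row_mx0.
have uA : A *m A^T \in unitmx by rewrite unitmxE unitfE.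
rewrite [X in \det X](_ : _ = block_mx 1%:M (y *m A^T *m invmx (A *m A^T)) 0 1%:M
  *m block_mx (y *m coproj A *m y^T) 0 (A *m y^T) (A *m A^T)).
  by rewrite det_mulmx det_ublock det_lblock !det1 !mul1r [in LHS]det_mx11 mulrC.
rewrite mulmx_block !mul1mx !mul0mx !add0r; congr block_mx.
  by rewrite /coproj mulmxBr mulmx1 mulmxBl !mulmxA subrK.
by rewrite mulmxKV.
Qed.

Section coproj.
Variables (k m : nat) (A : 'M[F]_(k, m)).
Hypothesis gA : gram A != 0.

Let uA : A *m A^T \in unitmx. Proof. by rewrite unitmxE unitfE. Qed.

Lemma coproj_tr : (coproj A)^T = coproj A.
Proof.
rewrite /coproj linearB /= trmx1 !trmx_mul trmxK trmx_inv trmx_mul trmxK.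
by rewrite mulmxA.
Qed.

Lemma coproj_idem : coproj A *m coproj A = coproj A.
Proof.
rewrite {1}/coproj mulmxBl mul1mx -[RHS]subr0; congr (_ - _).
rewrite /coproj mulmxBr mulmx1 !mulmxA.
by rewrite -(mulmxA (A^T *m _) A A^T) mulmxKV// subrr.
Qed.

Lemma coproj_trace : \tr (coproj A) = m%:R - k%:R.
Proof.
rewrite /coproj linearB /= mxtrace1 -mulmxA mxtrace_mulC -mulmxA mulVmx//.
by rewrite mxtrace1.
Qed.

Lemma coproj_diag a : coproj A a a = \sum_b coproj A a b ^+ 2.
Proof.
rewrite -{1}coproj_idem mxE; apply: eq_bigr => b _.
have -> : coproj A b a = (coproj A)^T a b by rewrite [in RHS]mxE.
by rewrite coproj_tr expr2.
Qed.

Lemma coproj_diag_ge0 a : 0 <= coproj A a a.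
Proof. by rewrite coproj_diag; apply: sumr_ge0 => b _; exact: sqr_ge0. Qed.

Lemma coproj_diag_sqr a : coproj A a a ^+ 2 <= coproj A a a.
Proof.
rewrite {2}coproj_diag (bigD1 a)//= lerDl.
by apply: sumr_ge0 => b _; exact: sqr_ge0.
Qed.

Lemma coproj_diag_le1 a : coproj A a a <= 1.
Proof.
have h := coproj_diag_sqr a; rewrite leNgt; apply: contraTN h => P1.
by rewrite -ltNge expr2 ltr_pMl// (lt_trans ltr01).
Qed.

End coproj.

Lemma gram_ge0 k m (A : 'M[F]_(k, m)) : 0 <= gram A.
Proof.
elim: k A => [|k IH] A; first by rewrite /gram det_mx00.
rewrite -[A](@vsubmxK _ 1 k) gram_col_mx.
have [g0|g0] := eqVneq (gram (dsubmx (A : 'M[F]_(1 + k, m)))) 0; first by rewrite g0 mul0r.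
apply: mulr_ge0; first exact: IH.
set y := usubmx _; set P := coproj _.
have -> : y *m P *m y^T = (y *m P) *m (y *m P)^T.
  by rewrite trmx_mul coproj_tr// !mulmxA -(mulmxA y P P) coproj_idem.
by rewrite mxE; apply: sumr_ge0 => j _; rewrite [X in _ * X]mxE -expr2 sqr_ge0.
Qed.

Lemma gram_square m (A : 'M[F]_m) : gram A = \det A ^+ 2.
Proof. by rewrite /gram det_mulmx det_tr expr2. Qed.

(** With P the projection of rank d = m - k, the sum is the second
    moment of the quadratic form y P y^T when T collects the fourth moments of y.
    Only terms with paired indices survive: the pairing a = b, c = d contributes at
    most t (tr P)^2, the two others t tr (P^2) each, and the four equal indices
    kappa t times the sum of the squares of the diagonal entries.  As P^2 = P and
    P a a <= 1, the last sums are at most tr P = d. *)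
Lemma quadratic_form_fourth k m (A : 'M[F]_(k, m)) (T : 'I_m -> 'I_m -> 'I_m -> 'I_m -> F)
    (t kappa : F) :
  gram A != 0 -> 0 <= t -> 0 <= kappa ->
  (forall a b c d i, odd ((i == a) + (i == b) + (i == c) + (i == d)) -> T a b c d = 0) ->
  (forall a b, a != b -> T a a b b <= t /\ T a b a b <= t /\ T a b b a <= t) ->
  (forall a, T a a a a <= kappa * t) ->
  \sum_a \sum_b \sum_c \sum_d coproj A a b * coproj A c d * T a b c d <=
  t * ((m%:R - k%:R) ^+ 2 + (2 + kappa) * (m%:R - k%:R)).
Proof.
move=> gA t0 kappa0 Todd T2 T4; set P := coproj A; set D := m%:R - k%:R.
have trP : \sum_a P a a = D by rewrite /D -(coproj_trace gA).
have Psym a b : P b a = P a b.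
  have -> : P b a = P^T a b by rewrite [in RHS]mxE.
  by rewrite /P coproj_tr.
apply: (@le_trans _ _ (\sum_a (P a a * (t * D + kappa * t) + 2 * t * P a a))); last first.
  rewrite big_split /= -mulr_suml -mulr_sumr trP.
  by rewrite le_eqVlt; apply/orP; left; apply/eqP; ring.
(* For fixed a the terms with b = a pair c with d, and those with b != a pair
   the set of c and d with that of a and b. *)
apply: ler_sum => a _; rewrite (bigD1 a)//=; apply: lerD.
  rewrite (eq_bigr (fun c => P a a * (P c c * T a a c c))); last first.
    move=> c _; rewrite (bigD1 c)//= big1 ?addr0 ?mulrA// => d dc.
    rewrite (Todd a a c d c) ?mulr0// eqxx (eq_sym c d) (negbTE dc).
    by case: (c == a).
  rewrite -mulr_sumr ler_wpM2l ?coproj_diag_ge0//.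
  rewrite (bigD1 a)//= addrC; apply: lerD.
    rewrite -trP [X in t * X](bigD1 a)//= mulrDr ler_wpDl ?mulr_ge0 ?coproj_diag_ge0//.
    rewrite mulr_sumr; apply: ler_sum => c ca; rewrite mulrC.
    by rewrite ler_wpM2r ?coproj_diag_ge0//; have [] := T2 a c _; rewrite // eq_sym.
  apply: (@le_trans _ _ (P a a * (kappa * t))).
    by rewrite ler_wpM2l ?coproj_diag_ge0.
  by rewrite ler_piMl ?mulr_ge0 ?coproj_diag_le1.
rewrite [in leRHS]/P (coproj_diag gA) mulr_sumr [leRHS](bigD1 a)//=; apply: ler_wpDl.
  by apply: mulr_ge0; [rewrite mulr_ge0|exact: sqr_ge0].
apply: ler_sum => b ba.
have -> : \sum_(c < m) \sum_(d < m) P a b * P c d * T a b c d =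
    P a b ^+ 2 * (T a b a b + T a b b a).
  rewrite (bigD1 a)//= (bigD1 b)//= (bigD1 b (P := fun i => i != a))//=.
  rewrite (bigD1 a (P := fun d => true))//=.
  have odd1 c d : (c, d) != (a, b) -> (c, d) != (b, a) -> T a b c d = 0.
    rewrite !xpair_eqE !negb_and => h1 h2.
    have [ca|ca] := eqVneq c a.
      subst c; rewrite eqxx/= in h1.
      by apply: (Todd a b a d b); rewrite eqxx (negbTE ba) (eq_sym b d) (negbTE h1).
    have [cb|cb] := eqVneq c b.
      subst c; rewrite eqxx/= in h2.
      by apply: (Todd a b b d a); rewrite eqxx (eq_sym a b) (negbTE ba) (eq_sym a d) (negbTE h2).
    have [cd|cd] := eqVneq c d.
      subst d; apply: (Todd a b c c a).
      by rewrite eqxx (eq_sym a b) (negbTE ba) (eq_sym a c) (negbTE ca).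
    by apply: (Todd a b c d c); rewrite eqxx (negbTE ca) (negbTE cb) (negbTE cd).
  have -> : \sum_(i < m | i != b) P a b * P a i * T a b a i = 0.
    apply: big1 => d db; rewrite odd1 ?mulr0//;
      by rewrite !xpair_eqE ?eqxx ?(eq_sym a b) ?(negbTE ba) ?(negbTE db).
  have -> : \sum_(i < m | i != a) P a b * P b i * T a b b i = 0.
    apply: big1 => d da; rewrite odd1 ?mulr0//;
      by rewrite !xpair_eqE ?eqxx ?(negbTE ba) ?(negbTE da).
  have -> : \sum_(i < m | (i != a) && (i != b)) \sum_(d < m) P a b * P i d * T a b i d = 0.
    apply: big1 => c /andP[ca cb]; apply: big1 => d _.
    by rewrite odd1 ?mulr0// !xpair_eqE ?(negbTE ca) ?(negbTE cb).
  rewrite (Psym a b); ring.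
have ab : a != b by rewrite eq_sym.
have [_ [h1 h2]] := T2 a b ab.
rewrite mulrC ler_wpM2r ?sqr_ge0// (_ : 2 * t = t + t); last by ring.
exact: lerD.
Qed.

Lemma quadratic_form_second k m (A : 'M[F]_(k, m)) (s : F) :
  gram A != 0 ->
  \sum_a \sum_b coproj A a b * (if a == b then s else 0) = s * (m%:R - k%:R).
Proof.
move=> gA; rewrite -(coproj_trace gA) mulr_sumr; apply: eq_bigr => a _.
rewrite (bigD1 a)//= eqxx big1 ?addr0 1?mulrC// => b ba.
by rewrite eq_sym (negbTE ba) mulr0.
Qed.

Lemma quadratic_formE k m (A : 'M[F]_(k, m)) (y : 'rV[F]_m) :
  (y *m coproj A *m y^T) 0 0 = \sum_a \sum_b coproj A a b * (y 0 a * y 0 b).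
Proof.
rewrite mxE exchange_big /=; apply: eq_bigr => b _.
rewrite mxE [y^T _ _]mxE mulr_suml; apply: eq_bigr => a _; ring.
Qed.

End gram.

(** * Decoupling independent points *)

Section decoupling.
Local Open Scope ereal_scope.
Context (R : realType) (d d' : measure_display) (T : measurableType d)
  (E : measurableType d').
Variable P : probability T R.

Definition tuple_rv n (X : 'I_n -> {RV P >-> E}) (w : T) : n.-tuple E :=
  [tuple X i w | i < n].

Lemma measurable_tuple_rv n (X : 'I_n -> {RV P >-> E}) :
  measurable_fun setT (tuple_rv X).
Proof.
apply/measurable_fun_tnthP => i.
rewrite (_ : _ \o _ = X i) => [|]; first exact: measurable_funP.
by apply/funext => x /=; rewrite tnth_mktuple.
Qed.

Definition tuple_box n (B : 'I_n -> set E) : set (n.-tuple E) :=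
  [set x | forall i, B i (tnth x i)].

Lemma measurable_tuple_box n (B : 'I_n -> set E) :
  (forall i, measurable (B i)) -> measurable (tuple_box B).
Proof.
move=> mB; rewrite (_ : tuple_box B =
    \big[setI/setT]_(i < n) ((fun x : n.-tuple E => tnth x i) @^-1` B i)).
  apply: bigsetI_measurable => i _; rewrite -[X in measurable X]setTI.
  exact: measurable_tnth.
rewrite -bigcap_seq/=; apply/seteqP; split=> x /= Bx i.
  by move=> _ /=; exact: Bx.
by have := Bx i; rewrite /= mem_index_enum; exact.
Qed.

(** Boxes generate the product sigma-algebra and are stable under
    intersection. *)
Lemma tuple_measurable_box n :
  @measurable _ (n.-tuple E) =
  <<s [set C | exists2 B : 'I_n -> set E, (forall i, measurable (B i)) & C = tuple_box B] >>.
Proof.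
apply/seteqP; split.
  apply: smallest_sub; first exact: smallest_sigma_algebra.
  move=> C; rewrite -bigcup_seq /= => -[i _ [A mA <-]].
  apply: sub_sigma_algebra => /=.
  exists (fun j => if j == i then A else setT).
    by move=> j; case: ifP.
  apply/seteqP; split => x /=.
    by move=> [_ Ax] j; case: eqP => [->|].
  by move=> /(_ i); rewrite eqxx.
apply: smallest_sub; first exact: sigma_algebra_measurable.
by move=> C [B mB ->]; exact: measurable_tuple_box.
Qed.

Lemma independent_box n (X : 'I_n.+1 -> {RV P >-> E}) (A : set E) (B : 'I_n -> set E) :
  independent X -> measurable A -> (forall i, measurable (B i)) ->
  P (X ord0 @^-1` A `&` tuple_rv (fun i => X (lift ord0 i)) @^-1` tuple_box B) =
  P (X ord0 @^-1` A) * \prod_i P (X (lift ord0 i) @^-1` B i).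
Proof.
move=> iX mA mB; pose AA (i : 'I_n.+1) := if unlift ord0 i is Some j then B j else A.
have mAA i : i \in [set: 'I_n.+1]%SET -> measurable (AA i).
  by move=> _; rewrite /AA; case: unliftP.
have := iX [set: 'I_n.+1]%SET AA mAA.
rewrite (eq_bigl xpredT); last by move=> i; rewrite inE.
rewrite big_ord_recl; under eq_bigr do rewrite /AA liftK.
rewrite {2}/AA unlift_none => <-; congr (P _).
apply/seteqP; split => w /=.
  move=> [Aw Bw] i _; rewrite /AA; case: (unliftP ord0 i) => [j ->|->//].
  by have := Bw j; rewrite tnth_mktuple.
move=> h; split.
  by have := h ord0; rewrite /= inE /AA unlift_none; exact.
move=> i; rewrite tnth_mktuple; have := h (lift ord0 i).
by rewrite /= inE /AA liftK; exact.
Qed.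

Lemma independent_lift n (X : 'I_n.+1 -> {RV P >-> E}) :
  independent X -> independent (fun i => X (lift ord0 i)).
Proof.
move=> iX J A mA.
pose AA (i : 'I_n.+1) := if unlift ord0 i is Some j then A j else setT.
have := iX [set lift ord0 j | j in J]%SET AA.
rewrite big_imset/=; last by move=> i j _ _; exact: lift_inj.
under eq_bigr do rewrite /AA liftK.
move=> <-; last first.
  by move=> i /imsetP[j jJ ->]; rewrite /AA liftK; exact: mA.
congr (P _); apply/seteqP; split => w /= h i.
  by move=> /imsetP[j jJ ->]; rewrite /AA liftK; exact: h.
move=> iJ; have := h (lift ord0 i); rewrite /= /AA liftK; apply.
exact: imset_f.
Qed.

(** Both sides are finite measures as functions of C, and they agree on boxes. *)
Lemma independent_tuple n (X : 'I_n.+1 -> {RV P >-> E}) (A : set E) (C : set (n.-tuple E)) :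
  independent X -> measurable A -> measurable C ->
  P (X ord0 @^-1` A `&` tuple_rv (fun i => X (lift ord0 i)) @^-1` C) =
  P (X ord0 @^-1` A) * P (tuple_rv (fun i => X (lift ord0 i)) @^-1` C).
Proof.
move=> iX mA mC; set Y := tuple_rv _.
have mY : measurable_fun setT Y by exact: measurable_tuple_rv.
have mXA : measurable (X ord0 @^-1` A).
  by rewrite -[X in measurable X]setTI; exact: measurable_funP.
have PA : P (X ord0 @^-1` A) = (fine (P (X ord0 @^-1` A)))%:E.
  by rewrite fineK// fin_num_measure.
have [r rP] : exists r : {nonneg R}, P (X ord0 @^-1` A) = r%:num%:E.
  have r0 : (0 <= fine (P (X ord0 @^-1` A)))%R by rewrite fine_ge0.
  by exists (NngNum r0).
pose Yp : {mfun T >-> n.-tuple E} := HB.pack Y (isMeasurableFun.Build _ _ _ _ _ mY).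
pose m1 : {measure set (n.-tuple E) -> \bar R} := pushforward (mrestr P mXA) Yp.
pose m2 : {measure set (n.-tuple E) -> \bar R} := mscale r (pushforward P Yp).
suff : m1 mY C = m2 mY C.
  by rewrite /m1 /m2 /= /mscale /= /pushforward /mrestr /= rP setIC.
apply: (@measure_unique _ R _ [set C | exists2 B : 'I_n -> set E,
    (forall i, measurable (B i)) & C = tuple_box B] (fun=> setT)) => //.
- exact: tuple_measurable_box.
- move=> _ _ [B mB ->] [B' mB' ->]; exists (fun i => B i `&` B' i).
    by move=> i; exact: measurableI.
  apply/seteqP; split => x /=; first by move=> [h h'] i.
  by move=> h; split => i; have [] := h i.
- by move=> _; exists (fun=> setT) => //; apply/seteqP; split => x.
- by rewrite bigcup_const.
- move=> _ [B mB ->].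
  rewrite /m1 /m2 /= /mscale /= /pushforward /mrestr /= -rP setIC.
  rewrite independent_box//; congr (_ * _).
  have := independent_box iX measurableT mB.
  by rewrite preimage_setT setTI probability_setT mul1e => ->.
- move=> _; rewrite /m1 /= /pushforward /mrestr /= preimage_setT setTI.
  by rewrite PA ltry.
Qed.

(** By independence the joint law of the first variable and the others is a
    product measure, so the two may be sampled separately. *)
Lemma integral_decouple n (X : 'I_n.+1 -> {RV P >-> E}) (F : E * n.-tuple E -> \bar R) :
  independent X -> measurable_fun setT F -> (forall z, 0 <= F z) ->
  \int[P]_w F (X ord0 w, tuple_rv (fun i => X (lift ord0 i)) w) =
  \int[P]_w' \int[P]_w F (X ord0 w, tuple_rv (fun i => X (lift ord0 i)) w').
Proof.
move=> iX mF F0; set Y := tuple_rv _.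
have mY : measurable_fun setT Y by exact: measurable_tuple_rv.
pose Yp : {mfun T >-> n.-tuple E} := HB.pack Y (isMeasurableFun.Build _ _ _ _ _ mY).
pose Z w := (X ord0 w, Y w).
have mZ : measurable_fun setT Z.
  by apply: measurable_fun_pair => //; exact: measurable_funP.
pose Zp : {mfun T >-> (E * n.-tuple E)%type} := HB.pack Z (isMeasurableFun.Build _ _ _ _ _ mZ).
transitivity (\int[distribution P Zp]_z F z).
  by rewrite /distribution ge0_integral_pushforward// preimage_setT.
transitivity (\int[distribution P (X ord0) \x distribution P Yp]_z F z).
  apply: eq_measure_integral => A mA _; apply/esym.
  apply: product_measure_unique => // A1 A2 mA1 mA2.
  by rewrite /distribution /pushforward /= -independent_tuple.
rewrite fubini_tonelli2//= /distribution ge0_integral_pushforward//; last first.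
- by move=> y _; apply: integral_ge0.
- exact: measurable_fun_fubini_tonelli_G.
rewrite preimage_setT; apply: eq_integral => w' _ /=.
rewrite /fubini_G ge0_integral_pushforward// ?preimage_setT//.
exact: measurable_fun_pair1.
Qed.

End decoupling.

(** * Moments of Gram determinants *)

Section expectation.
Context (R : realType) (d : measure_display) (T : measurableType d).
Variable P : probability T R.

(** An expectation together with integrability, so that means add without side
    conditions. *)
Definition has_mean (f : T -> R) (v : R) : Prop :=
  P.-integrable setT (EFin \o f) /\ (\int[P]_w (f w)%:E = v%:E)%E.

Lemma has_mean_eq f g u v : (forall w, f w = g w) -> u = v -> has_mean f u -> has_mean g v.
Proof. by move=> fg -> h; rewrite (_ : g = f)//; apply/funext => w; rewrite fg. Qed.

Lemma has_meanZ c f u : has_mean f u -> has_mean (fun w => c * f w) (c * u).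
Proof.
move=> [fi fE]; split; first exact: (integrableZl measurableT c fi).
by under eq_integral do rewrite EFinM; rewrite integralZl// fE.
Qed.

Lemma has_mean_sum (I : finType) (f : I -> T -> R) (u : I -> R) :
  (forall i, has_mean (f i) (u i)) -> has_mean (fun w => \sum_i f i w) (\sum_i u i).
Proof.
move=> h; have E : EFin \o (fun w => \sum_i f i w) = (fun w => \sum_i (f i w)%:E)%E.
  by apply/funext => w /=; rewrite sumEFin.
split.
  by rewrite E; apply: integrable_sum => // i _; have [] := h i.
transitivity (\int[P]_w (\sum_i (f i w)%:E))%E.
  by apply: eq_integral => w _; rewrite sumEFin.
rewrite integral_sum//; last by move=> i; have [] := h i.
by rewrite -sumEFin; apply: eq_bigr => i _; have [] := h i.
Qed.

End expectation.

Lemma measurable_det d (T : measurableType d) (R : realType) n (M : T -> 'M[R]_n) :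
  (forall i j, measurable_fun setT (fun x => M x i j)) ->
  measurable_fun setT (fun x => \det (M x)).
Proof.
move=> mM; rewrite /determinant; apply: measurable_sum => s.
by apply: measurable_funM => //; apply: measurable_prod => i _.
Qed.

Lemma measurable_gram d (T : measurableType d) (R : realType) k m (M : T -> 'M[R]_(k, m)) :
  (forall i j, measurable_fun setT (fun x => M x i j)) ->
  measurable_fun setT (fun x => gram (M x)).
Proof.
move=> mM; rewrite /gram; apply: measurable_det => i j.
rewrite (_ : (fun _ => _) = (fun x => \sum_l M x i l * M x j l)).
  by apply: measurable_sum => l; apply: measurable_funM.
by apply/funext => x; rewrite mxE; apply: eq_bigr => l _; rewrite [(M x)^T _ _]mxE.
Qed.

Section gram_expectation.
Context (R : realType) (d d' : measure_display) (T : measurableType d)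
  (E : measurableType d').
Variable P : probability T R.
Variables (m : nat) (h : E -> 'rV[R]_m).
Hypothesis mh : forall j, measurable_fun setT (fun e => h e 0 j).

Definition rowmx_of k (es : k.-tuple E) : 'M[R]_(k, m) :=
  \matrix_(i, j) h (tnth es i) 0 j.

Definition rows k (X : 'I_k -> {RV P >-> E}) (w : T) : 'M[R]_(k, m) :=
  \matrix_(i, j) h (X i w) 0 j.

Lemma rowsS k (X : 'I_k.+1 -> {RV P >-> E}) w :
  rows X w = col_mx (h (X ord0 w)) (rowmx_of (tuple_rv (fun i => X (lift ord0 i)) w))
  :> 'M[R]_(1 + k, m).
Proof.
rewrite -[LHS](@vsubmxK _ 1 k m); congr col_mx; apply/matrixP => i j; rewrite !mxE.
  by rewrite (ord1 i) lshift0.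
by rewrite tnth_mktuple rshift1.
Qed.

Lemma rowmx_of_rv k (X : 'I_k -> {RV P >-> E}) w : rowmx_of (tuple_rv X w) = rows X w.
Proof. by apply/matrixP => i j; rewrite !mxE tnth_mktuple. Qed.

Lemma measurable_gram_rows k (X : 'I_k -> {RV P >-> E}) :
  measurable_fun setT (fun w => gram (rows X w)).
Proof.
apply: measurable_gram => i j.
rewrite (_ : (fun _ => _) = (fun e => h e 0 j) \o X i).
  exact: measurableT_comp.
by apply/funext => w; rewrite mxE.
Qed.

Lemma measurable_gram_cons k :
  measurable_fun setT (fun z : E * k.-tuple E => gram (col_mx (h z.1) (rowmx_of z.2))).
Proof.
apply: measurable_gram => i j.
case: (splitP i) => [i' ii'|i' ii'].
  rewrite (_ : (fun _ => _) = (fun e => h e 0 j) \o fst).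
    exact: (measurableT_comp (mh j)).
  apply/funext => z; rewrite (_ : i = lshift k i'); last exact/val_inj.
  by rewrite col_mxEu (ord1 i').
rewrite (_ : (fun _ => _) = (fun e => h e 0 j) \o ((fun es => tnth es i') \o snd)).
  apply: (measurableT_comp (mh j)); apply: measurableT_comp => //.
  exact: measurable_tnth.
apply/funext => z; rewrite (_ : i = rshift 1 i'); last exact/val_inj.
by rewrite col_mxEd mxE.
Qed.

(** Conditioning on all rows but the first: the Gram determinant is that of the
    other rows times a quadratic form in the first. *)
Lemma integral_gram_decouple k (X : 'I_k.+1 -> {RV P >-> E}) (p : nat) :
  independent X ->
  (\int[P]_w (gram (rows X w) ^+ p)%:E =
   \int[P]_w' \int[P]_w (gram (rows (fun i => X (lift ord0 i)) w') ^+ p *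
     (\sum_a \sum_b coproj (rows (fun i => X (lift ord0 i)) w') a b *
        (h (X ord0 w) 0 a * h (X ord0 w) 0 b)) ^+ p)%:E)%E.
Proof.
move=> iX.
have := @integral_decouple R d d' T E P k X
  (fun z => (gram (col_mx (h z.1) (rowmx_of z.2)) ^+ p)%:E) iX.
move=> H; etransitivity; last first.
  etransitivity; first apply: H.
  - apply/measurable_EFinP; apply: measurable_funX; exact: measurable_gram_cons.
  - by move=> z; rewrite lee_fin exprn_ge0// gram_ge0.
  apply: eq_integral => w' _; apply: eq_integral => w _ /=.
  by rewrite gram_col_mx exprMn rowmx_of_rv quadratic_formE.
by apply: eq_integral => w _; rewrite -rowsS.
Qed.

Variables (s : R).

(** Each row removed contributes the trace of its projection times s. *)
Lemma integral_gram k (X : 'I_k -> {RV P >-> E}) : (k <= m)%N -> 0 <= s ->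
  independent X ->
  (forall i a b, has_mean P (fun w => h (X i w) 0 a * h (X i w) 0 b) (if a == b then s else 0)) ->
  (\int[P]_w (gram (rows X w))%:E = (\prod_(j < k) (s * (m%:R - j%:R)))%:E)%E.
Proof.
move=> + s0; elim: k X => [|k IH] X km iX H2.
  rewrite big_ord0; under eq_integral do rewrite /gram det_mx00.
  by rewrite integral_cst// mul1e; exact: probability_setT.
have := integral_gram_decouple 1%N iX; under eq_integral do rewrite expr1.
move=> ->; rewrite big_ord_recr /= mulrC EFinM.
rewrite -(IH (fun i => X (lift ord0 i)))//; last 2 first.
- exact: ltnW.
- exact: independent_lift.
rewrite -ge0_integralZl//; last 3 first.
- by apply/measurable_EFinP; exact: measurable_gram_rows.
- by move=> w _; rewrite lee_fin gram_ge0.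
- by rewrite lee_fin mulr_ge0// subr_ge0 ler_nat ltnW.
apply: eq_integral => w' _; set A := rows _ w'.
have [g0|g0] := eqVneq (gram A) 0.
  under eq_integral do rewrite g0 expr1 mul0r.
  by rewrite integral0 g0 mule0.
have : has_mean P (fun w => gram A ^+ 1 *
     (\sum_a \sum_b coproj A a b * (h (X ord0 w) 0 a * h (X ord0 w) 0 b)) ^+ 1)
     (gram A * (s * (m%:R - k%:R))).
  rewrite -(quadratic_form_second _ g0).
  apply: (has_mean_eq (f := fun w => gram A * (\sum_a \sum_b coproj A a b *
    (h (X ord0 w) 0 a * h (X ord0 w) 0 b)))) => //.
  apply: has_meanZ; apply: has_mean_sum => a; apply: has_mean_sum => b; exact: has_meanZ.
by case=> _ ->; rewrite -EFinM mulrC.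
Qed.

(** The recursion of the second moment, each step being bounded by
    quadratic_form_fourth. *)
Lemma integral_gram_sqr k (X : 'I_k -> {RV P >-> E}) (kappa : R)
    (M4 : 'I_m -> 'I_m -> 'I_m -> 'I_m -> R) : (k <= m)%N -> 0 <= s -> 0 <= kappa ->
  independent X ->
  (forall i a b c e, has_mean P (fun w => (h (X i w) 0 a * h (X i w) 0 b) *
       (h (X i w) 0 c * h (X i w) 0 e)) (M4 a b c e)) ->
  (forall a b c e i, odd ((i == a) + (i == b) + (i == c) + (i == e)) -> M4 a b c e = 0) ->
  (forall a b, a != b -> M4 a a b b <= s /\ M4 a b a b <= s /\ M4 a b b a <= s) ->
  (forall a, M4 a a a a <= kappa * s) ->
  (\int[P]_w (gram (rows X w) ^+ 2)%:E <=
   (\prod_(j < k) (s * ((m%:R - j%:R) ^+ 2 + (2 + kappa) * (m%:R - j%:R))))%:E)%E.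
Proof.
move=> + s0 k0; elim: k X => [|k IH] X km iX H4 Modd M2 M1.
  rewrite big_ord0; under eq_integral do rewrite /gram det_mx00 expr1n.
  by rewrite integral_cst// mul1e; exact: probability_le1.
rewrite (integral_gram_decouple 2%N iX) big_ord_recr /= mulrC EFinM.
have mk0 : 0 <= m%:R - k%:R :> R by rewrite subr_ge0 ler_nat ltnW.
set C := s * _.
have C0 : 0 <= C.
  by rewrite mulr_ge0// addr_ge0 ?sqr_ge0// mulr_ge0// addr_ge0.
have IH' := IH (fun i => X (lift ord0 i)) (ltnW km) (independent_lift iX)
  (fun i => H4 _) Modd M2 M1.
apply: (@le_trans _ _ (C%:E *
    \int[P]_w (gram (rows (fun i => X (lift ord0 i)) w) ^+ 2)%:E)%E); last first.
  by rewrite lee_wpmul2l// lee_fin.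
rewrite -ge0_integralZl//; last 2 first.
- apply/measurable_EFinP; apply: measurable_funX; exact: measurable_gram_rows.
- by move=> w _; rewrite lee_fin exprn_ge0// gram_ge0.
apply: le_integral_any => w'.
  by apply: integral_ge0 => w _; rewrite lee_fin mulr_ge0 ?sqr_ge0.
set A := rows _ w';
have [g0|g0] := eqVneq (gram A) 0.
  under eq_integral do rewrite g0 expr0n mul0r.
  by rewrite integral0 g0 expr0n mule0.
have : has_mean P (fun w => gram A ^+ 2 *
     (\sum_a \sum_b coproj A a b * (h (X ord0 w) 0 a * h (X ord0 w) 0 b)) ^+ 2)
     (gram A ^+ 2 * \sum_a \sum_b \sum_c \sum_e coproj A a b * coproj A c e * M4 a b c e).
  apply: (has_mean_eq (f := fun w => gram A ^+ 2 * (\sum_a \sum_b \sum_c \sum_e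
      coproj A a b * coproj A c e *
      ((h (X ord0 w) 0 a * h (X ord0 w) 0 b) * (h (X ord0 w) 0 c * h (X ord0 w) 0 e))))) => //.
    move=> w; congr (_ * _); rewrite expr2 mulr_suml; apply: eq_bigr => a _.
    rewrite mulr_suml; apply: eq_bigr => b _.
    rewrite mulr_sumr; apply: eq_bigr => c _.
    rewrite mulr_sumr; apply: eq_bigr => e _; ring.
  apply: has_meanZ; do 4 apply: has_mean_sum => ?; exact: has_meanZ.
case=> _ ->; rewrite -EFinM lee_fin mulrC ler_wpM2r ?sqr_ge0//.
exact: quadratic_form_fourth.
Qed.

End gram_expectation.

(** * Coordinates of a uniform point of a ball *)

Section uniform_law.
Context (R : realType) (n : nat) (q : \bar R) (d : measure_display)
  (T : measurableType d) (P : probability T R) (X : {RV P >-> n.-tuple R}).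
Hypothesis hq : (1 <= q)%E.
Hypothesis uX : uniform_in (lq_ball n q) X.
Local Notation K := (lq_ball n q).
Local Notation t := (inv_exp q).

Lemma inv_exp_ge0 : 0 <= t. Proof. by have /andP[] := inv_exp_itv hq. Qed.

Definition volK : R := coord_moment t 0 ^+ n / gammaD (n%:R * t).

Lemma volK_gt0 : 0 < volK.
Proof.
have t0 := inv_exp_ge0.
by rewrite divr_gt0 ?exprn_gt0 ?coord_moment_gt0// gammaD_gt0// mulr_ge0.
Qed.

Lemma volKE : lebesgue_tuple R n K = volK%:E.
Proof. exact: lq_ball_volume. Qed.

Lemma integral_uniform (f : n.-tuple R -> \bar R) :
  measurable_fun setT f -> (forall x, 0 <= f x)%E ->
  (\int[P]_w f (X w) = volK^-1%:E * \int[lebesgue_tuple R n]_(x in K) f x)%E.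
Proof.
move=> mf f0.
have mK : measurable K := @measurable_lq_ball R n q.
have v0 := volK_gt0.
have vi0 : 0 <= volK^-1 by rewrite invr_ge0 ltW.
transitivity (\int[distribution P X]_x f x)%E.
  by rewrite /distribution ge0_integral_pushforward// ?preimage_setT//; exact: measurable_funP.
pose mu1 : {measure set (n.-tuple R) -> \bar R} := mscale (NngNum vi0) (lebesgue_tuple R n).
have dE A : measurable A -> distribution P X A = (volK^-1%:E * lebesgue_tuple R n (A `&` K))%E.
  by move=> mA; rewrite uX// volKE inver gt_eqF// muleC.
rewrite -(setUv K) ge0_integral_setU//; last 3 first.
- exact: measurableC.
- by rewrite setUv.
- exact/disj_setPCl.
rewrite [X in (_ + X)%E](_ : _ = 0%E) ?adde0; last first.
  apply: null_set_integral; first exact: measurableC.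
    exact: measurable_funTS.
  by have := dE (~` K) (measurableC mK); rewrite setICl measure0 mule0.
transitivity (\int[mu1]_(x in K) f x)%E.
  apply: eq_measure_integral => A mA AK.
  by rewrite [LHS](dE _ mA) (setIidl AK).
rewrite /mu1 ge0_integral_mscale//.
exact: measurable_funTS.
Qed.

Definition coord_flip (i : 'I_n) : 'M[R]_n :=
  diag_mx (\row_j (if j == i then -1 else 1)).

Lemma tnth_flip i x j : tnth (affine_tuple (coord_flip i) 0 x) j =
  (if j == i then - tnth x j else tnth x j).
Proof.
rewrite tnth_mktuple mxE addr0 (bigD1 j)//= !mxE eqxx mulr1n big1 ?addr0.
  by case: ifP => _; rewrite ?mulr1// mulrN1.
by move=> k kj; rewrite !mxE (negbTE kj) mulr0n mulr0.
Qed.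

Lemma norm_det_flip i : `|\det (coord_flip i)| = 1.
Proof.
rewrite det_diag normr_prod big1// => j _; rewrite mxE.
by case: ifP; rewrite ?normrN normr1.
Qed.

Lemma lq_ball_flip i x : K (affine_tuple (coord_flip i) 0 x) = K x.
Proof.
have E j : `|tnth (affine_tuple (coord_flip i) 0 x) j| = `|tnth x j|.
  by rewrite tnth_flip; case: ifP => _; rewrite ?normrN.
case: q => [r| |]//=; first by under eq_bigr do rewrite E.
by under eq_bigr do rewrite E.
Qed.

(** The ball is invariant under changing the sign of a coordinate, and so is
    Lebesgue measure. *)
Lemma integral_uniform_flip i (f : n.-tuple R -> \bar R) :
  measurable_fun setT f -> (forall x, 0 <= f x)%E ->
  (\int[P]_w f (affine_tuple (coord_flip i) 0 (X w)) = \int[P]_w f (X w))%E.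
Proof.
move=> mf f0.
have mff : measurable_fun setT (f \o affine_tuple (coord_flip i) 0).
  exact: (measurableT_comp mf (@measurable_affine_tuple _ _ _ _ _)).
rewrite (integral_uniform mff) ?(integral_uniform mf)//; last by move=> x; exact: f0.
congr (_ * _)%E; rewrite integral_mkcond [RHS]integral_mkcond.
have mK : measurable K := @measurable_lq_ball R n q.
rewrite -(@affine_invariant_unit R n (coord_flip i) _ 0 (f \_ K)).
- rewrite norm_det_flip mul1e; apply: eq_integral => x _; rewrite !patchE.
  congr (if _ then _ else _).
  by apply/idP/idP => /set_mem h; apply/mem_set; move: h; rewrite lq_ball_flip.
- by rewrite unitmxE unitfE -normr_eq0 norm_det_flip oner_eq0.
- by apply: (measurable_restrictT _ _).1 => //; exact: measurable_funTS.
- by move=> x; apply: erestrict_ge0.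
Qed.

Definition coord_monomial (al : 'I_n -> nat) (x : n.-tuple R) : R := \prod_i tnth x i ^+ al i.

Lemma measurable_monomial al : measurable_fun setT (coord_monomial al).
Proof.
apply: measurable_prod => i _; apply: measurable_funX; exact: measurable_tnth.
Qed.

Lemma norm_monomial al x : `|coord_monomial al x| = abs_monomial al x.
Proof. by rewrite normr_prod; apply: eq_bigr => i _; rewrite normrX. Qed.

Lemma monomial_even al x : (forall i, ~~ odd (al i)) -> coord_monomial al x = abs_monomial al x.
Proof.
move=> ev; apply: eq_bigr => i _.
by rewrite -normrX ger0_norm// real_exprn_even_ge0 ?num_real.
Qed.

Lemma monomial_flip al x i : odd (al i) ->
  coord_monomial al (affine_tuple (coord_flip i) 0 x) = - coord_monomial al x.
Proof.
move=> oi; rewrite /coord_monomial (bigD1 i)//= [in RHS](bigD1 i)//= tnth_flip eqxx.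
rewrite exprNn -signr_odd oi expr1 mulN1r mulNr; congr (- (_ * _)).
by apply: eq_bigr => j ji; rewrite tnth_flip (negbTE ji).
Qed.

(** With gamma_ratio, one of the two factors of a moment of the uniform law: this
    one depends on the exponent of a single coordinate, the other on the dimension
    and the total degree. *)
Definition rel_moment (a : nat) : R := coord_moment t a / coord_moment t 0.

Definition gamma_ratio (k : nat) : R := gammaD (n%:R * t) / gammaD ((n%:R + k%:R) * t).

Lemma integral_abs_monomial al :
  (\int[P]_w (abs_monomial al (X w))%:E =
   ((\prod_i rel_moment (al i)) * gamma_ratio (\sum_i al i))%:E)%E.
Proof.
rewrite (@integral_uniform (fun x => (abs_monomial al x)%:E)); last 2 first.
- by apply/measurable_EFinP; exact: measurable_abs_monomial.
- by move=> x; rewrite lee_fin abs_monomial_ge0.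
rewrite lq_ball_moment// -EFinM; congr EFin.
have t0 := inv_exp_ge0.
have c0 := coord_moment_gt0 0 t0.
have -> : \prod_i coord_moment t (al i) = coord_moment t 0 ^+ n * \prod_i rel_moment (al i).
  rewrite -[n in _ ^+ n]card_ord -prodr_const -big_split /=; apply: eq_bigr => i _.
  by rewrite /rel_moment mulrC divfK// gt_eqF.
rewrite /volK /gamma_ratio invf_div.
have g1 : gammaD ((n%:R + (\sum_i al i)%:R) * t) != 0.
  by rewrite gt_eqF// gammaD_gt0// mulr_ge0// addr_ge0.
have c1 : coord_moment t 0 != 0 by rewrite gt_eqF.
by field; rewrite ?g1 ?c1 ?expf_neq0//.
Qed.

Definition signed_moment (al : 'I_n -> nat) : R :=
  if [forall i, ~~ odd (al i)] then (\prod_i rel_moment (al i)) * gamma_ratio (\sum_i al i) else 0.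

(** If an exponent is odd, changing the sign of that coordinate exchanges the
    positive and the negative part of the monomial, so its mean is 0; otherwise the
    monomial equals its absolute value. *)
Lemma has_mean_monomial al : has_mean P (fun w => coord_monomial al (X w)) (signed_moment al).
Proof.
have mm : measurable_fun setT (fun w => (coord_monomial al (X w))%:E).
  apply/measurable_EFinP; apply: measurableT_comp (measurable_monomial al) _.
  exact: measurable_funP.
have inte : P.-integrable setT (EFin \o (fun w => coord_monomial al (X w))).
  apply/integrableP; split => //=.
  under eq_integral do rewrite norm_monomial.
  by rewrite integral_abs_monomial ltry.
split => //; rewrite /signed_moment; case: ifPn => [/forallP ev|].
  by under eq_integral do rewrite monomial_even//; exact: integral_abs_monomial.
rewrite negb_forall => /existsP[i]; rewrite negbK => oi.
rewrite integralE.
pose gp (x : n.-tuple R) : \bar R := maxe (coord_monomial al x)%:E 0%E.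
have mgp : measurable_fun setT gp.
  by apply: measurable_maxe => //; apply/measurable_EFinP; exact: measurable_monomial.
have gp0 x : (0 <= gp x)%E by rewrite /gp le_max lexx orbT.
have E : (\int[P]_w (fun w => (coord_monomial al (X w))%:E)^\- w =
    \int[P]_w (fun w => (coord_monomial al (X w))%:E)^\+ w)%E.
  transitivity (\int[P]_w gp (affine_tuple (coord_flip i) 0 (X w)))%E.
    by apply: eq_integral => w _; rewrite /gp monomial_flip// EFinN funenegE.
  by rewrite integral_uniform_flip//; apply: eq_integral => w _; rewrite funeposE.
rewrite E subee//.
exact: integrable_pos_fin_num.
Qed.

End uniform_law.

(** * Norms from second and fourth moments *)

Section norm_bounds.
Context (R : realType) (d : measure_display) (T : measurableType d).
Variable P : probability T R.

Lemma integral_ge_combination (f g h : T -> R) (a b c : R) :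
  measurable_fun setT f -> measurable_fun setT g -> measurable_fun setT h ->
  (forall w, 0 <= f w) -> (forall w, 0 <= g w) -> (forall w, 0 <= h w) ->
  0 <= a -> 0 <= b -> 0 <= c ->
  (forall w, a * f w <= b * g w + c * h w) ->
  (a%:E * \int[P]_w (f w)%:E <= b%:E * \int[P]_w (g w)%:E + c%:E * \int[P]_w (h w)%:E)%E.
Proof.
move=> mf mg mh f0 g0 h0 a0 b0 c0 H.
have mE (k : T -> R) : measurable_fun setT k -> measurable_fun setT (fun w => (k w)%:E).
  by move=> mk; apply/measurable_EFinP.
rewrite -!ge0_integralZl ?lee_fin//; try exact: mE; try by move=> w _; rewrite lee_fin.
rewrite -ge0_integralD//; last 4 first.
- by move=> w _; rewrite mule_ge0// lee_fin.
- by apply: measurable_funeM; exact: mE.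
- by move=> w _; rewrite mule_ge0// lee_fin.
- by apply: measurable_funeM; exact: mE.
apply: le_integral_any => w; first by rewrite mule_ge0// lee_fin.
by rewrite -!EFinM -EFinD lee_fin.
Qed.

(** Normalise u = D / sqrt A, so that E u^2 = 1 and E u^4 <= M.  Integrating
    u^4 - 3 M u^2 + 2 M^(3/2) u >= 0 gives E u >= M^(-1/2).  The upper bound then
    comes from u^p <= 1 + u^4, and the lower one from u^p >= l^(p - 1) (u - l) with
    l = E u / 2. *)
Lemma Lnorm_bounds (p A M c : R) (D : T -> R) : 1 <= p <= 4 -> 0 < A -> 1 <= M -> 0 < c ->
  measurable_fun setT D -> (forall w, 0 <= D w) ->
  (\int[P]_w (D w ^+ 2)%:E = A%:E)%E ->
  (\int[P]_w (D w ^+ 4)%:E <= (A ^+ 2 * M)%:E)%E ->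
  exists2 v : R, ('N[P]_(p%:E)[EFin \o (fun w => (c * D w)%R)] = v%:E)%E &
    c * Num.sqrt A / (2 * Num.sqrt M) <= v <= c * Num.sqrt A * (1 + M).
Proof.
move=> /andP[p1 p4] A0 M1 c0 mD D0 ED2 ED4.
have M0 : 0 < M by lra.
have p0 : 0 < p by lra.
set rA := Num.sqrt A; set rM := Num.sqrt M.
have rA0 : 0 < rA by rewrite sqrtr_gt0.
have rM0 : 0 < rM by rewrite sqrtr_gt0.
have rA2 : rA ^+ 2 = A by rewrite sqr_sqrtr// ltW.
have rM2 : rM ^+ 2 = M by rewrite sqr_sqrtr// ltW.
pose u w := D w / rA.
have mu : measurable_fun setT u by exact: measurable_funM.
have u0 w : 0 <= u w by rewrite divr_ge0// ltW.
have mun k : measurable_fun setT (fun w => u w ^+ k) by exact: measurable_funX.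
have un0 k w : 0 <= u w ^+ k by rewrite exprn_ge0.
have mup : measurable_fun setT (fun w => u w `^ p).
  exact: (measurableT_comp (measurable_powR p)).
have uE k : (\int[P]_w (u w ^+ k)%:E = (rA ^- k)%:E * \int[P]_w (D w ^+ k)%:E)%E.
  rewrite -ge0_integralZl//.
  - by apply: eq_integral => w _; rewrite -EFinM /u exprMn mulrC exprVn.
  - by apply/measurable_EFinP; exact: measurable_funX.
  - by move=> w _; rewrite lee_fin exprn_ge0.
  - by rewrite lee_fin invr_ge0 exprn_ge0// ltW.
have Eu2 : (\int[P]_w (u w ^+ 2)%:E = 1)%E.
  by rewrite uE ED2 rA2 -EFinM mulVf// gt_eqF.
have Eu4 : (\int[P]_w (u w ^+ 4)%:E <= M%:E)%E.
  rewrite uE; apply: (@le_trans _ _ ((rA ^- 4)%:E * (A ^+ 2 * M)%:E)%E).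
    by rewrite lee_wpmul2l// lee_fin invr_ge0 exprn_ge0// ltW.
  by rewrite -EFinM lee_fin -rA2 -exprM mulrA mulVf ?mul1r// expf_neq0// gt_eqF.
have E1 : (\int[P]_w (1 : R)%:E = 1)%E.
  by rewrite integral_cst// mul1e; exact: probability_setT.
have [e1 Ee1 e1M] : exists2 e1 : R, (\int[P]_w (u w)%:E = e1%:E)%E & rM^-1 <= e1.
  have fe : (\int[P]_w (u w)%:E \is a fin_num)%E.
    rewrite ge0_fin_numE; last by apply: integral_ge0 => w _; rewrite lee_fin.
    have := @integral_ge_combination u (fun=> 1) (fun w => u w ^+ 2) 1 1 1
      mu (measurable_cst _) (mun 2%N) u0
      (fun=> ler01) (un0 2%N) ler01 ler01 ler01.
    rewrite !mul1e E1 Eu2 => H; apply: le_lt_trans; first apply: H.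
      by move=> w; rewrite !mul1r; have := sqr_ge0 (u w - 1); nra.
    by rewrite -EFinD ltry.
  exists (fine (\int[P]_w (u w)%:E)%E); first by rewrite fineK.
  have H := @integral_ge_combination (fun w => u w ^+ 2) u (fun w => u w ^+ 4)
    (3 * M) (2 * (M * rM)) 1 (mun 2%N) mu (mun 4%N) (un0 2%N) u0 (un0 4%N).
  have {H} := H _ _ ler01 _.
  rewrite Eu2 mule1 mul1e => H.
  have : ((3 * M)%:E <= (2 * (M * rM))%:E * \int[P]_w (u w)%:E + M%:E)%E.
    apply: le_trans; first apply: H.
    - by rewrite mulr_ge0// ltW.
    - by rewrite !mulr_ge0// ltW.
    - move=> w; rewrite mul1r -rM2.
      have := u0 w; move: (u w) => x x0.
      rewrite -subr_ge0 (_ : _ - _ = x * (x - rM) ^+ 2 * (x + 2 * rM)); last by ring.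
      apply: mulr_ge0; first by apply: mulr_ge0 => //; exact: sqr_ge0.
      by rewrite addr_ge0// mulr_ge0// ltW.
    - by rewrite leeD2l.
  rewrite -(fineK fe) -EFinM -EFinD lee_fin; set e := fine _ => H2.
  rewrite -(ler_pM2l (_ : 0 < 2 * (M * rM))); last by rewrite !mulr_gt0.
  rewrite mulrA mulfK ?gt_eqF//. move=> /=; lra.
have e10 : 0 < e1 by apply: lt_le_trans e1M; rewrite invr_gt0.
pose l := e1 / 2.
have l0 : 0 < l by rewrite divr_gt0.
have up0 w : 0 <= u w `^ p by exact: powR_ge0.
have Ihi : (\int[P]_w (u w `^ p)%:E <= (1 + M)%:E)%E.
  have H := @integral_ge_combination (fun w => u w `^ p) (fun=> 1) (fun w => u w ^+ 4) 1 1 1 mup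
    (measurable_cst _) (mun 4%N) up0 (fun=> ler01) (un0 4%N) ler01 ler01 ler01.
  rewrite -[leLHS]mul1e; apply: le_trans; first apply: H.
    move=> w; rewrite !mul1r; have := u0 w; move: (u w) => x x0.
    have [x1|x1] := leP x 1.
      have one_p : (1 : R) `^ p = 1 by rewrite powR1.
      rewrite ler_wpDr ?exprn_ge0// -[leRHS]one_p ge0_ler_powR ?nnegrE//.
      exact: ltW.
    rewrite ler_wpDl// -powR_mulrn//; apply: ler_powR; last exact: p4.
    exact: ltW.
  by rewrite !mul1e E1 EFinD leeD2l.
have [I IE] : exists I : R, (\int[P]_w (u w `^ p)%:E = I%:E)%E.
  exists (fine (\int[P]_w (u w `^ p)%:E)%E); rewrite fineK// ge0_fin_numE.
    exact: le_lt_trans Ihi (ltry _).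
  by apply: integral_ge0 => w _; rewrite lee_fin.
have I1 : I <= 1 + M by rewrite -lee_fin -IE.
have I2 : l `^ p <= I.
  have H := @integral_ge_combination u (fun w => u w `^ p) (fun=> 1) (l `^ (p - 1)) 1 (l `^ p) mu
    mup (measurable_cst _) u0 up0 (fun=> ler01) (powR_ge0 _ _) ler01 (powR_ge0 _ _).
  have lp : l * l `^ (p - 1) = l `^ p by rewrite mulr_powRB1// ltW.
  move: H; rewrite mul1e E1 mule1 Ee1 IE -EFinM -EFinD lee_fin => H.
  suff : l `^ (p - 1) * e1 <= I + l `^ p.
    have -> : e1 = l + l by rewrite /l; field.
    by rewrite mulrDr mulrC lp; lra.
  apply: H => w; rewrite mul1r mulr1 -lp.
  have [ul|ul] := leP l (u w).
    apply: ler_wpDr; first by rewrite mulr_ge0 ?powR_ge0// ltW.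
    rewrite -(mulr_powRB1 (u0 w) p0) mulrC; apply: ler_wpM2l => //.
    apply: ge0_ler_powR => //; rewrite ?nnegrE ?subr_ge0//.
    exact: ltW.
  apply: ler_wpDl; first exact: powR_ge0.
  rewrite mulrC; apply: ler_wpM2r; first exact: powR_ge0.
  exact: ltW.
exists (c * rA * I `^ p^-1).
  rewrite unlock /=.
  have -> : (\int[P]_x (`|(c * D x)%:E| `^ p)%E = ((c * rA) `^ p * I)%:E)%E.
    rewrite EFinM -IE -ge0_integralZl//; last 3 first.
    - by apply/measurable_EFinP.
    - by move=> w _; rewrite lee_fin.
    - by rewrite lee_fin powR_ge0.
    apply: eq_integral => w _; rewrite abse_EFin ger0_norm; last by rewrite mulr_ge0// ltW.
    rewrite poweR_EFin -EFinM -powRM//; last by rewrite mulr_ge0// ltW.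
    by congr (_ `^ _)%:E; rewrite /u; field; rewrite gt_eqF.
  rewrite poweR_EFin; congr EFin.
  have cr0 : 0 <= c * rA by rewrite mulr_ge0// ltW.
  have I0 : 0 <= I by apply: le_trans I2; exact: powR_ge0.
  rewrite powRM ?powR_ge0// -powRrM mulfV ?gt_eqF// powRr1//.
have I0 : 0 <= I by apply: le_trans I2; exact: powR_ge0.
have cr0 : 0 < c * rA by rewrite mulr_gt0.
have pi0 : 0 <= p^-1 by rewrite invr_ge0 ltW.
apply/andP; split.
  rewrite ler_pM2l//; apply: (@le_trans _ _ l).
    by rewrite invfM /l mulrC ler_pM2r// invr_gt0.
  have -> : l = (l `^ p) `^ p^-1 by rewrite -powRrM mulfV ?gt_eqF// powRr1// ltW.
  by apply: ge0_ler_powR => //; rewrite ?nnegrE// powR_ge0.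
rewrite ler_pM2l//; apply: (@le_trans _ _ ((1 + M) `^ p^-1)).
  by apply: ge0_ler_powR => //; rewrite ?nnegrE//; lra.
rewrite -[leRHS]powRr1; last by lra.
by apply: ler_powR; [lra|rewrite invf_le1].
Qed.

End norm_bounds.

(** * Determinants with independent rows *)

(** Exponents of the product of the coordinates a and b; cnt4 does the same for
    four coordinates. *)
Definition cnt2 m (a b : 'I_m) (i : 'I_m) : nat := (i == a) + (i == b).
Definition cnt4 m (a b c e : 'I_m) (i : 'I_m) : nat := (i == a) + (i == b) + (i == c) + (i == e).

Lemma sum_delta m (a : 'I_m) : (\sum_(i < m) (i == a) = 1)%N.
Proof. by rewrite (bigD1 a)//= eqxx big1// => i /negbTE ->. Qed.

Lemma sum_cnt2 m (a b : 'I_m) : (\sum_i cnt2 a b i = 2)%N.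
Proof. by rewrite !big_split /= !sum_delta. Qed.

Lemma sum_cnt4 m (a b c e : 'I_m) : (\sum_i cnt4 a b c e i = 4)%N.
Proof. by rewrite !big_split /= !sum_delta. Qed.

Section det_moments.
Context (R : realType) (d d' : measure_display) (T : measurableType d)
  (E : measurableType d').
Variable P : probability T R.
Variables (m : nat) (h : E -> 'rV[R]_m).
Hypothesis mh : forall j, measurable_fun setT (fun e => h e 0 j).
Variables (X : 'I_m -> {RV P >-> E}) (mu : ('I_m -> nat) -> R) (s kappa : R) (C : nat).
Hypothesis s0 : 0 < s.
Hypothesis k0 : 0 <= kappa.
Hypothesis kC : 2 + kappa <= C%:R.
Hypothesis iX : independent X.
Hypothesis Emu : forall i al, has_mean P (fun w => \prod_j h (X i w) 0 j ^+ al j) (mu al).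
Hypothesis mu_odd : forall al i, odd (al i) -> ~~ odd (\sum_j al j) -> mu al = 0.
Hypothesis mu2 : forall a, mu (cnt2 a a) = s.
Hypothesis mu22 : forall a b, a != b -> mu (cnt4 a a b b) <= s ^+ 2.
Hypothesis mu4 : forall a, mu (cnt4 a a a a) <= kappa * s ^+ 2.

Lemma prod_delta (x : 'I_m -> R) a : \prod_j x j ^+ (j == a) = x a.
Proof. by rewrite (bigD1 a)//= eqxx expr1 big1 ?mulr1// => j /negbTE ->. Qed.

Lemma prod_cnt2 (x : 'I_m -> R) a b : \prod_j x j ^+ cnt2 a b j = x a * x b.
Proof.
under eq_bigr do rewrite /cnt2 exprD.
by rewrite big_split /= !prod_delta.
Qed.

Lemma prod_cnt4 (x : 'I_m -> R) a b c e :
  \prod_j x j ^+ cnt4 a b c e j = (x a * x b) * (x c * x e).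
Proof.
under eq_bigr do rewrite /cnt4 !exprD.
by rewrite !big_split /= !prod_delta mulrA.
Qed.

Lemma prod_falling (F : R -> R) k :
  \prod_(j < k.+1) F (k.+1%:R - j%:R) = F k.+1%:R * \prod_(j < k) F (k%:R - j%:R).
Proof.
rewrite big_ord_recl subr0; congr (_ * _); apply: eq_bigr => j _; congr F.
by rewrite /= /bump /= add1n -!natr1; ring.
Qed.

Lemma prod_falling_second k :
  \prod_(j < k) (s * (k%:R - j%:R)) = s ^+ k * k`!%:R.
Proof.
elim: k => [|k IH]; first by rewrite big_ord0 mul1r.
by rewrite (prod_falling (fun x => s * x)) IH factS natrM exprS; ring.
Qed.

Lemma det_second_moment :
  (\int[P]_w (`|\det (rows h X w)| ^+ 2)%:E = (s ^+ m * m`!%:R)%:E)%E.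
Proof.
under eq_integral do rewrite real_normK ?num_real// -gram_square.
rewrite (integral_gram mh (s := s))//; last 2 first.
- exact: ltW.
- move=> i a b; apply: has_mean_eq (Emu i (cnt2 a b)).
    by move=> w; rewrite prod_cnt2.
  case: eqVneq => [->|ab]; first exact: mu2.
  apply: (mu_odd (i := a)); last by rewrite sum_cnt2.
  by rewrite /cnt2 eqxx (negbTE ab).
by rewrite prod_falling_second.
Qed.

Lemma bernoulli_ineq (x : R) k : 0 <= x -> 1 + k%:R * x <= (1 + x) ^+ k.
Proof.
move=> x0; elim: k => [|k IH]; first by rewrite mul0r addr0.
rewrite exprS; have : (1 + x) * (1 + k%:R * x) <= (1 + x) * (1 + x) ^+ k.
  by rewrite ler_wpM2l// addr_ge0.
apply: le_trans; rewrite -natr1.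
have : 0 <= k%:R * x * x by rewrite !mulr_ge0.
lra.
Qed.

(** Relative to (s d)^2 a step of codimension d costs the factor
    1 + (2 + kappa) / d <= ((d + 1) / d)^C, and these factors telescope. *)
Lemma prod_falling_fourth k :
  \prod_(j < k) (s ^+ 2 * ((k%:R - j%:R) ^+ 2 + (2 + kappa) * (k%:R - j%:R))) <=
  (s ^+ k * k`!%:R) ^+ 2 * k.+1%:R ^+ C.
Proof.
pose F x := s ^+ 2 * (x ^+ 2 + (2 + kappa) * x).
elim: k => [|k IH]; first by rewrite big_ord0 mul1r !expr1n mul1r.
rewrite (prod_falling F).
have s2 : 0 < s ^+ 2 by rewrite exprn_gt0.
have k1 : 0 < k.+1%:R :> R by rewrite ltr0n.
have F0 : 0 <= F k.+1%:R.
  by rewrite mulr_ge0 ?(ltW s2)// addr_ge0 ?sqr_ge0// mulr_ge0 ?(ltW k1)// addr_ge0.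
apply: le_trans; first by apply: ler_wpM2l IH.
set q := (s ^+ k * k`!%:R) ^+ 2.
have q0 : 0 <= q by exact: sqr_ge0.
have -> : (s ^+ k.+1 * (k.+1)`!%:R) ^+ 2 = s ^+ 2 * k.+1%:R ^+ 2 * q.
  by rewrite /q factS natrM [s ^+ k.+1]exprS; ring.
have FE : F k.+1%:R <= s ^+ 2 * k.+1%:R ^+ 2 * (k.+2%:R / k.+1%:R) ^+ C.
  rewrite /F -mulrA ler_pM2l//.
  have -> : k.+1%:R ^+ 2 + (2 + kappa) * k.+1%:R = k.+1%:R ^+ 2 * (1 + (2 + kappa) / k.+1%:R) :> R.
    by field; rewrite gt_eqF.
  rewrite ler_pM2l ?exprn_gt0//.
  have -> : k.+2%:R / k.+1%:R = 1 + k.+1%:R^-1 :> R.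
    by rewrite -[k.+2%:R]natr1; field; rewrite gt_eqF.
  apply: le_trans (bernoulli_ineq C (x := k.+1%:R^-1) _); last by rewrite invr_ge0 ltW.
  by rewrite lerD2l ler_pM2r ?invr_gt0.
apply: (@le_trans _ _ (s ^+ 2 * k.+1%:R ^+ 2 * (k.+2%:R / k.+1%:R) ^+ C * (q * k.+1%:R ^+ C))).
  by rewrite ler_wpM2r// mulr_ge0// exprn_ge0// ltW.
rewrite le_eqVlt; apply/orP; left; apply/eqP.
rewrite exprMn exprVn; field; by rewrite expf_neq0// gt_eqF.
Qed.

Lemma det_fourth_moment :
  (\int[P]_w (`|\det (rows h X w)| ^+ 4)%:E <=
   ((s ^+ m * m`!%:R) ^+ 2 * m.+1%:R ^+ C)%:E)%E.
Proof.
have E4 w : `|\det (rows h X w)| ^+ 4 = gram (rows h X w) ^+ 2.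
  by rewrite gram_square -[4%N]/(2 * 2)%N exprM real_normK ?num_real.
under eq_integral do rewrite E4.
apply: le_trans.
  apply: (@integral_gram_sqr R d d' T E P m h mh (s ^+ 2) m X kappa
    (fun a b c e => mu (cnt4 a b c e))) => //.
  - exact: sqr_ge0.
  - move=> i a b c e; apply: has_mean_eq (Emu i (cnt4 a b c e)) => //.
    by move=> w; rewrite prod_cnt4.
  - by move=> a b c e i odi; apply: (mu_odd (i := i)); rewrite ?sum_cnt4.
  - move=> a b ab; have E1 : cnt4 a b a b = cnt4 a a b b.
      by apply/funext => i; rewrite /cnt4; lia.
    have E2 : cnt4 a b b a = cnt4 a a b b.
      by apply/funext => i; rewrite /cnt4; lia.
    by rewrite E1 E2; have := mu22 ab.
by rewrite lee_fin prod_falling_fourth.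
Qed.

End det_moments.

(** * Norm bounds for the random polytopes *)

Section ball_coordinates.
Context (R : realType) (q : \bar R).
Hypothesis hq : (1 <= q)%E.
Local Notation t := (inv_exp q).

Lemma rel_moment_gt0 a : 0 < rel_moment q a.
Proof. by rewrite divr_gt0// coord_moment_gt0// inv_exp_ge0. Qed.

Lemma rel_moment0 : rel_moment q 0 = 1.
Proof. by rewrite /rel_moment divff// gt_eqF// coord_moment_gt0// inv_exp_ge0. Qed.

Lemma gamma_ratio_gt0 n k : 0 < gamma_ratio n q k.
Proof.
have t0 := inv_exp_ge0 hq.
by rewrite divr_gt0// gammaD_gt0// mulr_ge0// addr_ge0.
Qed.

(** Log-convexity of Gamma; it makes the squares of two coordinates negatively
    correlated. *)
Lemma gamma_ratio_logconvex n : gamma_ratio n q 4 <= gamma_ratio n q 2 ^+ 2.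
Proof.
have t0 := inv_exp_ge0 hq.
have nt0 : 0 <= n%:R * t :> R by rewrite mulr_ge0.
have ut0 : 0 <= 2%:R * t :> R by rewrite mulr_ge0.
have := gammaD_logconvex nt0 ut0.
have -> : n%:R * t + 2%:R * t = (n%:R + 2%:R) * t by ring.
have -> : (n%:R + 2%:R) * t + 2%:R * t = (n%:R + 4%:R) * t by ring.
rewrite /gamma_ratio.
have g0 := gammaD_gt0 nt0.
have g2 : 0 < gammaD ((n%:R + 2%:R) * t) by rewrite gammaD_gt0// mulr_ge0// addr_ge0.
have g4 : 0 < gammaD ((n%:R + 4%:R) * t) by rewrite gammaD_gt0// mulr_ge0// addr_ge0.
move: g0 g2 g4; set a := gammaD _; set b := gammaD _; set c := gammaD _ => a0 b0 c0 H.
rewrite ler_pdivrMr// expr_div_n mulrAC ler_pdivlMr ?exprn_gt0//.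
by rewrite (expr2 a) -mulrA ler_pM2l.
Qed.

Definition coord_var n : R := rel_moment q 2 * gamma_ratio n q 2.

(** A bound for the fourth moment of a coordinate over the square of its
    variance.  The summand 1 makes it valid for a constant coordinate as well. *)
Definition kurtosis : R := 1 + rel_moment q 4 / rel_moment q 2 ^+ 2.

Lemma coord_var_gt0 n : 0 < coord_var n.
Proof. by rewrite mulr_gt0 ?rel_moment_gt0 ?gamma_ratio_gt0. Qed.

Lemma kurtosis_ge1 : 1 <= kurtosis.
Proof. by rewrite lerDl divr_ge0 ?sqr_ge0// ltW// rel_moment_gt0. Qed.

Lemma signed_moment_odd n (al : 'I_n -> nat) i : odd (al i) -> signed_moment q al = 0.
Proof.
move=> oi; rewrite /signed_moment ifF//; apply/negbTE.
by rewrite negb_forall; apply/existsP; exists i; rewrite negbK.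
Qed.

Lemma signed_moment0 n (al : 'I_n -> nat) : (forall i, al i = 0%N) -> signed_moment q al = 1.
Proof.
move=> al0; rewrite /signed_moment ifT; last by apply/forallP => i; rewrite al0.
rewrite !big1//= => [|i _]; last by rewrite al0 rel_moment0.
rewrite mul1r /gamma_ratio addr0 divff// gt_eqF// gammaD_gt0// mulr_ge0//.
exact: inv_exp_ge0.
Qed.

Lemma signed_moment_cnt2 n (a : 'I_n) : signed_moment q (cnt2 a a) = coord_var n.
Proof.
rewrite /signed_moment ifT; last by apply/forallP => i; rewrite /cnt2 addnn odd_double.
rewrite sum_cnt2 (bigD1 a)//= big1 ?mulr1.
  by rewrite /cnt2 eqxx.
by move=> i /negbTE ia; rewrite /cnt2 ia rel_moment0.
Qed.

Lemma signed_moment_cnt22 n (a b : 'I_n) : a != b ->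
  signed_moment q (cnt4 a a b b) <= coord_var n ^+ 2.
Proof.
move=> ab; rewrite /signed_moment ifT; last first.
  by apply/forallP => i; rewrite /cnt4 addnn -addnA addnn oddD !odd_double.
rewrite sum_cnt4 (bigD1 a)//= (bigD1 b)/= 1?eq_sym// big1 ?mulr1; last first.
  by move=> i /andP[/negbTE ia /negbTE ib]; rewrite /cnt4 ia ib rel_moment0.
have -> : cnt4 a a b b a = 2%N by rewrite /cnt4 eqxx (negbTE ab).
have -> : cnt4 a a b b b = 2%N by rewrite /cnt4 eqxx eq_sym (negbTE ab).
rewrite /coord_var exprMn [rel_moment q 2 ^+ 2]expr2.
have rr : 0 < rel_moment q 2 * rel_moment q 2 by rewrite mulr_gt0 ?rel_moment_gt0.
by rewrite (ler_pM2l rr); exact: gamma_ratio_logconvex.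
Qed.

Lemma signed_moment_cnt4 n (a : 'I_n) :
  signed_moment q (cnt4 a a a a) <= kurtosis * coord_var n ^+ 2.
Proof.
rewrite /signed_moment ifT; last first.
  by apply/forallP => i; rewrite /cnt4 addnn -addnA addnn oddD !odd_double.
rewrite sum_cnt4 (bigD1 a)//= big1 ?mulr1; last first.
  by move=> i /negbTE ia; rewrite /cnt4 ia rel_moment0.
have -> : cnt4 a a a a a = 4%N by rewrite /cnt4 eqxx.
have r2 := rel_moment_gt0 2; have r4 := rel_moment_gt0 4; have g2 := gamma_ratio_gt0 n 2.
apply: (@le_trans _ _ (rel_moment q 4 * gamma_ratio n q 2 ^+ 2)).
  by rewrite ler_pM2l//; exact: gamma_ratio_logconvex.
have -> : kurtosis * coord_var n ^+ 2 = coord_var n ^+ 2 + rel_moment q 4 * gamma_ratio n q 2 ^+ 2.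
  by rewrite /kurtosis /coord_var; field; rewrite gt_eqF.
by rewrite lerDr sqr_ge0.
Qed.

(** An integer bounding 2 + kurtosis, the degree of the polynomial factor in the
    fourth moment. *)
Definition growth_exp : nat := (Num.truncn (2 + kurtosis)).+1.

Lemma growth_expP : 2 + kurtosis <= growth_exp%:R.
Proof. by apply: ltW; rewrite /growth_exp truncnS_gt. Qed.

(** The L^2 norm of the determinant of n independent points, sqrt (s^n n!),
    divided by n! times the volume of the ball. *)
Definition base_size n : R :=
  Num.sqrt (coord_var n ^+ n) / (Num.sqrt n`!%:R * volK n q).

Section points.
Context (n : nat) (d : measure_display) (T : measurableType d) (P : probability T R).

Lemma V_eq (X : 'I_n -> {RV P >-> n.-tuple R}) w : (0 < n)%N ->
  V_ (lq_ball n q) X w =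
  (2 ^+ n / n`!%:R / volK n q * `|\det (rows (fun x : n.-tuple R => \row_j tnth x j) X w)|)%:E.
Proof.
move=> n0; rewrite /V_ conv_hull_cross// lebesgue_tuple_image; last exact: measurable_lq_ball.
rewrite cross_volume volKE// inver gt_eqF ?volK_gt0// -!EFinM; congr EFin.
rewrite (_ : \matrix_(i, j) tnth (X i w) j = rows (fun x : n.-tuple R => \row_j tnth x j) X w).
  by ring.
by apply/matrixP => i j; rewrite !mxE.
Qed.

(** Homogeneous coordinates with an adjustable first entry c.  The determinant
    scales linearly in c, and choosing c^2 to be the coordinate variance gives all
    entries of a row the same second moment. *)
Definition hom_row (c : R) (x : n.-tuple R) : 'rV[R]_n.+1 :=
  \row_j (if unlift ord0 j is Some j' then tnth x j' else c).

(** Eliminating the first column of the homogeneous matrix with the pivot c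
    leaves the differences to the first point. *)
Lemma U_eq (X : 'I_n.+1 -> {RV P >-> n.-tuple R}) c w : 0 < c ->
  U_ (lq_ball n q) X w =
  ((c * n`!%:R * volK n q)^-1 * `|\det (rows (hom_row c) X w)|)%:E.
Proof.
move=> c0; rewrite /U_ conv_hull_simplex lebesgue_tuple_image; last first.
  exact: measurable_corner_simplex.
rewrite simplex_volume volKE// inver gt_eqF ?volK_gt0// -!EFinM; congr EFin.
have A00 : rows (hom_row c) X w 0 0 = c by rewrite !mxE unlift_none.
rewrite det_pivot A00 ?gt_eqF// normrM gtr0_norm//.
set M := \matrix_(i, j) _; set M' := \matrix_(i, j) _.
have -> : M = M'.
  apply/matrixP => i j; rewrite !mxE unlift_none !liftK; field.
  by rewrite gt_eqF.
have v0 := volK_gt0 n hq.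
have f0 : (n`!%:R : R) != 0 by rewrite pnatr_eq0 -lt0n fact_gt0.
by field; rewrite f0 !gt_eqF.
Qed.

(** The dimension 0 is excluded because an empty family has an empty hull. *)
Lemma V_bounds (p : R) (X : 'I_n -> {RV P >-> n.-tuple R}) : (0 < n)%N -> 1 <= p <= 4 ->
  iid_uniform_in (lq_ball n q) X ->
  exists2 v : R, ('N[P]_(p%:E)[V_ (lq_ball n q) X] = v%:E)%E &
    2 ^+ n * base_size n / (2 * Num.sqrt (n.+1%:R ^+ growth_exp)) <= v <=
    2 ^+ n * base_size n * (1 + n.+1%:R ^+ growth_exp).
Proof.
move=> n0 hp [iX uX].
pose h (x : n.-tuple R) : 'rV[R]_n := \row_j tnth x j.
have mh j : measurable_fun setT (fun x => h x 0 j).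
  rewrite (_ : (fun _ => _) = (fun x => tnth x j)); first exact: measurable_tnth.
  by apply/funext => x; rewrite mxE.
have Emu i al : has_mean P (fun w => \prod_j h (X i w) 0 j ^+ al j) (signed_moment q al).
  apply: has_mean_eq (has_mean_monomial hq (uX i) al) => // w.
  by apply: eq_bigr => j _; rewrite mxE.
have s0 := coord_var_gt0 n.
have E2 := det_second_moment mh s0 iX Emu
  (fun al i o _ => signed_moment_odd o) (@signed_moment_cnt2 n).
have k0 : 0 <= kurtosis by have := kurtosis_ge1; lra.
have E4 := det_fourth_moment mh s0 k0 growth_expP iX Emu
  (fun al i o _ => signed_moment_odd o) (@signed_moment_cnt22 n) (@signed_moment_cnt4 n).
set c := 2 ^+ n / n`!%:R / volK n q.
have v0 := volK_gt0 n hq.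
have f0 : 0 < (n`!%:R : R) by rewrite ltr0n fact_gt0.
have c0 : 0 < c by rewrite /c; apply: divr_gt0 => //; apply: divr_gt0 => //; exact: exprn_gt0.
have -> : V_ (lq_ball n q) X = EFin \o (fun w => c * `|\det (rows h X w)|).
  by apply/funext => w; rewrite V_eq.
have A0 : 0 < coord_var n ^+ n * n`!%:R by rewrite mulr_gt0// exprn_gt0.
have M1 : 1 <= n.+1%:R ^+ growth_exp :> R by rewrite exprn_ege1// ler1n.
have mD : measurable_fun setT (fun w => `|\det (rows h X w)|).
  apply: measurableT_comp => //; apply: measurable_det => i j.
  rewrite (_ : (fun _ => _) = (fun e => h e 0 j) \o X i); first exact: measurableT_comp.
  by apply/funext => w; rewrite mxE.
have [v vE vb] := Lnorm_bounds hp A0 M1 c0 mD (fun w => normr_ge0 _) E2 E4.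
exists v => //.
have -> : 2 ^+ n * base_size n = c * Num.sqrt (coord_var n ^+ n * n`!%:R).
  rewrite sqrtrM ?exprn_ge0 ?(ltW s0)// /c /base_size.
  have rE : n`!%:R = Num.sqrt n`!%:R ^+ 2 :> R by rewrite sqr_sqrtr// ltW.
  have r0 : 0 < Num.sqrt n`!%:R :> R by rewrite sqrtr_gt0.
  rewrite [X in _ / X / _ * _]rE; set r := Num.sqrt n`!%:R in r0 *.
  by field; rewrite !gt_eqF.
exact: vb.
Qed.

(** The matrix of size n + 1 has a constant first column, whose odd powers do not
    have mean 0.  The moment of a row still vanishes as soon as some exponent is odd
    and the total degree even, since at least two exponents are then odd and one of
    them belongs to another column. *)
Lemma U_bounds (p : R) (X : 'I_n.+1 -> {RV P >-> n.-tuple R}) : 1 <= p <= 4 ->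
  iid_uniform_in (lq_ball n q) X ->
  exists2 v : R, ('N[P]_(p%:E)[U_ (lq_ball n q) X] = v%:E)%E &
    Num.sqrt n.+1%:R * base_size n / (2 * Num.sqrt (n.+2%:R ^+ growth_exp)) <= v <=
    Num.sqrt n.+1%:R * base_size n * (1 + n.+2%:R ^+ growth_exp).
Proof.
move=> hp [iX uX].
have s0 := coord_var_gt0 n.
set s := coord_var n in s0 *.
pose cc := Num.sqrt s.
have cc0 : 0 < cc by rewrite sqrtr_gt0.
have cc2 : cc ^+ 2 = s by rewrite sqr_sqrtr// ltW.
pose h := hom_row cc.
have h0 x : h x 0 ord0 = cc by rewrite mxE unlift_none.
have hl x j : h x 0 (lift ord0 j) = tnth x j by rewrite mxE liftK.
have mh j : measurable_fun setT (fun x => h x 0 j).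
  case: (unliftP ord0 j) => [j' ->|->].
    by under eq_fun do rewrite hl; exact: measurable_tnth.
  by under eq_fun do rewrite h0; exact: measurable_cst.
pose mu (al : 'I_n.+1 -> nat) := cc ^+ al ord0 * signed_moment q (fun i => al (lift ord0 i)).
have Emu i al : has_mean P (fun w => \prod_j h (X i w) 0 j ^+ al j) (mu al).
  apply: has_mean_eq (has_meanZ (cc ^+ al ord0)
    (has_mean_monomial hq (uX i) (fun i => al (lift ord0 i)))) => // w.
  rewrite big_ord_recl h0; congr (_ * _).
  by apply: eq_bigr => j _; rewrite hl.
have mu_odd al i : odd (al i) -> ~~ odd (\sum_j al j) -> mu al = 0.
  move=> oi os; apply/eqP; rewrite /mu mulf_eq0; apply/orP; right; apply/eqP.
  have [j oj] : exists j, odd (al (lift ord0 j)).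
    apply/existsP; apply: contraNT os => /existsPn ev.
    rewrite big_ord_recl oddD.
    have -> : odd (\sum_(j < n) al (lift ord0 j)) = false.
      by elim/big_ind: _ => // [x y xE yE|j _]; [rewrite oddD xE yE|apply/negbTE/ev].
    rewrite addbF; move: oi; case: (unliftP ord0 i) => [j ->|->//] oj.
    by have := ev j; rewrite oj.
  exact: signed_moment_odd oj.
have cntl (f : 'I_n.+1 -> nat) (g : 'I_n -> nat) :
    (forall i, f (lift ord0 i) = g i) -> mu f = cc ^+ f ord0 * signed_moment q g.
  by move=> fg; rewrite /mu; congr (_ * signed_moment q _); apply/funext.
have ltE (i j : 'I_n) : (lift ord0 i == lift ord0 j) = (i == j).
  by rewrite (inj_eq lift_inj).
have l0E (i : 'I_n) : (lift ord0 i == ord0) = false by rewrite eq_sym (negbTE (neq_lift _ _)).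
have mu2 a : mu (cnt2 a a) = s.
  case: (unliftP ord0 a) => [a' ->|->].
    rewrite (cntl _ (cnt2 a' a')); last by move=> i; rewrite /cnt2 !ltE.
    by rewrite signed_moment_cnt2 /cnt2 (negbTE (neq_lift _ _)) mul1r.
  rewrite (cntl _ (fun=> 0%N)); last by move=> i; rewrite /cnt2 !l0E.
  by rewrite signed_moment0// mulr1 /cnt2 eqxx.
have mu22 a b : a != b -> mu (cnt4 a a b b) <= s ^+ 2.
  case: (unliftP ord0 a) => [a' ->|->]; case: (unliftP ord0 b) => [b' ->|->].
  - rewrite ltE => ab; rewrite (cntl _ (cnt4 a' a' b' b')); last by move=> i; rewrite /cnt4 !ltE.
    by rewrite /cnt4 !(negbTE (neq_lift _ _)) mul1r; exact: signed_moment_cnt22.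
  - move=> _; rewrite (cntl _ (cnt2 a' a')); last by move=> i; rewrite /cnt4 /cnt2 !ltE !l0E !addn0.
    by rewrite /cnt4 !(negbTE (neq_lift _ _)) eqxx cc2 signed_moment_cnt2 expr2.
  - move=> _; rewrite (cntl _ (cnt2 b' b')); last by move=> i; rewrite /cnt4 /cnt2 !ltE !l0E.
    by rewrite /cnt4 !(negbTE (neq_lift _ _)) eqxx cc2 signed_moment_cnt2 expr2.
  - by rewrite eqxx.
have k1 := kurtosis_ge1.
have mu4 a : mu (cnt4 a a a a) <= kurtosis * s ^+ 2.
  case: (unliftP ord0 a) => [a' ->|->].
    rewrite (cntl _ (cnt4 a' a' a' a')); last by move=> i; rewrite /cnt4 !ltE.
    by rewrite /cnt4 !(negbTE (neq_lift _ _)) mul1r; exact: signed_moment_cnt4.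
  rewrite (cntl _ (fun=> 0%N)); last by move=> i; rewrite /cnt4 !l0E.
  rewrite signed_moment0// mulr1 /cnt4 eqxx /= -[(1 + 1 + 1 + 1)%N]/(2 * 2)%N exprM cc2.
  by rewrite ler_peMl// sqr_ge0.
have E2 := det_second_moment mh s0 iX Emu mu_odd mu2.
have k0 : 0 <= kurtosis by lra.
have E4 := det_fourth_moment mh s0 k0 growth_expP iX Emu mu_odd mu22 mu4.
have v0 := volK_gt0 n hq.
have f0 : 0 < (n`!%:R : R) by rewrite ltr0n fact_gt0.
set c := (cc * n`!%:R * volK n q)^-1.
have c0 : 0 < c by rewrite invr_gt0; apply: mulr_gt0 => //; exact: mulr_gt0.
have -> : U_ (lq_ball n q) X = EFin \o (fun w => c * `|\det (rows h X w)|).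
  by apply/funext => w; rewrite (U_eq _ _ cc0).
have A0 : 0 < s ^+ n.+1 * n.+1`!%:R by rewrite mulr_gt0 ?exprn_gt0// ltr0n fact_gt0.
have M1 : 1 <= n.+2%:R ^+ growth_exp :> R by rewrite exprn_ege1// ler1n.
have mD : measurable_fun setT (fun w => `|\det (rows h X w)|).
  apply: measurableT_comp => //; apply: measurable_det => i j.
  rewrite (_ : (fun _ => _) = (fun e => h e 0 j) \o X i); first exact: measurableT_comp.
  by apply/funext => w; rewrite mxE.
have [v vE vb] := Lnorm_bounds hp A0 M1 c0 mD (fun w => normr_ge0 _) E2 E4.
exists v => //.
have -> : Num.sqrt n.+1%:R * base_size n = c * Num.sqrt (s ^+ n.+1 * n.+1`!%:R).
  have s1 : 0 <= s ^+ n by rewrite exprn_ge0// ltW.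
  rewrite exprS factS natrM (sqrtrM _ (mulr_ge0 (ltW s0) s1)).
  rewrite (sqrtrM _ (ltW s0)) [Num.sqrt (n.+1%:R * _)]sqrtrM//.
  rewrite -/cc /c /base_size -/s.
  have rE : n`!%:R = Num.sqrt n`!%:R ^+ 2 :> R by rewrite sqr_sqrtr// ltW.
  have r0 : 0 < Num.sqrt n`!%:R :> R by rewrite sqrtr_gt0.
  rewrite [X in (cc * X * _)^-1]rE; set r := Num.sqrt n`!%:R in r0 *.
  by field; rewrite !gt_eqF.
exact: vb.
Qed.

End points.
End ball_coordinates.

(** * From logarithmic bounds to asymptotic equivalence *)

Section asymptotics.
Variable R : realType.

Lemma ln_div_le (x y : R) : 0 < x -> 0 < y -> ln y - ln x <= (y - x) / x.
Proof.
move=> x0 y0; rewrite -ln_div ?posrE//.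
apply: le_trans (ln_leB1 _) _; first exact: divr_gt0.
by rewrite mulrBl divff// gt_eqF.
Qed.

Lemma ln_natS_le (n : nat) : (0 < n)%N ->
  ln n.+2%:R <= 4 * Num.sqrt n%:R :> R.
Proof.
move=> n0; have n0R : 1 <= n%:R :> R by rewrite ler1n.
set r := Num.sqrt n%:R; have r0 : 0 < r by rewrite sqrtr_gt0; lra.
have r2 : r ^+ 2 = n%:R by rewrite sqr_sqrtr//; lra.
have n2 : n.+2%:R <= (2 * r) ^+ 2 :> R.
  by rewrite exprMn r2 -addn2 natrD; lra.
apply: (@le_trans _ _ (ln ((2 * r) ^+ 2))).
  by rewrite ler_ln ?posrE ?ltr0n// exprn_gt0// mulr_gt0.
rewrite lnXn ?mulr_gt0// mulr2n.
have := @ln_leB1 R (2 * r); rewrite mulr_gt0// => /(_ isT); lra.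
Qed.

(** The hypothesis says that f n ^ (1/n) is a n^(-1/2) exp (d n) for n large, with
    d n tending to 0, since ln (n + 2) <= 4 sqrt n. *)
Lemma expR_equivalent (f : nat -> R) (a K : R) (N : nat) : 0 <= K -> 0 < a ->
  (forall n, (N <= n)%N -> (0 < n)%N -> 0 < f n /\
    `|ln (f n) / n%:R + ln n%:R / 2 - ln a| <= (K + K * ln n.+2%:R) / n%:R) ->
  (fun n => f n `^ n%:R^-1) ~_\oo (fun n => a * n%:R `^ (- 2^-1)).
Proof.
move=> K0 a0 H; apply/eqaddoP => e e0.
pose eta := ln (1 + e).
have eta0 : 0 < eta by apply: ln_gt0; lra.
near=> n.
have nN : (N <= n)%N by near: n; exact: nbhs_infty_ge.
have n0 : (0 < n)%N by near: n; exact: nbhs_infty_gt.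
have nb : ((5 * K) / eta) ^+ 2 <= n%:R by near: n; exact: nbhs_infty_ger.
have n0R : 1 <= n%:R :> R by rewrite ler1n.
have [fn0 Hn] := H n nN n0.
set dl := ln (f n) / n%:R + ln n%:R / 2 - ln a in Hn.
have fE : f n `^ n%:R^-1 = a * n%:R `^ (- 2^-1) * expR dl.
  rewrite /powR !gt_eqF//; last by lra.
  rewrite -[in RHS](@lnK R a) ?posrE// -!expRD /dl; congr expR.
  by field; rewrite pnatr_eq0 -lt0n.
rewrite /= -[(_ - _) n]/(f n `^ n%:R^-1 - a * n%:R `^ (- 2^-1)) fE.
rewrite -[X in _ - X]mulr1 -mulrBr normrM mulrC ler_wpM2r//.
have dle : `|dl| <= eta.
  apply: le_trans Hn _; rewrite ler_pdivrMr; last lra.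
  set r := Num.sqrt (n%:R : R).
  have r1 : 1 <= r by rewrite -sqrtr1 ler_sqrt//; lra.
  have r2 : r ^+ 2 = n%:R by rewrite sqr_sqrtr//; lra.
  have lnr := ln_natS_le n0.
  apply: (@le_trans _ _ (5 * K * r)).
    have : K * ln n.+2%:R <= K * (4 * r) by rewrite ler_wpM2l.
    have : K <= K * r by rewrite ler_peMr.
    by lra.
  have nr : (5 * K) / eta <= r.
    rewrite -(@ler_pXn2r _ 2)// ?nnegrE ?r2//; last lra.
    by rewrite divr_ge0// ?mulr_ge0// ltW.
  rewrite -r2 expr2 mulrA ler_wpM2r//; first lra.
  by rewrite -ler_pdivrMl// mulrC.
have ee : eta <= e by have := @ln_leB1 R (1 + e); rewrite /eta => h; lra.
rewrite ler_norml; move: dle; rewrite ler_norml => /andP[d1 d2]; apply/andP; split.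
  have := expR_ge1Dx dl; lra.
have : expR dl <= expR eta by rewrite ler_expR.
rewrite /eta lnK ?posrE; lra.
Unshelve. all: by end_near. Qed.

End asymptotics.

(** * The normalising size *)

Section base_size_asymptotics.
Variable R : realType.
Implicit Types x u : R.

Lemma ln_gammaD_lower x : 0 < x -> x * ln x - x <= ln (gammaD x).
Proof.
move=> x0; have := gammaD_lower (ltW x0); rewrite /powR gt_eqF// -expRD => h.
by rewrite -ler_expR lnK// posrE gammaD_gt0// ltW.
Qed.

Lemma ln_gammaD_upper x : 0 <= x ->
  ln (gammaD x) <= ln (x + 1) + (x * ln (x + 1) - x).
Proof.
move=> x0; have x1 : 0 < x + 1 by lra.
have := gammaD_upper x0; rewrite /powR gt_eqF// -expRD => h.
by rewrite -ler_expR lnK ?posrE ?gammaD_gt0// expRD lnK ?posrE.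
Qed.

Lemma ln_gammaD_ratio_ge x u : 1 <= x -> 0 <= u ->
  u * ln x + ln (gammaD x) <= ln (gammaD (x + u)).
Proof.
move=> x1 u0; have x0 : 0 < x by lra.
have gx : gammaD x \is Num.pos by rewrite posrE gammaD_gt0// ltW.
have gxu : gammaD (x + u) \is Num.pos by rewrite posrE gammaD_gt0// addr_ge0// ltW.
have := gammaD_ratio_ge x1 u0; rewrite /powR (gt_eqF x0) => h.
rewrite -ler_expR.
rewrite (expRD (u * ln x)).
by rewrite [X in _ * X <= _](lnK gx) [X in _ <= X](lnK gxu).
Qed.

Lemma ln_gammaD_ratio_le x u : 0 <= x -> 0 <= u ->
  ln (gammaD (x + u)) <= u * ln (x + u + 1) + ln (gammaD x).
Proof.
move=> x0 u0; have x1 : 0 < x + u + 1 by lra.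
have gx : gammaD x \is Num.pos by rewrite posrE gammaD_gt0.
have gxu : gammaD (x + u) \is Num.pos by rewrite posrE gammaD_gt0// addr_ge0.
have := gammaD_ratio_le x0 u0; rewrite /powR (gt_eqF x1) => h.
rewrite -ler_expR.
by rewrite (expRD (u * ln _)) [X in _ <= _ * X](lnK gx) [X in X <= _](lnK gxu).
Qed.

Lemma ln_sqrt x : 0 < x -> ln (Num.sqrt x) = ln x / 2.
Proof.
move=> x0; rewrite -[in RHS](@sqr_sqrtr _ x) ?ltW// lnXn ?sqrtr_gt0//.
by rewrite mulr2n; field.
Qed.

Lemma mul_ln_sub_le x y : 0 < x -> 0 < y -> x * (ln y - ln x) <= y - x.
Proof.
move=> x0 y0; have := ln_div_le x0 y0.
by rewrite ler_pdivlMr// mulrC.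
Qed.

Lemma mul_ln_succ_le x : 0 < x -> x * (ln (x + 1) - ln x) <= 1.
Proof.
move=> x0; have x1 : 0 < x + 1 by lra.
by apply: le_trans (mul_ln_sub_le x0 x1) _; lra.
Qed.

Lemma mul_ln_add_le x u : 0 < x -> 0 <= u <= 1 ->
  x * (ln (x + 2 * u + 1) - ln x) <= 3.
Proof.
move=> x0 u01; have x1 : 0 < x + 2 * u + 1 by lra.
by apply: le_trans (mul_ln_sub_le x0 x1) _; lra.
Qed.

Variable q : \bar R.
Hypothesis hq : (1 <= q)%E.
Local Notation t := (inv_exp q).

(** The limit of (ln (base_size n) + (n / 2) ln n) / n. *)
Definition base_rate : R :=
  ln (rel_moment q 2) / 2 - ln (coord_moment t 0) + 2^-1 - t.

Lemma base_size_gt0 n : 0 < base_size q n.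
Proof.
apply: divr_gt0; first by rewrite sqrtr_gt0 exprn_gt0// coord_var_gt0.
by apply: mulr_gt0; [rewrite sqrtr_gt0 ltr0n fact_gt0|exact: volK_gt0].
Qed.

Let ln_base_size_identity (n a b c e k : R) :
  n * (a + (b - c)) / 2 - (e / 2 + (n * k - b)) =
  n / 2 * (a + b - c) - e / 2 - n * k + b.
Proof. by field. Qed.

Let base_rate_identity (n a b c e k l u : R) :
  n / 2 * (a + b - c) - e / 2 - n * k + b + n * l / 2 - n * (a / 2 - k + 2^-1 - u) =
  n / 2 * (b - c) - e / 2 + b + n * l / 2 - n / 2 + n * u.
Proof. by field. Qed.

Let half_double (n u a : R) : n * u * a = n / 2 * (2 * u * a).
Proof. by field. Qed.

(** The estimate behind base_size_asymptotics, in generic reals: n and u are the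
    dimension and the inverse exponent, x = n u; a, a1, a3, l, l1, l2 are the
    logarithms of x, x + 1, x + 2 u + 1, n, n + 1, n + 2; and g, gx, gxu are
    those of gammaD n, gammaD x, gammaD (x + 2 u). *)
Let error_bound (n u x a a1 a3 l l1 l2 g gx gxu : R) :
  n * l - n <= g -> g <= l1 + (n * l1 - n) -> n * (l1 - l) <= 1 ->
  0 <= l1 -> l1 <= l2 -> a1 <= l2 ->
  x * a - x <= gx -> gx <= a1 + (x * a1 - x) ->
  x * (a1 - a) <= 1 -> x * (a3 - a) <= 3 ->
  x * a <= n / 2 * (gxu - gx) -> n / 2 * (gxu - gx) <= x * a3 ->
  n * u = x ->
  `|n / 2 * (gx - gxu) - g / 2 + gx + n * l / 2 - n / 2 + n * u| <= 4 + l2.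
Proof.
move=> h1 h2 h3 h4 h5 h6 h7 h8 h9 h10 h11 h12 ->.
by rewrite ler_norml; apply/andP; split; lra.
Qed.

Let error_bound0 (n l l1 l2 g : R) :
  n * l - n <= g -> g <= l1 + (n * l1 - n) -> n * (l1 - l) <= 1 ->
  0 <= l1 -> l1 <= l2 ->
  `|n / 2 * (0 - 0) - g / 2 + 0 + n * l / 2 - n / 2| <= 4 + l2.
Proof.
move=> h1 h2 h3 h4 h5.
by rewrite ler_norml; apply/andP; split; lra.
Qed.

Lemma ln_base_size n : ln (base_size q n) =
  n%:R / 2 * (ln (rel_moment q 2) + ln (gammaD (n%:R * t)) - ln (gammaD (n%:R * t + 2 * t)))
  - ln (gammaD n%:R) / 2 - n%:R * ln (coord_moment t 0) + ln (gammaD (n%:R * t)).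
Proof.
have t0 := inv_exp_ge0 hq.
have c0 := coord_moment_gt0 0 t0.
have g0 : 0 < gammaD (n%:R * t) by rewrite gammaD_gt0// mulr_ge0.
have g2 : 0 < gammaD ((n%:R + 2%:R) * t) by rewrite gammaD_gt0// mulr_ge0// addr_ge0.
have f0 : 0 < n`!%:R :> R by rewrite ltr0n fact_gt0.
have s0 := coord_var_gt0 hq n.
have v0 := volK_gt0 n hq.
have rp := rel_moment_gt0 hq 2; have gp := gamma_ratio_gt0 hq n 2.
have lnv : ln (volK n q) = n%:R * ln (coord_moment t 0) - ln (gammaD (n%:R * t)).
  by rewrite /volK (ln_div (exprn_gt0 n c0) g0) (lnXn n c0) -[ln _ *+ n]mulr_natl.
have lns : ln (coord_var q n) =
    ln (rel_moment q 2) + (ln (gammaD (n%:R * t)) - ln (gammaD (n%:R * t + 2 * t))).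
  rewrite /coord_var (lnM rp gp) /gamma_ratio (ln_div g0 g2).
  by have -> : (n%:R + 2%:R) * t = n%:R * t + 2 * t by exact: mulrDl.
have sf0 : 0 < Num.sqrt n`!%:R :> R by rewrite sqrtr_gt0.
have sn0 : 0 < coord_var q n ^+ n by rewrite exprn_gt0.
have ss0 : 0 < Num.sqrt (coord_var q n ^+ n) by rewrite sqrtr_gt0.
have sv0 := mulr_gt0 sf0 v0.
rewrite /base_size (ln_div ss0 sv0) (lnM sf0 v0) (ln_sqrt sn0) (ln_sqrt f0) (lnXn _ s0).
rewrite -gammaD_fact lnv -[ln _ *+ n]mulr_natl lns.
exact: ln_base_size_identity.
Qed.

(** If t > 0 then n t >= 1 for n large and the Gamma bounds apply at x = n t; if
    t = 0 the Gamma factors at n t are 1. *)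
Lemma base_size_asymptotics : exists N : nat, forall n, (N <= n)%N -> (0 < n)%N ->
  `|ln (base_size q n) + n%:R * ln n%:R / 2 - n%:R * base_rate| <= 4 + ln n.+2%:R.
Proof.
have t0 := inv_exp_ge0 hq.
have t01 := inv_exp_itv hq; have /andP[_ t1] := t01.
have key n : (0 < n)%N -> let x : R := n%:R * t in
    x = 0 \/ 1 <= x ->
    `|ln (base_size q n) + n%:R * ln n%:R / 2 - n%:R * base_rate| <= 4 + ln n.+2%:R.
  move=> n0 /= xx; have n0R : 1 <= n%:R :> R by rewrite ler1n.
  have -> : ln (base_size q n) + n%:R * ln n%:R / 2 - n%:R * base_rate =
      n%:R / 2 * (ln (gammaD (n%:R * t)) - ln (gammaD (n%:R * t + 2 * t)))
      - ln (gammaD n%:R) / 2 + ln (gammaD (n%:R * t)) + n%:R * ln n%:R / 2 - n%:R / 2 + n%:R * t.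
    by rewrite ln_base_size; exact: base_rate_identity.
  have n0' : 0 < n%:R :> R by lra.
  have h3 := mul_ln_succ_le n0'.
  have n2E : n.+2%:R = n%:R + 2 :> R by rewrite -addn2 natrD.
  have l1 : 0 <= ln (n%:R + 1) :> R by apply: ln_ge0; lra.
  have l2 : ln (n%:R + 1) <= ln n.+2%:R :> R by rewrite ler_ln ?posrE ?n2E; lra.
  have h1 := ln_gammaD_lower n0'.
  have h2 := ln_gammaD_upper (ltW n0').
  case: xx => [x0|x1].
    have -> : t = 0.
      by move/eqP: x0; rewrite mulf_eq0 gt_eqF// => /eqP.
    rewrite !mulr0 !addr0 gammaD0 ln1.
    exact: error_bound0 h1 h2 h3 l1 l2.
  set x := n%:R * t in x1 *.
  have x0 : 0 < x by exact: lt_le_trans x1.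
  have u0 : 0 <= 2 * t :> R by rewrite mulr_ge0.
  have h4 := ln_gammaD_lower x0.
  have h5 := ln_gammaD_upper (ltW x0).
  have h6 := ln_gammaD_ratio_ge x1 u0.
  have h7 := ln_gammaD_ratio_le (ltW x0) u0.
  have h8 := mul_ln_succ_le x0.
  have h9 := mul_ln_add_le x0 t01.
  have x1' : 0 < x + 1 by rewrite addr_gt0.
  have l3 : ln (x + 1) <= ln n.+2%:R.
    have xn : x <= n%:R by rewrite /x ler_piMr.
    rewrite ler_ln ?posrE// n2E; apply: lerD => //.
    by rewrite ler1n.
  have n20 : 0 < n%:R / 2 :> R by rewrite divr_gt0.
  apply: (error_bound h1 h2 h3 l1 l2 l3 h4 h5 h8 h9); last by [].
    have -> : x * ln x = n%:R / 2 * (2 * t * ln x) by rewrite /x; exact: half_double.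
    by rewrite (ler_pM2l n20) lerBrDr.
  have -> : x * ln (x + 2 * t + 1) = n%:R / 2 * (2 * t * ln (x + 2 * t + 1)).
    by rewrite /x; exact: half_double.
  by rewrite (ler_pM2l n20) lerBlDr.
have [t00|tn0] := eqVneq t 0.
  by exists 0%N => n _ n0; apply: key => //; left; rewrite t00 mulr0.
exists (Num.truncn t^-1).+1 => n nN n0; apply: key => //; right.
have tp : 0 < t by rewrite lt_def tn0.
rewrite -ler_pdivrMr// div1r; apply: (@le_trans _ _ (Num.truncn t^-1).+1%:R).
  exact/ltW/truncnS_gt.
by rewrite ler_nat.
Qed.

Let ln_alpha_identity (u g1 g3 : R) : 0 < g1 -> 0 < g3 ->
  ln (expR (1 - 2 * u) * g3 / (3 * g1 ^+ 3)) / 2 =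
  ln 2 + (ln (g3 * (2 / 3) / (g1 * 2)) / 2 - ln (g1 * 2) + 2^-1 - u).
Proof.
move=> p1 p3.
have g2 : 0 < g1 * 2 by rewrite mulr_gt0.
have -> : g3 * (2 / 3) / (g1 * 2) = g3 / (3 * g1) by field; rewrite gt_eqF.
have d3 : 0 < 3 * g1 by rewrite mulr_gt0.
have d4 : 0 < 3 * g1 ^+ 3 by rewrite mulr_gt0// exprn_gt0.
have e0 := expR_gt0 (1 - 2 * u).
rewrite (ln_div (mulr_gt0 e0 p3) d4) (lnM e0 p3) expRK (ln_div p3 d3).
have t3 : 0 < 3 :> R by []. have t2 : 0 < 2 :> R by [].
rewrite (lnM t3 (exprn_gt0 3 p1)) (lnM t3 p1) (lnM p1 t2) (lnXn _ p1) -mulr_natl.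
by field.
Qed.

Lemma alpha_base_rate : 0 < alpha t /\ ln (alpha t) / 2 = ln 2 + base_rate.
Proof.
have t0 := inv_exp_ge0 hq.
have g1 : 0 < gammaD t by exact: gammaD_gt0.
have t3 : 0 <= 3 * t :> R by rewrite mulr_ge0.
have g3 := gammaD_gt0 t3.
rewrite /alpha -!gammaDE; split.
  exact: (divr_gt0 (mulr_gt0 (expR_gt0 _) g3) (mulr_gt0 (ltr0Sn R 2) (exprn_gt0 3 g1))).
have e2 : (1 + 2%:R) * t = 3 * t by rewrite nat1r.
have e3 : 2%:R + 1 = 3 :> R by rewrite natr1.
rewrite /base_rate /rel_moment /coord_moment !addr0 !mul1r !add0r divr1 e2 e3.
exact: ln_alpha_identity.
Qed.

End base_size_asymptotics.

(** * Conclusion *)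

Section root_asymptotics.
Variables (R : realType) (q : \bar R).
Hypothesis hq : (1 <= q)%E.

(** For M polynomial in n the error is O(ln n). *)
Lemma ln_two_sided (W M v : R) : 0 < W -> 1 <= M ->
  W / (2 * Num.sqrt M) <= v <= W * (1 + M) ->
  0 < v /\ `|ln v - ln W| <= 1 + ln M.
Proof.
move=> W0 M1 /andP[v1 v2].
have M0 : 0 < M by lra.
have r0 : 0 < Num.sqrt M by rewrite sqrtr_gt0.
have d0 : 0 < 2 * Num.sqrt M by rewrite mulr_gt0.
have v0 : 0 < v by apply: lt_le_trans v1; exact: divr_gt0.
split => //.
have l2 : ln (2 : R) <= 1 by have := @ln_leB1 R 2 (ltr0Sn R 1); lra.
have lM : 0 <= ln M by exact: ln_ge0.
have h1 : ln W - (ln 2 + ln M / 2) <= ln v.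
  rewrite -(ln_sqrt M0) -lnM ?posrE// -ln_div ?posrE// ler_ln ?posrE//.
  exact: divr_gt0.
have h2 : ln v <= ln W + (ln 2 + ln M).
  rewrite -!lnM ?posrE ?mulr_gt0// ler_ln ?posrE ?mulr_gt0//.
  by apply: le_trans v2 _; rewrite ler_pM2l//; lra.
by rewrite ler_norml; apply/andP; split; lra.
Qed.

(** The common conclusion for the two polytopes: lambda is the exponential rate of
    the prefactor of base_size, which is ln 2 for the symmetric hull and 0 for the
    hull of n + 1 points. *)
Lemma root_equivalent (lambda a : R) (v : nat -> R) : 0 < a ->
  ln a = lambda + base_rate q ->
  (forall n, (0 < n)%N -> 0 < v n /\
    `|ln (v n) - (n%:R * lambda + ln (base_size q n))| <=
      1 + (growth_exp q).+1%:R * ln n.+2%:R) ->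
  (fun n => v n `^ n%:R^-1) ~_\oo (fun n => a * n%:R `^ (- 2^-1)).
Proof.
move=> a0 la H.
have [N HN] := base_size_asymptotics hq.
apply: (@expR_equivalent R v a ((growth_exp q).+1%:R + 5) N) => //.
move=> n nN n0; have [v0 Hv] := H n n0; have Hb := HN n nN n0; split => //.
have n0R : 0 < n%:R :> R by rewrite ltr0n.
rewrite ler_pdivlMr// -[X in _ * X]gtr0_norm// -normrM.
have -> : (ln (v n) / n%:R + ln n%:R / 2 - ln a) * n%:R =
    (ln (v n) - (n%:R * lambda + ln (base_size q n))) +
    (ln (base_size q n) + n%:R * ln n%:R / 2 - n%:R * base_rate q).
  by rewrite la; field; rewrite gt_eqF.
apply: le_trans (ler_normD _ _) _.
have l0 : 0 <= ln n.+2%:R :> R by apply: ln_ge0; rewrite ler1n.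
have C0 : 0 <= (growth_exp q).+1%:R :> R by [].
lra.
Qed.

(** Absorbs into the error term the prefactor sqrt (n + 1) of the hull of n + 1
    points. *)
Lemma absorb_half (lv a b c l : R) : 0 <= a -> a <= l ->
  `|lv - (a / 2 + b)| <= 1 + c * l -> `|lv - b| <= 1 + (c + 1) * l.
Proof.
rewrite !ler_norml => a0 al /andP[h1 h2]; apply/andP; split; lra.
Qed.

End root_asymptotics.

Theorem mainTheorem3 (R : realType) (p : R) (q : \bar R)
    (hp : 1 <= p <= 4) (hq : (1 <= q)%E) :
  (forall (d : nat -> measure_display) (T : forall n, measurableType (d n))
      (P : forall n, probability (T n) R)
      (X : forall n, 'I_n -> {RV (P n) >-> n.-tuple R}),
    (forall n, iid_uniform_in (lq_ball n q) (X n)) ->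
    (fun n => fine ('N[P n]_(p%:E)[V_ (lq_ball n q) (X n)])%E `^ n%:R^-1)
    ~_\oo
    (fun n => Num.sqrt (alpha (fine (q^-1)%E)) * n%:R `^ (- 2^-1)))
  /\
  (forall (d : nat -> measure_display) (T : forall n, measurableType (d n))
      (P : forall n, probability (T n) R)
      (X : forall n, 'I_n.+1 -> {RV (P n) >-> n.-tuple R}),
    (forall n, iid_uniform_in (lq_ball n q) (X n)) ->
    (fun n => fine ('N[P n]_(p%:E)[U_ (lq_ball n q) (X n)])%E `^ n%:R^-1)
    ~_\oo
    (fun n => 2^-1 * Num.sqrt (alpha (fine (q^-1)%E)) * n%:R `^ (- 2^-1))).
Proof.
rewrite -/(inv_exp q).
have [a0 la] := alpha_base_rate hq.
have ln_nat k (n : nat) : (k <= n)%N -> ln k.+1%:R <= ln n.+1%:R :> R.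
  by move=> kn; rewrite ler_ln ?posrE ?ltr0n// ler_nat.
have ln_nat0 k : 0 <= ln k.+1%:R :> R by apply: ln_ge0; rewrite ler1n.
split=> d T P X iX.
- apply: (root_equivalent hq (lambda := ln 2)).
  + by rewrite sqrtr_gt0.
  + by rewrite ln_sqrt.
  move=> n n0; have [v -> vb] := V_bounds hq n0 hp (iX n).
  have M1 : 1 <= n.+1%:R ^+ growth_exp q :> R by rewrite exprn_ege1// ler1n.
  have B0 := base_size_gt0 hq n.
  have W0 : 0 < 2 ^+ n * base_size q n by rewrite mulr_gt0// exprn_gt0.
  have [v0 vln] := ln_two_sided W0 M1 vb; split => //=.
  move: vln; rewrite lnM ?posrE ?exprn_gt0// lnXn// mulr_natl => h; apply: le_trans h _.
  rewrite lerD2l lnXn ?ltr0n// -[ln _ *+ _]mulr_natl; apply: ler_pM => //.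
    by rewrite ler_nat.
  exact: ln_nat.
- apply: (root_equivalent hq (lambda := 0)).
  + by rewrite mulr_gt0// sqrtr_gt0.
  + rewrite lnM ?posrE ?sqrtr_gt0// ln_sqrt// la lnV ?posrE//; lra.
  move=> n n0; have [v -> vb] := U_bounds hq hp (iX n).
  have M1 : 1 <= n.+2%:R ^+ growth_exp q :> R by rewrite exprn_ege1// ler1n.
  have B0 := base_size_gt0 hq n.
  have s0 : 0 < Num.sqrt n.+1%:R :> R by rewrite sqrtr_gt0.
  have W0 : 0 < Num.sqrt n.+1%:R * base_size q n by exact: mulr_gt0.
  have [v0 vln] := ln_two_sided W0 M1 vb; split => //=.
  move: vln; rewrite lnM ?posrE// ln_sqrt// lnXn// -[ln _ *+ _]mulr_natl mulr0 add0r.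
  rewrite -[(growth_exp q).+1%:R]natr1.
  exact: absorb_half (ln_nat0 n) (ln_nat n n.+1 (leqnSn n)).
Qed.
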